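(* Let $0<\beta<1$, let $J$ be a function satisfying (A1)–(A3) of the context (with constant $a_0>0$), and let $\theta\in\Theta$, $\theta\ne0$, be such that $a_0I(\mu(\theta))\le1$. Consider the test of $H_0:\epsilon_n=0$ versus $H_1:\epsilon_n=n^{-\beta}$, where the sample sizes $K_{in}$, $1\le i\le n$, are i.i.d. with rate function $J$ (i.e. satisfying (A3)) and, conditionally on the sample sizes, the $Y_{in}$ are independent with $$Y_{in}\sim(1-\epsilon_n)F_0^{K_{in}}+\epsilon_nF_\theta^{K_{in}},\qquad 1\le i\le n.$$ If $\beta>b_J(\theta)$ then all test statistics are asymptotically powerless. If $\beta<b_J(\theta)$ then the threshold higher criticism test statistic ${\rm HC}_n^{\rm thres}$ is asymptotically powerful.
   Context: Exponential family: $\{F_\theta\}_{\theta\in\Theta}$ are distributions on $\mathbb{R}$ with $dF_\theta(x)=e^{\theta x-\psi(\theta)}dF_0(x)$, where $e^{\psi(\theta)}=E_0e^{\theta X}$ ($X\sim F_0$) and $\Theta=\{\theta:\psi(\theta)<\infty\}$. $\mu(\theta)=\psi'(\theta)$ and $I(\nu)=\sup_{\theta\in\Theta}[\theta\nu-\psi(\theta)]$. $F^k$ denotes the $k$-fold convolution of $F$. Sample sizes: for each $n$, $K_{1n},\dots,K_{nn}$ are i.i.d. positive-integer-valued and observed, and $J$ is a function on $[0,\infty)$ such that: (A1) there exists $a_0>0$ such that $J(a)=0$ for $0\le a\le a_0$; (A2) $J'(a)$ is continuous and strictly increasing on $[a_0,\infty)$, with $J'(a_0)=0$ and $\lim_{a\to\infty}J'(a)=\infty$;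 (A3) $P(K_{in}=k)=\alpha_{kn}n^{-J(k/\log n)}$ with $\sup_{k\ge\lambda_n}\tfrac{|\log\alpha_{kn}|}{k}\to0$ as $n\to\infty$, where $\lambda_n=a_0\log n$. Data: a test statistic may depend on $(K_{in},Y_{in})_{1\le i\le n}$. Phase transition curve: let $g(\nu,a)=aI(\nu)+J(a)$ and $f_\theta(\nu,a)=a[\theta\nu-\psi(\theta)]+\tfrac12[1-g(\nu,a)]$. For $\theta$ with $a_0I(\mu(\theta))\le1$, $$b_J(\theta)=\max_{(\nu,a):\,g(\nu,a)\le1}f_\theta(\nu,a),$$ the maximum being over $\nu\in\mathbb{R}$, $a>0$. P-values: conditionally on $K_{in}$, $p_i$ is the two-sided p-value of $Y_{in}$, that is, two times the upper or lower tail probability of $Y_{in}$ under $F_0^{K_{in}}$, whichever is smaller. When $F_0$ is discrete the p-values are randomized so that $p_i\sim{\rm Uniform}(0,1)$ under the $i$th null; concretely, $p_i=2\min(T_i,1-T_i)$ with $T_i=P_0(Y>Y_{in})+V_iP_0(Y=Y_{in})$ where $Y\sim F_0^{K_{in}}$ is taken independent of $Y_{in}$ given $K_{in}$ and $V_i$ are independent auxiliary Uniform$(0,1)$ variables. Threshold higher criticism: for $k\ge1$ let $A_k=\{i:K_{in}\ge k\}$, $n_k=\#A_k$, and let $p_{(i)k}$ be the $i$th smallest p-value among $\{p_i:i\in A_k\}$. Define $${\rm HC}_{kn}=\max_{1\le i\le n_k/2}\frac{i-n_kp_{(i)k}}{\sqrt{n_kp_{(i)k}(1-p_{(i)k})}},\qquad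 {\rm HC}_n^{\rm thres}=\max_{k\ge1}{\rm HC}_{kn},$$ where values of $k$ with $n_k<2$ (empty maximum) are ignored. Risk: $P_0,P_1$ denote probability under $H_0,H_1$. For a test statistic $T$, ${\rm Risk}(T)=\inf_c[P_0(T\ge c)+P_1(T<c)]$; if $T$ is stochastically smaller under $H_1$ than under $H_0$, the inequalities are reversed. A sequence $T_n$ is asymptotically powerful if ${\rm Risk}(T_n)\to0$ and asymptotically powerless if ${\rm Risk}(T_n)\to1$ as $n\to\infty$.
   Formalization: F_0 is assumed not to be a point mass: for a point mass all F_θ coincide and b_J(θ)=1/2, so H_0 and H_1 are identical and the claim of asymptotic power for β<1/2 would be false. *)

(* Defs.v *)
From HB Require Import structures.
From mathcomp Require Import all_boot all_order all_algebra.
From mathcomp Require Import all_classical all_reals all_analysis.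

Set Implicit Arguments.
Unset Strict Implicit.
Unset Printing Implicit Defensive.

Import Order.TTheory GRing.Theory Num.Theory.
Import numFieldNormedType.Exports.

Local Open Scope classical_set_scope.
Local Open Scope ring_scope.

Section Convolution.
Context {R : realType}.

Definition addpair (z : R * R) : R := z.1 + z.2.

Lemma measurable_addpair : measurable_fun [set: R * R] addpair.
Proof.
apply: measurable_realfun.measurable_funD; first exact: measurable_fst.
exact: measurable_snd.
Qed.

HB.instance Definition _ :=
  isMeasurableFun.Build _ _ (R * R)%type R addpair measurable_addpair.

(* Law of X + Y for independent X ~ F and Y ~ G. *)
Definition convolution (F G : probability R R) : probability R R :=
  distribution (F \x G)%E addpair.

Fixpoint conv_pow (F : probability R R) (k : nat) : probability R R :=
  if k is k'.+1 then convolution F (conv_pow F k') else \d_(0 : R).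

End Convolution.

Section ExponentialFamily.
Context {R : realType}.
Variable F0 : probability R R.

Definition natural_space : set R := [set t | ('M_F0 (idfun : R -> R) t < +oo)%E].

Definition psi (t : R) : R := ln (fine ('M_F0 (idfun : R -> R) t)%E).

(* The difference quotient is taken inside the natural parameter space, so that
   at an interior point this is the ordinary derivative, and at an end point
   belonging to the space it is the one-sided derivative. *)
Definition psi_slope (t : R) : set_system R :=
  (psi s - psi t) / (s - t) @[s --> within natural_space t^'].

Definition psi_derivable (t : R) : Prop := cvg (psi_slope t).

Definition mu (t : R) : R := lim (psi_slope t).

Definition rate_I (nu : R) : \bar R :=
  ereal_sup [set (t * nu - psi t)%:E | t in natural_space].

Definition curve_g (J : R -> R) (nu a : R) : \bar R :=
  (a%:E * rate_I nu + (J a)%:E)%E.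

Definition curve_f (J : R -> R) (t nu a : R) : \bar R :=
  ((a * (t * nu - psi t))%:E + 2^-1%:E * (1 - curve_g J nu a))%E.

(* The maximum of the curve function; when a_0 I(mu(t)) <= 1 it is attained, so
   it coincides with this supremum. *)
Definition b_curve (J : R -> R) (t : R) : \bar R :=
  ereal_sup [set curve_f J t z.1 z.2 |
    z in [set z : R * R | 0 < z.2 /\ (curve_g J z.1 z.2 <= 1)%E]].

End ExponentialFamily.

(* F t is unconstrained when t lies outside the natural parameter space. *)
Definition exponential_family {R : realType}
    (F : R -> probability R R) : Prop :=
  forall t, natural_space (F 0) t ->
  forall A : set R, measurable A ->
    F t A = (\int[F 0%R]_(x in A) (expR (t * x - psi (F 0) t))%:E)%E.

Definition rate_vanishes {R : realType} (a0 : R) (J : R -> R) : Prop :=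
  forall a, 0 <= a <= a0 -> J a = 0.

Definition rate_derivative {R : realType} (a0 : R) (J : R -> R) : Prop :=
  [/\ forall a, a0 <= a -> derivable J a 1,
      {within `[a0, +oo[, continuous (derive1 J)},
      {in `[a0, +oo[ &, {homo (derive1 J) : a b / a < b}},
      derive1 J a0 = 0 &
      derive1 J a @[a --> +oo] --> +oo].

(* Q n is the common law of K_{1n}, ..., K_{nn}.  The logarithm [lne] is
   -oo at 0, so the last clause forces alpha n k > 0 for k >= a0 log n and n
   large. *)
Definition sizes_follow_rate {R : realType} (a0 : R) (J : R -> R)
    (Q : nat -> probability nat R) (alpha : nat -> nat -> R) : Prop :=
  (forall n k, (0 < k)%N ->
     Q n [set k] = (alpha n k * n%:R `^ (- J (k%:R / ln n%:R)))%:E) /\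
  ereal_sup [set (`|lne (alpha n k)%:E| * (k%:R^-1)%:E)%E |
               k in [set k : nat | a0 * ln n%:R <= k%:R]]
    @[n --> \oo] --> (0%:E : \bar R).

(* Joint law of (K_i, Y_i, V_i)_{i < n} under P: the K_i are i.i.d. with law Q;
   given the K_i, the Y_i are independent with Y_i of law
   (1 - eps) F0^{K_i} + eps F1^{K_i}; the V_i are independent uniform variables,
   independent of all the (K_i, Y_i). *)
Record mixture_sample {R : realType} (F0 F1 : probability R R)
    (Q : probability nat R) (eps : R) (n : nat)
    (d : measure_display) (Omega : measurableType d) (P : probability Omega R)
    (K : 'I_n -> {mfun Omega >-> nat})
    (Y V : 'I_n -> {mfun Omega >-> R}) : Prop := MixtureSample {
  sizes_iid : forall k : 'I_n -> nat,
    P [set w | forall i, K i w = k i] = (\prod_(i < n) Q [set k i])%E ;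
  data_given_sizes : forall (k : 'I_n -> nat) (B : 'I_n -> set R),
    (forall i, measurable (B i)) ->
    P [set w | forall i, K i w = k i /\ B i (Y i w)] =
    (P [set w | forall i, K i w = k i] *
     \prod_(i < n) ((1 - eps)%:E * conv_pow F0 (k i) (B i) +
                    eps%:E * conv_pow F1 (k i) (B i)))%E ;
  aux_uniform : forall (k : 'I_n -> nat) (B C : 'I_n -> set R),
    (forall i, measurable (B i)) -> (forall i, measurable (C i)) ->
    P [set w | forall i, [/\ K i w = k i, B i (Y i w) & C i (V i w)]] =
    (P [set w | forall i, K i w = k i /\ B i (Y i w)] *
     \prod_(i < n) uniform_prob (@ltr01 R) (C i))%E }.

(* Randomized two-sided p-value of y, with v the value of the auxiliary uniform
   variable; v plays no role when the null law has no atom at y. *)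
Definition pvalue {R : realType} (F0 : probability R R)
    (k : nat) (y v : R) : R :=
  let T := fine (conv_pow F0 k `]y, +oo[%classic) + v * fine (conv_pow F0 k [set y]) in
  2 * Num.min T (1 - T).

Section HigherCriticism.
Context {R : realType} {n : nat}.
Variables (K : 'I_n -> nat) (p : 'I_n -> R).

Definition sorted_pvalues (k : nat) : seq R :=
  sort <=%R [seq p i | i <- enum 'I_n & (k <= K i)%N].

Definition n_above (k : nat) : nat := #|[set i | (k <= K i)%N]%SET|.

(* The order statistics are numbered from 1. *)
Definition hc_term (k i : nat) : R :=
  let pi := nth 0 (sorted_pvalues k) i.-1 in
  let nk := (n_above k)%:R in
  (i%:R - nk * pi) / Num.sqrt (nk * pi * (1 - pi)).

(* In the two maxima below the initial value is one of the competing terms as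
   soon as n_k >= 2, resp. n >= 2 (all K i being positive); beyond the largest
   K i one has n_k = 0. *)
Definition HC (k : nat) : R :=
  \big[Num.max/hc_term k 1]_(1 <= i < (n_above k)./2.+1) hc_term k i.

Definition HC_thres : R :=
  \big[Num.max/HC 1]_(1 <= k < (\max_(i < n) K i).+1 | (2 <= n_above k)%N) HC k.

End HigherCriticism.

Section Risk.
Context {R : realType} {d : measure_display} {Omega : measurableType d}.
Variables (P0 P1 : probability Omega R) (T : Omega -> R).

Definition stoch_smaller : Prop :=
  forall c, (P1 [set w | c < T w]%R <= P0 [set w | c < T w]%R)%E.

Definition risk : \bar R :=
  if `[< stoch_smaller >]
  then ereal_inf (range (fun c =>
         P0 [set w | T w <= c]%R + P1 [set w | c < T w]%R)%E)
  else ereal_inf (range (fun c =>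
         P0 [set w | c <= T w]%R + P1 [set w | T w < c]%R)%E).

End Risk.

Section Asymptotics.
Context {R : realType} {d : nat -> measure_display}
  {Omega : forall n, measurableType (d n)}.
Variables (P0 P1 : forall n, probability (Omega n) R)
  (T : forall n, Omega n -> R).

Definition asymptotically_powerful : Prop :=
  risk (@P0 n) (@P1 n) (@T n) @[n --> \oo] --> (0%:E : \bar R).

Definition asymptotically_powerless : Prop :=
  risk (@P0 n) (@P1 n) (@T n) @[n --> \oo] --> (1%:E : \bar R).

End Asymptotics.

(* Main.v *)
Require Import Defs.
From HB Require Import structures.
From mathcomp Require Import all_boot all_order all_algebra.
From mathcomp Require Import all_classical all_reals all_analysis.
From mathcomp Require Import measurable_realfun.
From mathcomp Require Import ring lra.

Set Implicit Arguments.
Unset Strict Implicit.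
Unset Printing Implicit Defensive.

Import Order.TTheory GRing.Theory Num.Theory.
Import numFieldNormedType.Exports.

Local Open Scope classical_set_scope.
Local Open Scope ring_scope.

(** Everything happens on a logarithmic scale: a sample size is [a * log n], with
    probability about [n ^ (- J a)], and an observation of that size near
    [nu * a * log n] has null probability about [n ^ (- a * I(nu))] and
    likelihood ratio [n ^ (a * (theta * nu - psi theta))].  A point [(nu, a)] is
    visible when the expected number of such observations from the mixture
    component, of exponent [1 - beta - g + a * (theta * nu - psi theta)] with
    [g = a * I(nu) + J a <= 1], exceeds the standard deviation
    [n ^ ((1 - g) / 2)] of the null count; this is
    [beta < f_theta (nu, a)].  Hence the curve is the supremum of [f_theta].

    Above the curve, the likelihood ratio [lr] of one observation is truncated
    where [e * lr > 1], with [e = n ^ (- beta)].  The truncation is controlled by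
    the mean of [min (e * lr) ((e * lr) ^ 2)], which is at most any moment
    [e ^ s * lr ^ s] with [1 <= s <= 2].  At relative size [a], the sum over the
    sample of such a moment has exponent [moment_exponent], and convex duality
    ([curve_point_of_moments], [moment_of_b_curve_lt]) says that above the curve
    some order [s] makes it negative: otherwise a line separating the exponents
    from zero yields a point of the curve.  By compactness in [a] the truncation
    cost is [o(1 / n)] ([trunc_cost_integral_small]), so the product of the
    truncated ratios has first and second moments tending to one, total
    variation tends to zero ([test_errors_ge]) and no test does better than
    guessing ([powerless_above_curve]).

    Under the null hypothesis, the randomized p-values are uniform given the
    sizes ([randomized_tail_uniform]).  A large term of the statistic forces many
    small p-values among the large sizes ([count_of_hc_term]), which a Chernoff
    bound makes unlikely ([count_upper_tail]); a union bound over the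
    [O (log n)] lower bounds on the sizes and all ranks keeps the statistic below
    [(log n) ^ 2] ([null_HC_thres_small]).

    Below the curve, choose a visible point ([point_of_lt_b_curve]).  All sums in
    a window around [k * nu] have p-values about [expR (- k * I(nu))]
    ([pval_window]), and the probability of the window under the alternative is
    bounded below by [cramer_lower_bound] and the density.  So at one threshold
    and one lower bound on the sizes, the number of small p-values exceeds its
    null value by a power of [n] times the standard deviation
    ([count_lower_tail]), and the statistic exceeds [2 * (log n) ^ 2]
    ([alternative_HC_thres_large]).  Separation at [(log n) ^ 2] makes the risk
    vanish ([powerful_of_separation]).

    Since the sizes are random, independence enters in one form throughout: the
    expectation of a product of functions of single observations is the product
    of the expectations ([mixture_sample_expectation]). *)

(** * Integration along simple functions and powers of convolution *)

Section WeightedIntegral.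
Local Open Scope ereal_scope.
Context d d' (W : measurableType d) (T : measurableType d') (R : realType).
Variables (m : {measure set W -> \bar R}) (rho : {measure set T -> \bar R}).
Variables (Z : W -> T) (g : W -> R) (c : R).
Hypotheses (mZ : measurable_fun setT Z) (mg : measurable_fun setT g).
Hypothesis g0 : forall w, (0 <= g w)%R.
Hypothesis weightE : forall A, measurable A ->
  \int[m]_w (g w * \1_A (Z w))%:E = c%:E * rho A.

Import HBNNSimple.

(** Linearity over the finitely many levels of a simple function. *)
Let weight_nnsfun (f : {nnsfun T >-> R}) :
  \int[m]_w (g w * f (Z w))%:E = c%:E * \int[rho]_x (f x)%:E.
Proof.
have mA r : measurable (f @^-1` [set r]) by exact: measurable_funPTI.
have fE x : (f x)%:E = \sum_(k \in range f) (k * \1_(f @^-1` [set k]) x)%:E.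
  by rewrite [in LHS](fimfunE f) -fsumEFin.
under [X in _ = _ * X]eq_integral do rewrite fE.
rewrite ge0_integral_fsum//; last 2 first.
- by move=> y; exact/measurable_EFinP/measurable_funM.
- by move=> y x _; rewrite nnfun_muleindic_ge0.
rewrite ge0_mule_fsumr; last first.
  by move=> r; apply: integral_ge0 => x _; rewrite nnfun_muleindic_ge0.
have -> : \int[m]_w (g w * f (Z w))%:E =
  \int[m]_w (\sum_(k \in range f)
    (g w)%:E * (k * \1_(f @^-1` [set k]) (Z w))%:E).
  apply: eq_integral => w _; rewrite EFinM fE ge0_mule_fsumr//.
  by move=> r; rewrite nnfun_muleindic_ge0.
rewrite ge0_integral_fsum//; last 2 first.
- move=> y; apply: emeasurable_funM; first exact/measurable_EFinP.
  apply/measurable_EFinP.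
  by apply: measurable_funM => //; apply: measurableT_comp.
- move=> y x _; apply: mule_ge0; first by rewrite lee_fin.
  by rewrite nnfun_muleindic_ge0.
apply: eq_fsbigr => r _.
have [r0|r0] := leP 0%R r; last first.
  have -> : f @^-1` [set r] = set0 by rewrite preimage_nnfun0.
  rewrite indic0.
  under eq_integral do rewrite mulr0 mule0.
  under [X in _ = _ * X]eq_integral do rewrite mulr0.
  by rewrite !integral0 mule0.
rewrite integralZl_indic_nnsfun// integral_indic// setIT.
transitivity (\int[m]_w (r%:E * (g w * \1_(f @^-1` [set r]) (Z w))%:E)).
  by apply: eq_integral => w _; rewrite -!EFinM mulrCA.
rewrite ge0_integralZl//; last 2 first.
- apply/measurable_EFinP; apply: measurable_funM => //.
  by apply: measurableT_comp.
- by move=> x _; rewrite lee_fin mulr_ge0.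
by rewrite weightE// muleCA.
Qed.

(** Two nonnegative functionals that agree on indicators agree on all
    nonnegative measurable functions: this is monotone convergence along simple
    functions.  It serves both for changes of density ([Z] the identity) and to
    factor the expectation of a product of independent terms. *)
Lemma weighted_integral (h : T -> \bar R) : measurable_fun setT h ->
  (forall x, 0 <= h x) ->
  \int[m]_w ((g w)%:E * h (Z w)) = c%:E * \int[rho]_x h x.
Proof.
move=> mh h0.
pose f_ := nnsfun_approx measurableT mh.
have cvf x : EFin \o f_^~ x @ \oo --> h x by exact: cvg_nnsfun_approx.
have nd x : nondecreasing_seq (fun n => (f_ n x)%:E).
  by move=> a b ab; rewrite lee_fin; exact/lefP/nd_nnsfun_approx.
have rE : \int[rho]_x h x = limn (fun n => \int[rho]_x (f_ n x)%:E).
  rewrite -monotone_convergence//.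
  - by apply: eq_integral => x _; apply/esym/cvg_lim => //; exact: cvf.
  - by move=> n; exact/measurable_EFinP/measurable_funP.
  - by move=> n y _; rewrite lee_fin.
have cvr : (fun n => \int[rho]_x (f_ n x)%:E) @ \oo --> \int[rho]_x h x.
  rewrite rE; apply: ereal_nondecreasing_is_cvgn => a b ab.
  apply: ge0_le_integral => //.
  - by move=> *; rewrite lee_fin.
  - exact/measurable_EFinP/measurable_funP.
  - exact/measurable_EFinP/measurable_funP.
  - by move=> x _; exact: nd.
have -> : \int[m]_w ((g w)%:E * h (Z w)) =
    limn (fun n => \int[m]_w ((g w)%:E * (f_ n (Z w))%:E)).
  rewrite -monotone_convergence//.
  - apply: eq_integral => w _; apply/esym/cvg_lim => //.
    exact: cvgeZl (cvf (Z w)).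
  - move=> n; apply: emeasurable_funM; apply/measurable_EFinP => //.
    by apply: measurableT_comp.
  - by move=> n y _; apply: mule_ge0; rewrite lee_fin.
  - by move=> y _ a b ab; apply: lee_wpmul2l; [rewrite lee_fin|exact: nd].
apply/cvg_lim => //.
rewrite (_ : (fun n => _) = (fun n => c%:E * \int[rho]_x (f_ n x)%:E)); last first.
  by apply/funext => n; rewrite -weight_nnsfun; apply: eq_integral.
by apply: cvgeZl.
Qed.

End WeightedIntegral.

Lemma integral_indicT d (T : measurableType d) (R : realType)
  (mu : {measure set T -> \bar R}) (A : set T) : measurable A ->
  (\int[mu]_x (\1_A x)%:E = mu A)%E.
Proof. by move=> mA; rewrite integral_indic// setIT. Qed.

Lemma integral_cst_probability d (T : measurableType d) (R : realType)
  (P : probability T R) (c : R) : (\int[P]_x c%:E = c%:E)%E.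
Proof.
rewrite -[RHS]mule1 -(@probability_setT _ _ _ P).
exact: (@integral_cst _ _ _ P setT measurableT c%:E).
Qed.

Section Convolution.
Local Open Scope ereal_scope.
Context {R : realType}.
Implicit Types (F G : probability R R) (h : R -> \bar R).

Lemma integral_convolution F G h : measurable_fun setT h ->
  (forall x, 0 <= h x) ->
  \int[convolution F G]_z h z = \int[F]_x \int[G]_y h (x + y)%R.
Proof.
move=> mh h0; rewrite /convolution ge0_integral_distribution//.
rewrite (@fubini_tonelli1 _ _ _ _ _ F G)//; last by move=> x; exact: h0.
by apply: measurableT_comp => //; exact: measurable_addpair.
Qed.

Lemma measurable_shift (x : R) A : measurable A ->
  measurable ((fun y => x + y)%R @^-1` A).
Proof.
move=> mA; rewrite -[X in measurable X]setTI.
have mx : measurable_fun setT (fun y : R => (x + y)%R) by exact: measurable_funD.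
exact: mx.
Qed.

Lemma measurable_conv_fubini G h : measurable_fun setT h ->
  (forall x, 0 <= h x) ->
  measurable_fun setT (fun x : R => \int[G]_y h (x + y)%R).
Proof.
move=> mh h0.
apply: (@measurable_fun_fubini_tonelli_F _ _ _ _ _ G
  (fun z : R * R => h (addpair z))) => //.
by apply: (measurableT_comp mh); exact: measurable_addpair.
Qed.

Lemma integral_shift_indic G (x : R) A : measurable A ->
  \int[G]_y (\1_A (x + y)%R)%:E = G ((fun y => x + y)%R @^-1` A).
Proof.
move=> mA.
transitivity (\int[G]_z (\1_((fun y => x + y)%R @^-1` A) z)%:E) => //.
by rewrite integral_indic ?setIT//; exact: measurable_shift.
Qed.

Lemma convolutionE F G A : measurable A ->
  convolution F G A = \int[F]_x G ((fun y => x + y)%R @^-1` A).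
Proof.
move=> mA; transitivity (\int[convolution F G]_z (\1_A z)%:E).
  by rewrite integral_indic// setIT.
rewrite integral_convolution//.
- by apply: eq_integral => x _; rewrite integral_shift_indic.
exact/measurable_EFinP.
Qed.

Lemma conv_powS F k : conv_pow F k.+1 = convolution F (conv_pow F k).
Proof. by []. Qed.

Lemma measurable_conv_section G A : measurable A ->
  measurable_fun setT (fun x : R => G ((fun y => x + y)%R @^-1` A)).
Proof.
move=> mA; under eq_fun do rewrite -integral_shift_indic//.
apply: (@measurable_conv_fubini G (fun z => (\1_A z)%:E)).
- exact/measurable_EFinP.
- by move=> x; rewrite lee_fin.
Qed.

Lemma measurable_expR_affine (t c : R) :
  measurable_fun setT (fun x : R => expR (t * x - c)).
Proof.
apply: measurableT_comp => //; apply: measurable_funB => //.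
Qed.

Lemma conv_pow_mgf F (t c : R) k :
  \int[conv_pow F k]_x (expR (t * x - k%:R * c))%:E
  = (\int[F]_x (expR (t * x - c))%:E) ^+ k.
Proof.
have me b : measurable_fun setT (fun x : R => (expR (t * x - b))%:E).
  by apply/measurable_EFinP; exact: measurable_expR_affine.
elim: k => [|k IH].
  by rewrite /= integral_dirac// diracT mul1e mulr0 mul0r subr0 expR0.
rewrite expeS conv_powS integral_convolution//.
have E x y : (expR (t * (x + y) - k.+1%:R * c))%:E =
    (expR (t * x - c))%:E * (expR (t * y - k%:R * c))%:E.
  by rewrite -EFinM -expRD -addn1 natrD; congr (expR _)%:E; ring.
under eq_integral => x _.
  under eq_integral => y _ do rewrite E.
  rewrite ge0_integralZl// IH; over.
rewrite ge0_integralZr//.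
by apply: expe_ge0; apply: integral_ge0 => *; rewrite lee_fin expR_ge0.
Qed.

Definition tilted (F0 F1 : probability R R) (t c : R) :=
  forall A, measurable A -> F1 A = \int[F0]_(x in A) (expR (t * x - c))%:E.

Lemma tilted_integral F0 F1 t c h : tilted F0 F1 t c ->
  measurable_fun setT h -> (forall x, 0 <= h x) ->
  \int[F1]_x h x = \int[F0]_x ((expR (t * x - c))%:E * h x).
Proof.
move=> F01 mh h0.
rewrite -[LHS]mul1e -(@weighted_integral _ _ _ _ _ F0 F1 id (fun x => expR (t * x - c)))//.
- exact: measurable_expR_affine.
- move=> A mA; rewrite mul1e; apply: etrans (esym (F01 A mA)); rewrite [RHS]integral_mkcond; apply: eq_integral => x _.
  rewrite /patch indicE; case: ifPn => _; first by rewrite mulr1.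
  by rewrite mulr0.
Qed.

(** The exponential of a sum is the product of the exponentials, so the
    density factors over the summands: a power of the tilted law is the tilt,
    by the same parameter, of the power. *)
Lemma tilted_conv_pow F0 F1 t c k : tilted F0 F1 t c ->
  tilted (conv_pow F0 k) (conv_pow F1 k) t (k%:R * c).
Proof.
move=> F01.
have me b : measurable_fun setT (fun x : R => (expR (t * x - b))%:E).
  by apply/measurable_EFinP; exact: measurable_expR_affine.
elim: k => [|k IH] A mA.
  rewrite /= integral_dirac//; last exact: measurable_funTS.
  by rewrite mulr0 mul0r subr0 expR0 mule1.
rewrite !conv_powS convolutionE// [RHS]integral_mkcond.
rewrite (tilted_integral F01)//; last exact: measurable_conv_section.
rewrite integral_convolution//; last 2 first.
- by apply: (measurable_restrictT _ _).1 => //; exact: measurable_funTS.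
- by move=> x; rewrite /patch; case: ifP => // _; rewrite lee_fin expR_ge0.
apply: eq_integral => x _.
rewrite IH; last exact: measurable_shift.
rewrite -ge0_integralZl//; last 2 first.
- exact: measurable_shift.
- exact: measurable_funTS.
rewrite [LHS]integral_mkcond; apply: eq_integral => y _; rewrite /patch.
have -> : (y \in (fun y => x + y)%R @^-1` A) = ((x + y)%R \in A).
  by apply/idP/idP; rewrite !inE.
case: ifPn => _ //.
rewrite -EFinM -expRD; congr (expR _)%:E.
by rewrite -addn1 natrD; ring.
Qed.

(** If every summand is required to fall in [D], the law of the sum can only
    lose mass; what remains is [c ^+ k] times the power of the law conditioned
    on [D]. *)
Lemma conv_pow_restrict F G (D : set R) (c : R) k A : (0 <= c)%R ->
  measurable D -> (forall B, measurable B -> F (B `&` D) = c%:E * G B) ->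
  measurable A -> (c ^+ k)%:E * conv_pow G k A <= conv_pow F k A.
Proof.
move=> c0 mD FG.
elim: k A => [|k IH] A mA; first by rewrite expr0 mul1e.
rewrite !conv_powS !convolutionE// exprS EFinM -muleA muleCA.
rewrite -(@weighted_integral _ _ _ _ _ F G id (\1_D))//; last 2 first.
- move=> B mB; rewrite -FG// -[B `&` D]setIT -integral_indic//; last exact: measurableI.
  by apply: eq_integral => x _; rewrite indicI mulrC.
- exact: measurable_conv_section.
have mDi : measurable_fun setT (fun x : R => (\1_D x)%:E : \bar R).
  exact/measurable_EFinP.
rewrite -ge0_integralZl//; last 3 first.
- by apply: emeasurable_funM => //; exact: measurable_conv_section.
- by move=> x _; rewrite mule_ge0// lee_fin.
- by rewrite lee_fin exprn_ge0.
apply: ge0_le_integral => //.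
- by move=> x _; rewrite !mule_ge0// lee_fin// exprn_ge0.
- apply: emeasurable_funM => //; apply: emeasurable_funM => //.
  exact: measurable_conv_section.
- exact: measurable_conv_section.
- move=> x _; rewrite muleCA indicE; case: (x \in D); last by rewrite mul0e.
  by rewrite mul1e; apply: IH; exact: measurable_shift.
Qed.

Definition window (x r : R) : set R := `[(x - r)%R, (x + r)%R]%classic.

Lemma windowP (x r y : R) : window x r y <-> (`|y - x| <= r)%R.
Proof.
rewrite /window/= in_itv/= ler_norml; split => /andP[? ?]; apply/andP; split; lra.
Qed.

(** If every summand is within [r] of [x], the sum of [k] of them is within
    [k * r] of [k * x]. *)
Lemma conv_pow_window F (x r : R) k :
  F (window x r) ^+ k <= conv_pow F k (window (k%:R * x) (k%:R * r)).
Proof.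
elim: k => [|k IH].
  by rewrite expe0 /window !mul0r subr0 addr0 /= diracE mem_set//= in_itv/= lexx.
have mW y s : measurable (window y s) by exact: measurable_itv.
set A := window (k.+1%:R * x) _.
have mA : measurable A by exact: mW.
rewrite expeS conv_powS convolutionE//.
set C := conv_pow F k (window (k%:R * x) (k%:R * r)).
have C0 : 0 <= C by exact: measure_ge0.
apply: (@le_trans _ _ (C * F (window x r))).
  by rewrite muleC; apply: lee_wpmul2r.
have -> : C * F (window x r) = \int[F]_y (C * (\1_(window x r) y)%:E).
  rewrite ge0_integralZl ?integral_indic ?setIT//.
  exact/measurable_EFinP.
apply: ge0_le_integral => //.
- by move=> y _; apply: mule_ge0; rewrite // lee_fin.
- by apply: emeasurable_funM => //; exact/measurable_EFinP.
- exact: measurable_conv_section.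
- move=> y _; rewrite indicE; case: (boolP (y \in _)); last by rewrite mule0.
  rewrite mule1 inE /window/= in_itv/= => /andP[y1 y2].
  apply: le_measure; rewrite ?inE//; first exact: measurable_shift.
  move=> z; rewrite /A /window/= !in_itv/= => /andP[z1 z2].
  by rewrite -addn1 natrD; apply/andP; split; lra.
Qed.

End Convolution.

(** * Lower bound for large deviations *)

Section ExponentialBounds.
Context {R : realType}.

Lemma expR_ge_cosh (a b : R) : expR `|a * b| <= expR (a * b) + expR (- a * b).
Proof.
case: (ger0P (a * b)) => _; rewrite ?mulNr ?lerDl ?lerDr expR_ge0//.
Qed.

Lemma expR_le_quadratic (v : R) : v <= 2^-1 -> expR v <= 1 + v + 2 * v ^+ 2.
Proof.
move=> v2.
have v1 : 0 < 1 - v by lra.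
have h : expR v * (1 - v) <= 1.
  have := expR_ge1Dx (- v); rewrite expRN => h.
  rewrite -[leRHS](mulfV (lt0r_neq0 (expR_gt0 v))).
  by rewrite ler_pM2l ?expR_gt0//; lra.
rewrite -(ler_pM2r v1) (le_trans h)//.
by have : 0 <= v ^+ 2 * (1 - 2 * v) by [apply: mulr_ge0; [exact: sqr_ge0|lra]]; nra.
Qed.

Lemma coshR_le (v : R) : `|v| <= 2^-1 -> expR v + expR (- v) <= 2 + 4 * v ^+ 2.
Proof.
rewrite ler_norml => /andP[v1 v2].
have := @expR_le_quadratic v v2.
have : - v <= 2^-1 by lra.
by move=> /expR_le_quadratic; rewrite sqrrN; lra.
Qed.

End ExponentialBounds.

Section TruncatedMgf.
Context {R : realType}.
Variables (F : probability R R) (nu : R).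

(** Moment generating function of [x - nu] restricted to a bounded window: it
    is finite for every tilt, whereas that of [F] itself may be infinite at
    every nonzero one. *)
Definition trunc_mgf (n : nat) (t : R) : R :=
  fine (\int[F]_(x in window nu n%:R) (expR (t * x - t * nu))%:E)%E.

Lemma measurable_window (x r : R) : measurable (window x r).
Proof. exact: measurable_itv. Qed.
Hint Resolve measurable_window : core.

Lemma measurable_expR_line (D : set R) (t c : R) :
  measurable_fun D (fun x : R => (expR (t * x - c))%:E).
Proof.
apply: measurable_funTS; apply/measurable_EFinP.
exact: measurable_expR_affine.
Qed.
Hint Resolve measurable_expR_line : core.

Lemma expR_window_le n (t x : R) : window nu n%:R x ->
  expR (t * x - t * nu) <= expR (`|t| * n%:R).
Proof.
rewrite /window/= in_itv/= => /andP[x1 x2].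
rewrite ler_expR -mulrBr; apply: le_trans (ler_norm _) _.
rewrite normrM ler_wpM2l// ler_norml; apply/andP; split; lra.
Qed.

Lemma trunc_mgfE n t :
  (\int[F]_(x in window nu n%:R) (expR (t * x - t * nu))%:E)%E
  = (trunc_mgf n t)%:E.
Proof.
rewrite /trunc_mgf fineK// ge0_fin_numE; last first.
  by apply: integral_ge0 => x _; rewrite lee_fin expR_ge0.
apply: (@le_lt_trans _ _ (\int[F]_(x in window nu n%:R) (expR (`|t| * n%:R))%:E)%E).
  apply: ge0_le_integral => //.
  by move=> x Dx; rewrite lee_fin expR_window_le.
rewrite integral_cst//; apply: lte_mul_pinfty; rewrite ?lee_fin ?expR_ge0//.
by rewrite (le_lt_trans (probability_le1 _ _)) ?ltry.
Qed.

Lemma trunc_mgf_ge0 n t : 0 <= trunc_mgf n t.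
Proof. by apply: fine_ge0; apply: integral_ge0 => x _; rewrite lee_fin expR_ge0. Qed.

Lemma trunc_mgf_shift n (t h : R) :
  trunc_mgf n (t + h) <= expR (`|h| * n%:R) * trunc_mgf n t.
Proof.
rewrite -lee_fin EFinM -!trunc_mgfE -ge0_integralZl//.
apply: ge0_le_integral => //.
- exact: measurable_funeM.
- move=> x Dx; rewrite -EFinM lee_fin.
  rewrite [X in expR X <= _](_ : _ = (h * x - h * nu) + (t * x - t * nu)); last by ring.
  by rewrite expRD ler_wpM2r ?expR_ge0// expR_window_le.
Qed.

(** A second-order estimate without derivatives: the sum of the two shifts
    kills the first-order term, so that at a minimum [t] of the truncated
    moment generating function both neighbours are only quadratically larger
    than the minimal value. *)
Lemma trunc_mgf_second n (t h : R) : `|h| * n%:R <= 2^-1 ->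
  trunc_mgf n (t + h) + trunc_mgf n (t - h)
  <= (2 + 4 * (h * n%:R) ^+ 2) * trunc_mgf n t.
Proof.
move=> hn.
rewrite -lee_fin EFinM EFinD -!trunc_mgfE -ge0_integralZl//; last first.
  by rewrite lee_fin; have := sqr_ge0 (h * n%:R); lra.
rewrite -ge0_integralD//.
apply: ge0_le_integral => //.
- by move=> x _; rewrite adde_ge0// lee_fin expR_ge0.
- exact: emeasurable_funD.
- exact: measurable_funeM.
- move=> x Dx; rewrite -EFinD -EFinM lee_fin.
  rewrite [X in expR X + _ <= _](_ : _ = (h * x - h * nu) + (t * x - t * nu)); last by ring.
  rewrite [X in _ + expR X <= _](_ : _ = - (h * x - h * nu) + (t * x - t * nu)); last by ring.
  rewrite (expRD (h * x - h * nu)) (expRD (- (h * x - h * nu))).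
  rewrite -mulrDl ler_wpM2r ?expR_ge0//.
  have xn : `|h * x - h * nu| <= `|h| * n%:R.
    move: Dx; rewrite /window/= in_itv/= => /andP[x1 x2].
    rewrite -mulrBr normrM ler_wpM2l// ler_norml; apply/andP; split; lra.
  apply: le_trans (coshR_le (le_trans xn hn)) _.
  rewrite lerD2l ler_wpM2l// -(real_normK (num_real (_ - _))) -(real_normK (num_real (h * _))).
  by rewrite ler_pXn2r ?nnegrE// normrM (ger0_norm (ler0n _ _)).
Qed.

Lemma le_trunc_mgf m n t : (m <= n)%N -> trunc_mgf m t <= trunc_mgf n t.
Proof.
move=> mn; rewrite -lee_fin -!trunc_mgfE; apply: ge0_subset_integral => //.
have : (m%:R <= n%:R :> R) by rewrite ler_nat.
by move=> h x; rewrite /window/= !in_itv/= => /andP[x1 x2]; apply/andP; split; lra.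
Qed.

Lemma trunc_mgf_gt (c : R) t :
  (c%:E < \int[F]_x (expR (t * x - t * nu))%:E)%E ->
  exists n, c < trunc_mgf n t.
Proof.
move=> ct.
have U : \bigcup_n window nu n%:R = [set: R].
  apply/seteqP; split => // x _.
  exists (Num.truncn `|x - nu|).+1 => //.
  have := truncnS_gt `|x - nu|.
  rewrite /window/= in_itv/= ltr_norml => /andP[x1 x2]; apply/andP; split; lra.
have := @ge0_nondecreasing_set_cvg_integral _ R R (fun n => window nu n%:R)
  (fun x => (expR (t * x - t * nu))%:E) F.
rewrite U => H.
have {}H : (\int[F]_(x in window nu i%:R) (expR (t * x - t * nu))%:E)%E @[i --> \oo]
    --> (\int[F]_x (expR (t * x - t * nu))%:E)%E.
  apply: H => //.
  move=> m n mn; apply/subsetPset.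
  have : (m%:R <= n%:R :> R) by rewrite ler_nat.
  by move=> h x; rewrite /window/= !in_itv/= => /andP[x1 x2]; apply/andP; split; lra.
have [N _ /(_ N (leqnn N))] := H _ (open_ereal_gt' ct).
by rewrite /= trunc_mgfE lte_fin => cN; exists N.
Qed.

(** A shift of the tilt by [h] changes the integrand by a factor between
    [expR (- `|h| * n)] and [expR (`|h| * n)] on the window; hence continuity
    without differentiating under the integral. *)
Lemma trunc_mgf_continuous n : continuous (trunc_mgf n).
Proof.
move=> t.
have lo s : expR (- (`|s - t| * n%:R)) * trunc_mgf n t <= trunc_mgf n s.
  rewrite expRN ler_pdivrMl ?expR_gt0//.
  have := trunc_mgf_shift n s (t - s).
  by rewrite addrC subrK distrC.
have hi s : trunc_mgf n s <= expR (`|s - t| * n%:R) * trunc_mgf n t.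
  have := trunc_mgf_shift n t (s - t).
  by rewrite addrC subrK.
have dc : (fun s => `|s - t| * n%:R) @ t --> (0 : R).
  rewrite [X in _ --> X](_ : _ = `|t - t| * n%:R); last by rewrite subrr normr0 mul0r.
  apply: cvgM; last exact: cvg_cst.
  by apply: cvg_norm; apply: cvgB => //; exact: cvg_cst.
have ec : expR \o (fun s => `|s - t| * n%:R) @ t --> (1 : R).
  have := @continuous_cvg _ _ _ (nbhs t) _ _ expR _ (@continuous_expR R 0) dc.
  by rewrite expR0; apply.
have ec' : expR \o (fun s => - (`|s - t| * n%:R)) @ t --> (1 : R).
  have := @continuous_cvg _ _ _ (nbhs t) _ _ expR _ (@continuous_expR R (- 0)) (cvgN dc).
  by rewrite oppr0 expR0; apply.
apply: (@squeeze_cvgr _ _ _ _ (fun s => expR (- (`|s - t| * n%:R)) * trunc_mgf n t)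
  (fun s => expR (`|s - t| * n%:R) * trunc_mgf n t)).
- by near=> s; rewrite lo hi.
- by rewrite -[X in _ --> X]mul1r; apply: cvgM => //; exact: cvg_cst.
- by rewrite -[X in _ --> X]mul1r; apply: cvgM => //; exact: cvg_cst.
Unshelve. all: by end_near.
Qed.

End TruncatedMgf.

Section CramerLowerBound.
Context {R : realType}.
Variables (F : probability R R) (nu : R).

Let mwin (x e : R) : measurable (window x e) := measurable_window x e.
Hint Resolve mwin : core.
Let mexp (D : set R) (t c : R) := @measurable_expR_line R D t c.
Hint Resolve mexp : core.

(** If the law is carried by one side of [nu], large tilts towards [nu] leave
    only the mass next to [nu]. *)
Lemma one_sided_window (sg r e : R) : `|sg| = 1 -> 0 < e ->
  F [set x | 0 < sg * (x - nu)] = 0%E ->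
  (forall t : R, (expR (- r))%:E < \int[F]_x (expR (t * x - t * nu))%:E)%E ->
  ((expR (- r))%:E <= F (window nu e))%E.
Proof.
move=> sg1 e0 Fsg H.
have mW : measurable (window nu e) by exact: measurable_window.
have Wfin : F (window nu e) \is a fin_num.
  by apply: fin_num_measure; exact: measurable_window.
rewrite -(fineK Wfin) lee_fin; apply/ler_addgt0Pr => p p0.
pose t := (1 + `|ln p|) / e.
have tp : expR (- (t * e)) <= p.
  rewrite /t divfK ?gt_eqF// -[leRHS](lnK p0) ler_expR.
  by have := ler_norm (- ln p); rewrite normrN; lra.
have t0 : 0 < t by rewrite divr_gt0//; have := normr_ge0 (ln p); lra.
have mG : measurable [set x | 0 < sg * (x - nu)].
  rewrite -[X in measurable X]setTI.
  have mf : measurable_fun setT (fun x : R => sg * (x - nu)).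
    by apply: measurable_funM => //; apply: measurable_funB.
  have -> : [set x | 0 < sg * (x - nu)] = (fun x => sg * (x - nu)) @^-1` `]0, +oo[.
    by apply/seteqP; split => x /=; rewrite in_itv/= andbT.
  exact: mf.
have := H (t * sg).
have : (\int[F]_x (expR (t * sg * x - t * sg * nu))%:E <=
   \int[F]_x ((\1_(window nu e) x)%:E + p%:E))%E.
  apply: ae_ge0_le_integral => //.
  - by move=> x _; rewrite -EFinD lee_fin addr_ge0// ltW.
  - by apply: emeasurable_funD => //; exact/measurable_EFinP.
  (* Off that null set [t * sg * (x - nu)] is nonpositive, and below [- t * e]
     outside the window. *)
  - exists [set x | 0 < sg * (x - nu)]; split => // x /= /not_implyP[_].
    move=> /negP; rewrite -ltNge -EFinD lte_fin => h.
    rewrite ltNge; apply/negP => h2; move: h; apply/negP; rewrite -leNgt.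
    have -> : t * sg * x - t * sg * nu = t * (sg * (x - nu)) by ring.
    rewrite indicE; case: (boolP (x \in window nu e)) => /= xW.
      have : expR (t * (sg * (x - nu))) <= 1.
        by rewrite -expR0 ler_expR pmulr_rle0.
      by move=> ?; rewrite mulr1n; lra.
    rewrite mulr0n add0r; apply: le_trans tp.
    rewrite ler_expR -mulrN ler_pM2l// leNgt; apply/negP => h3.
    move: xW; rewrite notin_setE; apply.
    apply/windowP; rewrite -[leLHS]mul1r -sg1 -normrM ler_norml.
    by apply/andP; split; lra.
rewrite ge0_integralD//; last 2 first.
- exact/measurable_EFinP.
- by move=> x _; rewrite lee_fin ltW.
rewrite integral_indic// setIT integral_cst_probability.
move=> h1 h2; have h3 := lt_le_trans h2 h1.
by rewrite -lee_fin EFinD (fineK Wfin); exact: ltW.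
Qed.

(** Coercivity and compactness turn the pointwise lower bounds on the moment
    generating function into a uniform one for some truncation. *)
Lemma trunc_mgf_uniform (r : R) :
  F [set x | 0 < 1 * (x - nu)] <> 0%E ->
  F [set x | 0 < (-1) * (x - nu)] <> 0%E ->
  (forall t : R, (expR (- r))%:E < \int[F]_x (expR (t * x - t * nu))%:E)%E ->
  exists n : nat, exists dl p : R, [/\ 0 < dl, 0 < p,
    (forall t, p * expR (`|t| * dl) <= trunc_mgf F nu n t) &
    (forall t, expR (- r) < trunc_mgf F nu n t)].
Proof.
move=> Fp Fm H.
(* Continuity from below: a charged side is already charged at a positive
   distance from [nu] and inside some window. *)
have side sg : F [set x | 0 < sg * (x - nu)] <> 0%E ->
  exists n : nat, (0 < F ([set x | (n.+1%:R^-1 <= sg * (x - nu))%R] `&` window nu n%:R))%E.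
  move=> Fsg; apply: contrapT => /forallNP h; apply: Fsg.
  pose A n := [set x | n.+1%:R^-1 <= sg * (x - nu)] `&` window nu n%:R.
  have mA n : measurable (A n).
    apply: measurableI => //; rewrite -[X in measurable X]setTI.
    have mf : measurable_fun setT (fun x : R => sg * (x - nu)).
      by apply: measurable_funM => //; apply: measurable_funB.
    have -> : [set x | n.+1%:R^-1 <= sg * (x - nu)] = (fun x => sg * (x - nu)) @^-1` `[n.+1%:R^-1, +oo[.
      by apply/seteqP; split => x /=; rewrite in_itv/= andbT.
    exact: mf.
  have -> : [set x | 0 < sg * (x - nu)] = \bigcup_n A n.
    apply/seteqP; split => x /=; last first.
      by move=> [n _ [/= xn _]]; apply: lt_le_trans xn; rewrite invr_gt0.
    move=> x0; pose N := maxn (Num.truncn (sg * (x - nu))^-1) (Num.truncn `|x - nu|).+1.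
    exists N => //; split => /=.
      rewrite -[leRHS]invrK lef_pV2 ?posrE ?invr_gt0//.
      apply: (le_trans (ltW (truncnS_gt _))); rewrite ler_nat ltnS.
      exact: leq_maxl.
    have xN : `|x - nu| <= N%:R.
      apply: (le_trans (ltW (truncnS_gt _))); rewrite ler_nat.
      exact: leq_maxr.
    move: xN; rewrite /window/= in_itv/= ler_norml => /andP[x1 x2]; apply/andP; split; lra.
  have A0 n : F (A n) = 0%E.
    apply/eqP; rewrite eq_le measure_ge0 andbT leNgt; apply/negP; exact: h.
  apply/(negligibleP F); first exact: bigcupT_measurable.
  by apply: negligible_bigcup => n; apply/(negligibleP F (mA n)); exact: A0.
have [n1 h1] := side _ Fp; have [n2 h2] := side _ Fm.
pose n0 := maxn n1 n2; pose dl : R := n0.+1%:R^-1.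
have dl0 : 0 < dl by rewrite invr_gt0.
have mA sg : measurable ([set x | dl <= sg * (x - nu)] `&` window nu n0%:R).
  apply: measurableI => //; rewrite -[X in measurable X]setTI.
  have mf : measurable_fun setT (fun x : R => sg * (x - nu)).
    by apply: measurable_funM => //; apply: measurable_funB.
  have -> : [set x | dl <= sg * (x - nu)] = (fun x => sg * (x - nu)) @^-1` `[dl, +oo[.
    by apply/seteqP; split => x /=; rewrite in_itv/= andbT.
  exact: mf.
have incl m sg : (m <= n0)%N ->
    [set x | m.+1%:R^-1 <= sg * (x - nu)] `&` window nu m%:R `<=`
    [set x | dl <= sg * (x - nu)] `&` window nu n0%:R.
  move=> mn x [/= x1 x2]; split => /=.
    by apply: le_trans x1; rewrite lef_pV2 ?posrE// ler_nat ltnS.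
  have : (m%:R <= n0%:R :> R) by rewrite ler_nat.
  by move: x2; rewrite /window/= !in_itv/= => /andP[? ?] ?; apply/andP; split; lra.
pose q sg := fine (F ([set x | dl <= sg * (x - nu)] `&` window nu n0%:R)).
have mA' m sg : measurable ([set x | m.+1%:R^-1 <= sg * (x - nu)] `&` window nu m%:R).
  apply: measurableI => //; rewrite -[X in measurable X]setTI.
  have mf : measurable_fun setT (fun x : R => sg * (x - nu)).
    by apply: measurable_funM => //; apply: measurable_funB.
  have -> : [set x | m.+1%:R^-1 <= sg * (x - nu)] = (fun x => sg * (x - nu)) @^-1` `[m.+1%:R^-1, +oo[.
    by apply/seteqP; split => x /=; rewrite in_itv/= andbT.
  exact: mf.
have q1 : 0 < q 1.
  rewrite fine_gt0// (lt_le_trans h1) ?le_measure ?inE//=; last first.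
    by apply: incl; exact: leq_maxl.
  by rewrite (le_lt_trans (probability_le1 _ _)) ?ltry.
have q2 : 0 < q (-1).
  rewrite fine_gt0// (lt_le_trans h2) ?le_measure ?inE//=; last first.
    by apply: incl; exact: leq_maxr.
  by rewrite (le_lt_trans (probability_le1 _ _)) ?ltry.
pose p := Num.min (q 1) (q (-1)).
have p0 : 0 < p by rewrite lt_min q1.
(* The mass [p] at distance [dl] on the side towards which [t] tilts. *)
have coer t : p * expR (`|t| * dl) <= trunc_mgf F nu n0 t.
  pose sg : R := if 0 <= t then 1 else -1.
  have tsg : `|t| * sg = t.
    by rewrite /sg; case: (ger0P t) => _; rewrite ?mulr1// mulrN1 opprK.
  have pq : p <= q sg.
    by rewrite /sg; case: ifP => _; rewrite ge_min lexx ?orbT.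
  apply: (@le_trans _ _ (q sg * expR (`|t| * dl))).
    by rewrite ler_wpM2r ?expR_ge0.
  rewrite -lee_fin -trunc_mgfE mulrC EFinM fineK ?fin_num_measure//.
  rewrite -integral_cst//.
  apply: (@le_trans _ _ (\int[F]_(x in [set x | (dl <= sg * (x - nu))%R] `&` window nu n0%:R)
     (expR (t * x - t * nu))%:E)%E).
    apply: ge0_le_integral => //.
    - by move=> x _ /=; rewrite lee_fin expR_ge0.
    - move=> x [/= x1 _]; rewrite /cst lee_fin ler_expR.
    have -> : t * x - t * nu = `|t| * (sg * (x - nu)) by rewrite mulrA tsg; ring.
    by rewrite ler_wpM2l.
  by apply: ge0_subset_integral => //; exact: subIsetr.
(* Outside [[- T, T]] coercivity alone suffices; inside, each tilt has its own
   truncation level, valid nearby, and compactness gives a common one. *)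
pose T := (`|r| + `|ln p| + 1) / dl.
have T0 : 0 <= T by rewrite divr_ge0 ?(ltW dl0)//; have := normr_ge0 r; have := normr_ge0 (ln p); lra.
have big (t : R) : T <= `|t| -> expR (- r) < p * expR (`|t| * dl).
  rewrite /T ler_pdivrMr// => h.
  rewrite -[X in X * _](lnK p0) -expRD ltr_expR.
  have := ler_norm (- ln p); rewrite normrN.
  by have := ler_norm (- r); rewrite normrN; lra.
have /compact_near_coveringP cov := @segment_compact _ (- T) T.
have := cov nat \oo (fun n (t : R) => expR (- r) < trunc_mgf F nu n t) _ _.
move=> /(_ _)[].
  move=> t _; have [N HN] := trunc_mgf_gt (H t).
  have near_t : \forall t' \near nbhs (t : R), expR (- r) < trunc_mgf F nu N t'.
    exact: (@cvgr_gt _ _ (nbhs (t : R)) _ (trunc_mgf F nu N) _ (@trunc_mgf_continuous _ F nu N t) _ HN).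
  near=> t' n => /=.
  apply: (@lt_le_trans _ _ (trunc_mgf F nu N t')).
    by near: t'.
  by apply: le_trunc_mgf; near: n; exact: nbhs_infty_ge.
move=> N _ HN.
exists (maxn n0 N), dl, p; split => // t.
  apply: (le_trans (coer t)); apply: le_trunc_mgf; exact: leq_maxl.
have [tT|tT] := leP T `|t|.
  apply: (lt_le_trans (big t tT)); apply: (le_trans (coer t)).
  by apply: le_trunc_mgf; exact: leq_maxl.
apply: (HN _ (leq_maxr n0 N)) => /=.
by rewrite in_itv/= -ler_norml ltW.
Unshelve. all: by end_near.
Qed.


Lemma trunc_mgf_argmin n (dl p : R) : 0 < dl -> 0 < p ->
  (forall t, p * expR (`|t| * dl) <= trunc_mgf F nu n t) ->
  exists ts, forall t, trunc_mgf F nu n ts <= trunc_mgf F nu n t.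
Proof.
move=> dl0 p0 coer; set z := trunc_mgf F nu n.
have z0 : 0 < z 0.
  by apply: lt_le_trans (coer 0); rewrite mulr_gt0 ?expR_gt0.
pose T := `|ln (z 0 / p)| / dl.
have T0 : 0 <= T by rewrite divr_ge0 ?(ltW dl0).
have [ts tsT hts] : exists2 c, c \in `[- T, T] & forall t, t \in `[- T, T] -> z c <= z t.
  apply: EVT_min; first by lra.
  by apply: continuous_subspaceT; exact: trunc_mgf_continuous.
exists ts => t; have [tT|tT] := leP `|t| T.
  by apply: hts; rewrite in_itv/= -ler_norml.
apply: (@le_trans _ _ (z 0)); first by apply: hts; rewrite in_itv/=; apply/andP; split; lra.
apply: le_trans (coer t).
rewrite mulrC -ler_pdivrMr// -[leLHS](lnK (divr_gt0 z0 p0)) ler_expR.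
apply: (le_trans (ler_norm _)).
by move: tT; rewrite /T ltr_pdivrMr// => /ltW.
Qed.

Lemma trunc_mgf_near_argmin n (ts h : R) :
  (forall t, trunc_mgf F nu n ts <= trunc_mgf F nu n t) -> `|h| * n%:R <= 2^-1 ->
  trunc_mgf F nu n (ts + h)
    <= expR (4 * (h * n%:R) ^+ 2) * trunc_mgf F nu n ts.
Proof.
move=> min hn; have := trunc_mgf_second F nu ts hn; have := min (ts - h).
have := expR_ge1Dx (4 * (h * n%:R) ^+ 2); have := trunc_mgf_ge0 F nu n ts.
set a := trunc_mgf F nu n ts; set b := trunc_mgf _ _ _ _; set q := 4 * _.
by move=> a0 e1 h1 h2; have := ler_wpM2r a0 e1; lra.
Qed.

(** Restricting the law to a window around [nu] makes all exponential moments
    finite; the mass lost is paid back by the factor [c ^+ k]. *)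
Lemma conv_pow_trunc_mgf n : 0 < trunc_mgf F nu n 0 ->
  exists c : R, exists G : probability R R, [/\ 0 < c,
    (forall k A, measurable A -> ((c ^+ k)%:E * conv_pow G k A <= conv_pow F k A)%E) &
    (forall k t, \int[conv_pow G k]_x (expR (t * x - k%:R * (t * nu)))%:E
      = ((trunc_mgf F nu n t / c) ^+ k)%:E)%E].
Proof.
move=> z0; pose D := window nu n%:R; pose c := trunc_mgf F nu n 0.
have mD : measurable D by exact: mwin.
have cE : F D = c%:E.
  rewrite /c -trunc_mgfE.
  transitivity (\int[F]_(x in D) (cst 1%:E) x)%E; first by rewrite (@integral_cst _ _ _ F D (mwin nu n%:R) 1%E) mul1e.
  by apply: eq_integral => x _; rewrite !mul0r subr0 expR0.
pose G : probability R R := mnormalize (mrestr F (mwin nu n%:R)) F.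
have GE B : measurable B -> F (B `&` D) = (c%:E * G B)%E.
  move=> mB; rewrite /G/= /mnormalize.
  have evE : mrestr F (mwin nu n%:R) setT = c%:E by rewrite /mrestr setTI.
  case: ifPn => [/orP[/eqP|/eqP] h|_].
  - have : c%:E = 0%E := etrans (esym evE) h.
    by move=> [] c0; move: z0; rewrite -/c c0 ltxx.
  - by have : c%:E = +oo%E := etrans (esym evE) h.
  - transitivity (c%:E * (F (B `&` D) *
      (fine (mrestr F (mwin nu n%:R) setT))^-1%:E))%E; last by [].
    by rewrite evE/= muleCA -EFinM mulfV ?mule1// gt_eqF.
have GI t : (\int[G]_x (expR (t * x - t * nu))%:E = (trunc_mgf F nu n t / c)%:E)%E.
  have E : (c%:E * \int[G]_x (expR (t * x - t * nu))%:E = (trunc_mgf F nu n t)%:E)%E.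
    rewrite -(@weighted_integral _ _ _ _ _ F G id (\1_D))//; last first.
      move=> A mA; rewrite -GE// -[A `&` D]setIT -integral_indic//; last exact: measurableI.
      by apply: eq_integral => x _; rewrite indicI mulrC.
    rewrite -trunc_mgfE [RHS]integral_mkcond; apply: eq_integral => x _.
    by rewrite /patch indicE; case: ifPn; rewrite ?mul1e ?mul0e.
  transitivity (c^-1%:E * (trunc_mgf F nu n t)%:E)%E; last first.
    by rewrite -EFinM; congr EFin; exact: mulrC.
  by rewrite -E muleA -EFinM mulVf ?gt_eqF// mul1e.
exists c, G; split => // [k A mA|k t].
  exact: conv_pow_restrict (ltW z0) mD GE mA.
by rewrite conv_pow_mgf GI EFin_expe.
Qed.

(** At step [h] the truncated moment generating function grows by a factor
    quadratic in [h] in the exponent, whereas a deviation of relative size [s]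
    is penalised linearly, by [h * s]; for small [h] the linear term wins. *)
Lemma cramer_step_size (s : R) n : 0 < s -> s <= 1 ->
  exists h, [/\ 0 < h, h * n%:R <= 2^-1 & 4 * (h * n%:R) ^+ 2 <= h * s / 2].
Proof.
move=> s0 s1; pose q : R := n.+1%:R; exists (s / (8 * q ^+ 2)); set h := s / _.
have q1 : 1 <= q by rewrite ler1n.
have q0 : 0 < q by lra.
have h0 : 0 < h by rewrite divr_gt0// mulr_gt0// exprn_gt0.
have nq : n%:R <= q by rewrite ler_nat.
have hq : h * q ^+ 2 = s / 8.
  by rewrite /h; field; rewrite gt_eqF.
have qq : n%:R <= q ^+ 2 by rewrite expr2; apply: (le_trans nq); rewrite ler_peMl// ltW.
split => //.
  by apply: (le_trans (ler_wpM2l (ltW h0) qq)); rewrite hq; lra.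
have n2 : n%:R ^+ 2 <= q ^+ 2 by rewrite lerXn2r ?nnegrE ?(ltW q0).
have := ler_wpM2l (ltW h0) (ler_wpM2l (ltW h0) n2).
by rewrite hq exprMn expr2 mulrA; lra.
Qed.

Lemma cramer_absorb (A M C E g : R) : 0 < C -> 0 <= g -> 2 <= E -> A <= M ->
  M / C / 2 <= E * g -> A / E / E <= C * g.
Proof.
move=> C0 g0 E2 AM h.
have E0 : 0 < E by lra.
rewrite ler_pdivrMr// ler_pdivrMr//; apply: (le_trans AM).
move: h; rewrite ler_pdivrMr// ler_pdivrMr// => h; apply: (le_trans h).
have -> : C * g * E * E = E * (C * g * E) by ring.
have -> : E * g * 2 * C = 2 * (C * g * E) by ring.
by rewrite ler_wpM2r// !mulr_ge0// ltW.
Qed.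

Lemma cramer_half (a b c : R) : a <= b + c -> c <= a / 2 -> a / 2 <= b.
Proof. by move=> h1 h2; lra. Qed.

(** The hypothesis says that the rate function at [nu] is at most [r]. If one
    side of [nu] is null, the mass close to [nu] is at least [expR (- r)], and
    all the summands may be asked to be there. Otherwise truncate, so that the
    moment generating function attains its minimum at some [ts]. Minimality
    makes the values at [ts + h] and [ts - h] exceed the minimum only by a
    factor of quadratic order in the exponent, so under the weight
    [expR (ts * y)] the sums far from [k * nu] carry at most half of the total
    weight. The rest lies in the window, where the weight is nearly constant.
    *)
Theorem cramer_lower_bound (r e : R) : 0 < e ->
  (forall t : R, (expR (- r))%:E < \int[F]_x (expR (t * x - t * nu))%:E)%E ->
  exists N, forall k, (N <= k)%N ->
    ((expR (- (k%:R * (r + e))))%:E <= conv_pow F k (window (k%:R * nu) (k%:R * e)))%E.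
Proof.
move=> e0 H.
have one sg : `|sg| = 1 -> F [set x | 0 < sg * (x - nu)] = 0%E ->
    forall k, ((expR (- (k%:R * (r + e))))%:E <= conv_pow F k (window (k%:R * nu) (k%:R * e)))%E.
  move=> sg1 Fsg k; have := one_sided_window sg1 e0 Fsg H.
  have Wfin : F (window nu e) \is a fin_num by exact: fin_num_measure.
  move=> h; apply: le_trans (conv_pow_window _ _ _ _).
  rewrite -(fineK Wfin) -EFin_expe lee_fin.
  apply: (@le_trans _ _ (expR (- r) ^+ k)).
    rewrite -expRM_natl ler_expR; have := ler0n R k.
    by move=> k0; have := mulr_ge0 k0 (ltW e0); lra.
  by rewrite lerXn2r ?nnegrE ?expR_ge0 ?fine_ge0// -lee_fin fineK.
have [/one h|Fp] := pselect (F [set x | 0 < 1 * (x - nu)] = 0%E).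
  by exists 0%N => k _; apply: h; rewrite normr1.
have [/one h|Fm] := pselect (F [set x | 0 < (-1) * (x - nu)] = 0%E).
  by exists 0%N => k _; apply: h; rewrite normrN1.
have [n [dl [p [dl0 p0 coer zr]]]] := trunc_mgf_uniform Fp Fm H.
have [ts min] := trunc_mgf_argmin dl0 p0 coer.
set z := trunc_mgf F nu n in coer zr min *.
have z0 t : 0 < z t by apply: lt_trans (zr t); exact: expR_gt0.
have [c [G [c0 GF GI]]] := conv_pow_trunc_mgf (z0 0).
set m := z ts.
(* The width [s] of the inner window: at most [e], and small enough for
   [expR (ts * y)] to vary by at most [expR (k * e / 2)] on it. *)
pose s := Num.min 1 (e / (2 * (1 + `|ts|))).
have d0 : 0 < 2 * (1 + `|ts|) by have := normr_ge0 ts; lra.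
have s0 : 0 < s by rewrite lt_min ltr01 divr_gt0.
have se : `|ts| * s <= e / 2.
  apply: (@le_trans _ _ (`|ts| * (e / (2 * (1 + `|ts|))))).
    by rewrite ler_wpM2l// ge_min lexx orbT.
  have -> : e / 2 = (1 + `|ts|) * (e / (2 * (1 + `|ts|))).
    by field; have := normr_ge0 ts; lra.
  by rewrite ler_wpM2r ?divr_ge0 ?(ltW e0) ?(ltW d0)//; lra.
have se' : s <= e.
  rewrite ge_min; apply/orP; right; rewrite ler_pdivrMr//.
  by have := normr_ge0 ts; nra.
have s1 : s <= 1 by rewrite ge_min lexx.
have [h [h0 hn hq]] := cramer_step_size n s0 s1.
have near1 sg : `|sg| = 1 -> z (ts + sg * h) <= m * expR (h * s / 2).
  move=> sg1; have : `|sg * h| * n%:R <= 2^-1.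
    by rewrite normrM sg1 mul1r gtr0_norm.
  move=> /(trunc_mgf_near_argmin min) /le_trans; apply.
  rewrite mulrC ler_wpM2l ?(ltW (z0 _))// ler_expR.
  have -> : (sg * h * n%:R) ^+ 2 = `|sg| ^+ 2 * (h * n%:R) ^+ 2.
    by rewrite real_normK ?num_real//; ring.
  by rewrite sg1 expr1n mul1r.
(* From [N] on, the weight outside the window is less than half of the total,
   and a factor [2] is absorbed in [expR (k * e / 2)]. *)
pose N := maxn (Num.truncn (6 / (h * s))).+1 (Num.truncn (2 / e)).+1.
exists N => k Nk.
have hsk : 3 <= k%:R * (h * s / 2).
  have : 6 / (h * s) <= k%:R.
    apply: (le_trans (ltW (truncnS_gt _))); rewrite ler_nat.
    by apply: leq_trans Nk; exact: leq_maxl.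
  by rewrite ler_pdivrMr ?mulr_gt0//; lra.
have ek : 1 <= k%:R * e / 2.
  have : 2 / e <= k%:R.
    apply: (le_trans (ltW (truncnS_gt _))); rewrite ler_nat.
    by apply: leq_trans Nk; exact: leq_maxr.
  by rewrite ler_pdivrMr//; lra.
pose W := window (k%:R * nu) (k%:R * s).
(* Inside the window the weight is bounded by its largest value; outside, one
   of the two shifts by [h] and [- h] increases the exponent by at least
   [k * (h * s)]. *)
have pw y : expR (ts * y - k%:R * (ts * nu)) <= expR (k%:R * e / 2) * \1_W y +
   expR (- (k%:R * (h * s))) * (expR ((ts + h) * y - k%:R * ((ts + h) * nu))
      + expR ((ts - h) * y - k%:R * ((ts - h) * nu))).
  set B := (X in _ <= _ + X).
  have B0 : 0 <= B by rewrite mulr_ge0 ?addr_ge0 ?expR_ge0.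
  rewrite indicE; case: (boolP (y \in W)) => /= yW.
    rewrite mulr1n mulr1 -[leLHS]addr0 lerD// ler_expR.
    move: yW; rewrite inE => /windowP yW.
    have -> : ts * y - k%:R * (ts * nu) = ts * (y - k%:R * nu) by ring.
    apply: (le_trans (ler_norm _)); rewrite normrM.
    apply: (@le_trans _ _ (`|ts| * (k%:R * s))); first by rewrite ler_wpM2l.
    by have := ler_wpM2l (ler0n R k) se; clear; lra.
  rewrite mulr0n mulr0 add0r /B.
  have yW' : k%:R * s < `|y - k%:R * nu|.
    by rewrite ltNge; apply/negP => /windowP yw; move: yW; rewrite notin_setE; apply.
  have -> : (ts + h) * y - k%:R * ((ts + h) * nu) =
    (ts * y - k%:R * (ts * nu)) + h * (y - k%:R * nu) by ring.
  have -> : (ts - h) * y - k%:R * ((ts - h) * nu) =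
    (ts * y - k%:R * (ts * nu)) + - h * (y - k%:R * nu) by ring.
  rewrite !(expRD (ts * y - _)) -mulrDr [leRHS]mulrCA -[leLHS]mulr1.
  rewrite ler_wpM2l ?expR_ge0// (expRN (k%:R * (h * s))) ler_pdivlMl ?expR_gt0// mulr1.
  apply: le_trans (expR_ge_cosh _ _).
  rewrite ler_expR normrM gtr0_norm//.
  by have := ler_wpM2l (ltW h0) (ltW yW'); clear; lra.
have mW : measurable W by exact: mwin.
have GW : conv_pow G k W \is a fin_num by exact: fin_num_measure.
have key : (m / c) ^+ k <= expR (k%:R * e / 2) * fine (conv_pow G k W) +
   expR (- (k%:R * (h * s))) * ((z (ts + h) / c) ^+ k + (z (ts - h) / c) ^+ k).
  rewrite -lee_fin -GI EFinD !EFinM EFinD -!GI fineK//.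
  apply: (@le_trans _ _ (\int[conv_pow G k]_y (((expR (k%:R * e / 2))%:E * (\1_W y)%:E) +
   (expR (- (k%:R * (h * s))))%:E * ((expR ((ts + h) * y - k%:R * ((ts + h) * nu)))%:E
      + (expR ((ts - h) * y - k%:R * ((ts - h) * nu)))%:E)))%E).
    apply: ge0_le_integral => //.
    - apply: emeasurable_funD; first by apply: measurable_funeM; exact/measurable_EFinP.
      by apply: measurable_funeM; exact: emeasurable_funD.
    - by move=> y _; rewrite -!EFinM -!EFinD lee_fin; exact: pw.
  rewrite ge0_integralD//; last 3 first.
  - by apply: measurable_funeM; exact/measurable_EFinP.
  - by move=> y _; rewrite -EFinD -EFinM lee_fin mulr_ge0 ?addr_ge0 ?expR_ge0.
  - by apply: measurable_funeM; exact: emeasurable_funD.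
  rewrite ge0_integralZl//; last exact/measurable_EFinP.
  rewrite integral_indic// setIT leeD2l// ge0_integralZl//.
  - by rewrite ge0_integralD.
  - exact: emeasurable_funD.
  - by move=> y _; rewrite -EFinD lee_fin addr_ge0 ?expR_ge0.
have bnd sg : `|sg| = 1 -> (z (ts + sg * h) / c) ^+ k <= (m / c) ^+ k * expR (k%:R * (h * s / 2)).
  move=> sg1; rewrite expRM_natl -exprMn; apply: lerXn2r; rewrite ?nnegrE.
  - by rewrite divr_ge0 ?(ltW (z0 _)) ?(ltW c0).
  - by rewrite mulr_ge0 ?expR_ge0// divr_ge0 ?(ltW (z0 _)) ?(ltW c0).
  - by rewrite mulrAC ler_wpM2r ?invr_ge0 ?(ltW c0)//; exact: near1.
have bp := bnd 1 (normr1 _); have bm := bnd (-1) (normrN1 _).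
rewrite mul1r in bp; rewrite mulN1r in bm.
have mc0 : 0 < (m / c) ^+ k by rewrite exprn_gt0// divr_gt0// z0.
have small : expR (- (k%:R * (h * s))) * ((z (ts + h) / c) ^+ k + (z (ts - h) / c) ^+ k)
   <= (m / c) ^+ k / 2.
  apply: (@le_trans _ _ (expR (- (k%:R * (h * s))) *
     (2 * ((m / c) ^+ k * expR (k%:R * (h * s / 2)))))).
    by rewrite ler_wpM2l ?expR_ge0// mulr_natl mulr2n lerD.
  have -> : expR (- (k%:R * (h * s))) * (2 * ((m / c) ^+ k * expR (k%:R * (h * s / 2))))
    = (m / c) ^+ k * (2 * (expR (- (k%:R * (h * s))) * expR (k%:R * (h * s / 2)))) by ring.
  rewrite -expRD ler_wpM2l ?(ltW mc0)//.
  have -> : - (k%:R * (h * s)) + k%:R * (h * s / 2) = - (k%:R * (h * s / 2)) by field.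
  have : 4 <= expR (k%:R * (h * s / 2)) by have := expR_ge1Dx (k%:R * (h * s / 2)); clear -hsk; lra.
  rewrite expRN => h4.
  have := lef_pV2 (expR_gt0 (k%:R * (h * s / 2))) (ltr0Sn R 3).
  by rewrite h4; clear; lra.
apply: (@le_trans _ _ (conv_pow F k W)); last first.
  apply: le_measure; rewrite ?inE//.
  move=> y /windowP yW; apply/windowP; apply: (le_trans yW).
  by rewrite ler_wpM2l.
apply: le_trans (GF k W mW).
rewrite -(fineK GW) -EFinM lee_fin.
set g := fine _ in key *.
have h2 : (m / c) ^+ k / 2 <= expR (k%:R * e / 2) * g by exact: cramer_half key small.
have h4 : expR (- (k%:R * r)) <= m ^+ k.
  have -> : - (k%:R * r) = k%:R * - r by ring.
  rewrite expRM_natl; apply: lerXn2r; rewrite ?nnegrE ?expR_ge0//.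
  - exact: ltW (z0 _).
  - exact: ltW (zr _).
have h5 : 2 <= expR (k%:R * e / 2) by have := expR_ge1Dx (k%:R * e / 2); clear -ek; lra.
have -> : - (k%:R * (r + e)) = - (k%:R * r) - k%:R * e / 2 - k%:R * e / 2 by field.
rewrite !expRD !(expRN (k%:R * e / 2)).
apply: (@cramer_absorb _ (m ^+ k)) => //; first by rewrite exprn_gt0.
- by rewrite fine_ge0.
- by rewrite -expr_div_n.
Qed.

End CramerLowerBound.

(** * Product formula for independent observations *)

Section WeightUnique.
Local Open Scope ereal_scope.

Lemma measurable_generated d (T : measurableType d) (G : set (set T)) :
  G `<=` measurable ->
  measurable_fun [set: g_sigma_algebraType G] (id : g_sigma_algebraType G -> T) ->
  @measurable d T = <<s G >>.
Proof.
move=> GT mid; apply/seteqP; split => A.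
- by move=> mA; have := mid measurableT A mA; rewrite setTI.
- by apply: smallest_sub => //; exact: sigma_algebra_measurable.
Qed.

Context d d' (W : measurableType d) (T : measurableType d') (R : realType).
Variables (m : {measure set W -> \bar R}) (rho : probability T R).
Variables (G : set (set T)) (cov : (set T)^nat).
Hypotheses (GE : @measurable d' T = <<s G >>) (GI : setI_closed G).
Hypotheses (covG : forall k, G (cov k)) (covT : \bigcup_k cov k = [set: T]).

(** Both sides are measures in [A], so it is enough that they agree on a
    generating pi-system. *)
Lemma weight_unique (Z : W -> T) (g : W -> R) (c : R) :
  measurable_fun setT Z -> measurable_fun setT g ->
  (forall w, (0 <= g w)%R) -> (0 <= c)%R ->
  (forall A, G A -> \int[m]_w (g w * \1_A (Z w))%:E = c%:E * rho A) ->
  forall A, measurable A -> \int[m]_w (g w * \1_A (Z w))%:E = c%:E * rho A.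
Proof.
move=> mZ mg g0 c0 H.
have mI A : measurable A -> measurable_fun setT (fun w => (g w * \1_A (Z w))%:E).
  move=> mA; apply/measurable_EFinP; apply: measurable_funM => //.
  by apply: measurableT_comp.
pose mu1 A := \int[m]_w (g w * \1_A (Z w))%:E.
have m0 : mu1 set0 = 0.
  by apply: integral0_eq => w _; rewrite indic0 mulr0.
have mge0 A : 0 <= mu1 A.
  by apply: integral_ge0 => w _; rewrite lee_fin mulr_ge0.
have msig : semi_sigma_additive mu1.
  move=> F mF tF mUF; rewrite /mu1.
  have -> : \int[m]_w (g w * \1_(\bigcup_n F n) (Z w))%:E =
      \int[m]_w (\sum_(0 <= i <oo) (g w * \1_(F i) (Z w))%:E).
    apply: eq_integral => w _.
    rewrite EFinM indicE; case: (boolP (Z w \in _)) => /= hw.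
      move: hw; rewrite inE => -[i _ Fi].
      rewrite mule1 (@nneseriesD1 _ _ i xpredT)//; last by move=> *; rewrite lee_fin mulr_ge0.
      rewrite indicE mem_set// mulr1 eseries0 ?adde0// => j _ /= ji.
      rewrite indicE memNset ?mulr0// => Fj.
      by move: tF => /trivIsetP/(_ _ _ Logic.I Logic.I ji)/seteqP[+ _] => /(_ (Z w)); apply.
    rewrite mule0 eseries0// => j _ _; rewrite indicE memNset ?mulr0// => Fj.
    by move: hw; rewrite notin_setE; apply; exists j.
  rewrite integral_nneseries//; last 2 first.
  - by move=> n; exact: mI.
  - by move=> n w _; rewrite lee_fin mulr_ge0.
  apply: is_cvg_nneseries => i _ _.
  by apply: integral_ge0 => w _; rewrite lee_fin mulr_ge0.
pose M1 : {measure set T -> \bar R} :=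
  HB.pack mu1 (isMeasure.Build _ _ _ mu1 m0 mge0 msig).
pose M2 : {measure set T -> \bar R} := mscale (NngNum c0) rho.
have mG A : G A -> measurable A by rewrite GE; exact: sub_gen_smallest.
have M12 A : G A -> M1 A = M2 A.
  by move=> GA; exact: H.
move=> A mA.
apply: (@measure_unique _ R _ G cov GE GI covG covT M1 M2 M12 _ A mA).
move=> k; rewrite M12// /M2/= /mscale/=.
by rewrite lte_mul_pinfty// (le_lt_trans (probability_le1 _ _)) ?ltry//; exact: mG.
Qed.

End WeightUnique.

Lemma measurable_forall_fin d (W : measurableType d) (I : finType)
    (A : I -> set W) : (forall i, measurable (A i)) ->
  measurable [set w | forall i, A i w].
Proof.
move=> mA; have -> : [set w | forall i, A i w] = \bigcap_(i in [set: I]) A i.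
  by apply/seteqP; split => w /= H; [move=> i _|move=> i]; exact: H.
by apply: fin_bigcap_measurable => //; exact: finite_finset.
Qed.

Lemma measurable_fun_bigprod d (W : measurableType d) (R : realType) (I : Type)
    (s : seq I) (p : pred I) (f : I -> W -> R) :
  (forall i, measurable_fun setT (f i)) ->
  measurable_fun setT (fun w => \prod_(i <- s | p i) f i w).
Proof.
move=> mf; elim: s => [|i s IH].
  by under eq_fun do rewrite big_nil; exact: measurable_cst.
under eq_fun do rewrite big_cons.
by case: (p i) => //; exact: measurable_funM.
Qed.

Section ProductExpectation.
Context d d' (W : measurableType d) (T : measurableType d') (R : realType).
Variables (P : probability W R) (rho : probability T R).
Variables (G : set (set T)) (cov : (set T)^nat).
Hypotheses (GE : @measurable d' T = <<s G >>) (GI : setI_closed G).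
Hypotheses (covG : forall k, G (cov k)) (covT : \bigcup_k cov k = [set: T]).
Variables (n : nat) (Z : 'I_n -> W -> T).
Hypothesis mZ : forall i, measurable_fun setT (Z i).
Hypothesis indep : forall A : 'I_n -> set T, (forall i, G (A i)) ->
  P [set w | forall i, A i (Z i w)] = (\prod_(i < n) rho (A i))%E.

Let mG A : G A -> measurable A.
Proof. by rewrite GE; exact: sub_gen_smallest. Qed.

(** The factors are handled one at a time: with all other factors in the
    weight, the claim for indicators of generating sets extends to all
    indicators by uniqueness of measures, then to all nonnegative functions. *)
Lemma product_expectation (h : 'I_n -> T -> R) (c : 'I_n -> R) :
  (forall i, measurable_fun setT (h i)) -> (forall i x, 0 <= h i x) ->
  (forall i, \int[rho]_x (h i x)%:E = (c i)%:E)%E ->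
  (\int[P]_w (\prod_(i < n) h i (Z i w))%:E = (\prod_(i < n) c i)%:E)%E.
Proof.
pose ok (hi : T -> R) (ci : R) := [/\ measurable_fun setT hi, (forall x, 0 <= hi x)
  & (\int[rho]_x (hi x)%:E = ci%:E)%E].
have ok1 A : G A -> ok (\1_A) (fine (rho A)).
  move=> GA; split => //; first exact/measurable_indicP/mG.
  by rewrite integral_indic ?setIT ?fineK// ?fin_num_measure//; exact: mG.
suff S j : (j <= n)%N -> forall (h : 'I_n -> T -> R) c, (forall i, ok (h i) (c i)) ->
    (forall i : 'I_n, (j <= i)%N -> exists2 A, G A & h i = \1_A) ->
    (\int[P]_w (\prod_(i < n) h i (Z i w))%:E = (\prod_(i < n) c i)%:E)%E.
  move=> mh h0 hc; apply: (S n (leqnn n)) => i; first by split.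
  by rewrite leqNgt ltn_ord.
elim: j => [_|j IH jn] {}h {}c hc hA.
  have /choice[A hAi] : forall i, exists A, G A /\ h i = \1_A.
    by move=> i; have [A ? ?] := hA i (leq0n i); exists A.
  have mE : measurable [set w | forall i, A i (Z i w)].
    apply: measurable_forall_fin => i; rewrite -[X in measurable X]setTI.
    by apply: mZ => //; apply: mG; have [] := hAi i.
  transitivity (P [set w | forall i, A i (Z i w)]).
    rewrite -integral_indicT//; apply: eq_integral => w _; congr EFin.
    rewrite indicE; case: (boolP (w \in _)) => /=; rewrite ?inE ?notin_setE /= => H.
      by rewrite big1// => i _; have [_ ->] := hAi i; rewrite indicE mem_set.
    have [i Hi] : exists i, ~ A i (Z i w) by apply: contrapT => /forallNP H'; apply: H => i; apply: contrapT.
    by rewrite (bigD1 i)//=; have [_ ->] := hAi i; rewrite indicE memNset ?mul0r.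
  rewrite indep; last by move=> i; have [] := hAi i.
  rewrite -prodEFin; apply: eq_bigr => i _.
  have [GA hE] := hAi i; have [_ _] := hc i; rewrite hE => <-.
  by rewrite integral_indic ?setIT//; exact: mG.
pose J := Ordinal jn.
pose g w := \prod_(i < n | i != J) h i (Z i w).
pose C := \prod_(i < n | i != J) c i.
have c0 i : 0 <= c i.
  have [_ hi0 ci] := hc i; rewrite -lee_fin -ci; apply: integral_ge0 => x _.
  by rewrite lee_fin.
have [mhJ hJ0 hJc] := hc J.
transitivity (\int[P]_w ((g w)%:E * (h J (Z J w))%:E))%E.
  by apply: eq_integral => w _; rewrite (bigD1 J)//= mulrC EFinM.
have mg : measurable_fun setT g.
  apply: measurable_fun_bigprod => i; have [mhi _ _] := hc i.
  exact: measurableT_comp.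
have g0 w : 0 <= g w by apply: prodr_ge0 => i _; have [] := hc i.
rewrite (@weighted_integral _ _ _ _ _ P rho (Z J) g C _ _ _ _ (fun x => (h J x)%:E)) //; last 2 first.
- apply: (weight_unique GE GI covG covT) => //; first by apply: prodr_ge0.
  move=> A GA.
  pose h' i := if i == J then \1_A else h i.
  pose c' i := if i == J then fine (rho A) else c i.
  transitivity (\int[P]_w (\prod_(i < n) h' i (Z i w))%:E)%E.
    apply: eq_integral => w _; rewrite [in RHS](bigD1 J)//= /h' eqxx mulrC.
    by congr (_ * _)%:E; apply: eq_bigr => i /negbTE ->.
  rewrite (IH (ltnW jn) h' c').
  + rewrite (bigD1 J)//= /c' eqxx mulrC EFinM fineK; last by apply: fin_num_measure; exact: mG.
    by congr (_%:E * _)%E; apply: eq_bigr => i /negbTE ->.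
  + by move=> i; rewrite /h' /c'; case: ifP => _ //; exact: ok1.
  + move=> i ji; rewrite /h'; case: ifP => [_|iJ]; first by exists A.
    apply: hA; rewrite ltn_neqAle ji andbT; apply/eqP => e.
    by move: iJ; rewrite -val_eqE/= -e eqxx.
- exact/measurable_EFinP.
by rewrite hJc -EFinM mulrC [in RHS](bigD1 J).
Qed.

End ProductExpectation.

Section SizeLaw.
Local Open Scope ereal_scope.
Context {R : realType}.
Implicit Types (Q : probability nat R) (F : probability R R).

Lemma measurable_fun_nat d (T : measurableType d) (f : nat -> T) :
  measurable_fun setT f.
Proof. by move=> _ A mA; exact: I. Qed.
Hint Resolve measurable_fun_nat : core.

Lemma measurable_nat (A : set nat) : measurable A.
Proof. by []. Qed.
Hint Resolve measurable_nat : core.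

Lemma integral_nat Q (f : nat -> \bar R) : (forall k, 0 <= f k) ->
  \int[Q]_k f k = \sum_(0 <= k <oo) Q [set k] * f k.
Proof.
move=> f0.
have E : \bigcup_k [set k] = [set: nat] by apply/seteqP; split => // k _; exists k.
rewrite -E ge0_integral_bigcup//; last by
  apply/trivIsetP => i j _ _ ij; apply/seteqP; split => // k [/= -> /eqP]; rewrite (negbTE ij).
apply: eq_eseriesr => k _.
transitivity (\int[Q]_(x in [set k]) (cst (f k)) x).
  by apply: eq_integral => x; rewrite inE => ->.
by rewrite integral_cst// muleC.
Qed.

Lemma fine_probability_ge0 d (T : measurableType d) (P : probability T R) A :
  (0 <= fine (P A))%R.
Proof. by rewrite fine_ge0. Qed.

Let idTR : measurableTypeR R -> R := idfun.

#[local] HB.instance Definition _ :=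
  @isMeasurableFun.Build _ _ _ _ idTR (@measurable_id _ _ setT).

Definition unif01 : probability R R :=
  distribution (uniform_prob (@ltr01 R)) idTR.

Lemma unif01E A : unif01 A = uniform_prob (@ltr01 R) A.
Proof. by []. Qed.

Definition tag_size (k : nat) (z : R * R) : nat * (R * R) := (k, z).

Lemma measurable_tag_size k : measurable_fun setT (tag_size k).
Proof. exact: measurable_fun_pair. Qed.

HB.instance Definition _ k :=
  isMeasurableFun.Build _ _ _ _ (tag_size k) (measurable_tag_size k).

Definition size_component F k : probability (nat * (R * R))%type R :=
  distribution (conv_pow F k \x unif01) (tag_size k).

(** The mixture, over the sizes [k], of the law of a triple with first
    component [k], observation of law [F ^ k] and uniform third component; a
    countable sum, so that integrals against it are iterated integrals. *)
Definition size_law Q F : {measure set (nat * (R * R)) -> \bar R} :=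
  mseries (fun k => mscale (NngNum (fine_probability_ge0 Q [set k]))
                      (size_component F k)) 0.

Lemma integral_size_law Q F (h : nat * (R * R) -> \bar R) :
  measurable_fun setT h -> (forall z, 0 <= h z) ->
  \int[size_law Q F]_z h z =
  \int[Q]_k \int[conv_pow F k]_y \int[unif01]_v h (k, (y, v)).
Proof.
move=> mh h0; rewrite integral_nat; last first.
  by move=> k; apply: integral_ge0 => y _; exact: integral_ge0.
rewrite ge0_integral_measure_series//; apply: eq_eseriesr => k _.
rewrite ge0_integral_mscale//= fineK ?fin_num_measure//; congr (_ * _).
rewrite ge0_integral_distribution// fubini_tonelli1//; last by move=> z; exact: h0.
by apply: (measurableT_comp mh); exact: measurable_tag_size.
Qed.

Lemma measurable_section (h : nat * (R * R) -> \bar R) F k :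
  measurable_fun setT h -> (forall z, 0 <= h z) ->
  measurable_fun setT (fun y => \int[unif01]_v h (k, (y, v))).
Proof.
move=> mh h0.
apply: (@measurable_fun_fubini_tonelli_F _ _ _ _ _ unif01
  (fun z : R * R => h (k, z))) => //.
by apply: (measurableT_comp mh); exact: measurable_tag_size.
Qed.

(** The alternative mixes the two laws conditionally on the size, which
    amounts to mixing the two laws of the triple. *)
Definition obs_measure Q F0 F1 (e : R) (e0 : (0 <= e)%R) (e1 : (0 <= 1 - e)%R) :
    {measure set (nat * (R * R)) -> \bar R} :=
  measure_add (mscale (NngNum e1) (size_law Q F0)) (mscale (NngNum e0) (size_law Q F1)).

Section Law.
Variables (Q : probability nat R) (F0 F1 : probability R R) (e : R).
Hypotheses (e0 : (0 <= e)%R) (e1 : (0 <= 1 - e)%R).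

Let integral_obs_measure (h : nat * (R * R) -> \bar R) :
  measurable_fun setT h -> (forall z, 0 <= h z) ->
  \int[obs_measure Q F0 F1 e0 e1]_z h z =
  (1 - e)%:E * \int[size_law Q F0]_z h z + e%:E * \int[size_law Q F1]_z h z.
Proof.
move=> mh h0; rewrite ge0_integral_measure_add//.
by rewrite !ge0_integral_mscale.
Qed.

Let obs_measureT : obs_measure Q F0 F1 e0 e1 setT = 1.
Proof.
rewrite -integral_indicT// integral_obs_measure//; last exact/measurable_EFinP.
have E F : \int[size_law Q F]_z (\1_[set: nat * (R * R)] z)%:E = 1.
  rewrite integral_size_law//; last exact/measurable_EFinP.
  transitivity (\int[Q]_k 1%:E); last by rewrite integral_cst_probability.
  apply: eq_integral => k _; rewrite -[RHS](integral_cst_probability (conv_pow F k)).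
  apply: eq_integral => y _; rewrite -[RHS](integral_cst_probability unif01).
  by apply: eq_integral => v _; rewrite indicT.
by rewrite !E !mule1 -EFinD subrK.
Qed.

Definition obs_law : probability (nat * (R * R))%type R :=
  HB.pack (Measure.sort (obs_measure Q F0 F1 e0 e1))
    (Measure_isProbability.Build _ _ _ (obs_measure Q F0 F1 e0 e1) obs_measureT).

Lemma obs_lawE A :
  obs_law A = (1 - e)%:E * size_law Q F0 A + e%:E * size_law Q F1 A.
Proof. exact: measure_addE. Qed.

Lemma integral_obs_law (h : nat * (R * R) -> \bar R) :
  measurable_fun setT h -> (forall z, 0 <= h z) ->
  \int[obs_law]_z h z =
  (1 - e)%:E * \int[size_law Q F0]_z h z + e%:E * \int[size_law Q F1]_z h z.
Proof. exact: integral_obs_measure. Qed.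

End Law.

(** Singletons for the size and measurable rectangles for the other two
    coordinates generate the product sigma-algebra. *)
Definition size_rect : set (set (nat * (R * R))) :=
  [set A | A = set0 \/ exists k B C, [/\ measurable B, measurable C &
     A = [set z | [/\ z.1 = k, B z.2.1 & C z.2.2]] ]].

Lemma size_rectI : setI_closed size_rect.
Proof.
move=> A A' [->|[k [B [C [mB mC ->]]]]] [->|[k' [B' [C' [mB' mC' ->]]]]].
- by left; rewrite setI0.
- by left; rewrite set0I.
- by left; rewrite setI0.
have [kk|kk] := eqVneq k k'.
  right; exists k, (B `&` B'), (C `&` C'); split; [exact: measurableI|exact: measurableI|].
  apply/seteqP; split => z /=; first by move=> [[? ? ?] [? ? ?]].
  by move=> [-> [? ?] [? ?]]; rewrite -kk.
by left; apply/seteqP; split => // z /= [[z1 _ _] [z2 _ _]]; move: kk; rewrite -z1 -z2 eqxx.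
Qed.

Lemma size_rect_measurable : size_rect `<=` measurable.
Proof.
move=> A [->|[k [B [C [mB mC ->]]]]]; first exact: measurable0.
have -> : [set z : nat * (R * R) | [/\ z.1 = k, B z.2.1 & C z.2.2]] = [set k] `*` (B `*` C).
  by apply/seteqP; split => z /=; [move=> []|move=> [? []]].
by apply: measurableX => //; exact: measurableX.
Qed.

Lemma size_rect_generated : @measurable _ (nat * (R * R))%type = <<s size_rect >>.
Proof.
apply: measurable_generated; first exact: size_rect_measurable.
have cupE (A : set (nat * (R * R))) : (forall k, size_rect (A `&` [set z | z.1 = k])) ->
    <<s size_rect >> A.
  move=> H; have -> : A = \bigcup_k (A `&` [set z | z.1 = k]).
    by apply/seteqP; split => [z Az|z [k _ []]//]; exists z.1.
  by apply: sigma_algebra_bigcup => k; apply: sub_gen_smallest.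
have -> : (id : g_sigma_algebraType size_rect -> _) = (fun z => (z.1, (z.2.1, z.2.2))).
  by apply/funext => -[? []].
apply: measurable_fun_pair => /=; last apply: measurable_fun_pair => /=.
- move=> _ A mA; rewrite setTI; apply: cupE => k.
  have [Ak|Ak] := pselect (A k); [right|left].
    exists k, setT, setT; split => //; apply/seteqP; split => z /=; first by move=> [].
    by move=> [-> _ _].
  by apply/seteqP; split => // z /= [Az zk]; apply: Ak; rewrite -zk.
- move=> _ B mB; rewrite setTI; apply: cupE => k; right; exists k, B, setT; split => //.
  by apply/seteqP; split => z /=; [move=> []|move=> [? ? _]].
- move=> _ C mC; rewrite setTI; apply: cupE => k; right; exists k, setT, C; split => //.
  by apply/seteqP; split => z /=; [move=> []|move=> [? _ ?]].
Qed.

Lemma size_rect_cover k : size_rect [set z | z.1 = k].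
Proof.
by right; exists k, setT, setT; split => //; apply/seteqP; split => z /=; [|move=> []].
Qed.

Lemma size_rect_coverT : \bigcup_k [set z : nat * (R * R) | z.1 = k] = setT.
Proof. by apply/seteqP; split => // z _; exists z.1. Qed.

Lemma size_law_rect Q F k B C : measurable B -> measurable C ->
  size_law Q F [set z | [/\ z.1 = k, B z.2.1 & C z.2.2]] =
  Q [set k] * (conv_pow F k B * unif01 C).
Proof.
move=> mB mC; set A := (X in size_law _ _ X).
have mA : measurable A by apply: size_rect_measurable; right; exists k, B, C.
rewrite -integral_indicT// integral_size_law//; last exact/measurable_EFinP.
rewrite (_ : \int[Q]_j _ = \int[Q]_j ((\1_[set k] j)%:E * (conv_pow F k B * unif01 C))).
  rewrite ge0_integralZr//; last by rewrite mule_ge0.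
  by rewrite integral_indicT.
apply: eq_integral => j _; rewrite indicE; case: (boolP (j \in [set k])) => /=.
  rewrite inE => /= ->; rewrite mul1e.
  rewrite -(integral_indicT (conv_pow F k) mB) -ge0_integralZr//; last exact/measurable_EFinP.
  apply: eq_integral => y _.
  rewrite -(integral_indicT unif01 mC) -ge0_integralZl//; last exact/measurable_EFinP.
  apply: eq_integral => v _; rewrite -EFinM; congr EFin; rewrite !indicE.
  rewrite -natrM mulnb; congr (_%:R); congr nat_of_bool.
  apply/idP/andP; rewrite !inE /A/=; first by move=> [].
  by move=> [? ?].
rewrite notin_setE mul0e => jk.
apply: integral0_eq => y _; apply: integral0_eq => v _.
by rewrite indicE memNset// => -[].
Qed.

End SizeLaw.

Section MixtureSample.
Local Open Scope ereal_scope.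
Context {R : realType}.
Variables (F0 F1 : probability R R) (Q : probability nat R) (e : R).
Hypotheses (e0 : (0 <= e)%R) (e1 : (0 <= 1 - e)%R).
Variables (n : nat) (d : measure_display) (Omega : measurableType d).
Variables (P : probability Omega R) (K : 'I_n -> {mfun Omega >-> nat})
  (Y V : 'I_n -> {mfun Omega >-> R}).
Hypothesis HS : mixture_sample F0 F1 Q e P K Y V.

Definition obs (i : 'I_n) (w : Omega) : nat * (R * R) := (K i w, (Y i w, V i w)).

Lemma measurable_obs i : measurable_fun setT (obs i).
Proof. by apply: measurable_fun_pair => //; exact: measurable_fun_pair. Qed.

(** The hypothesis on the sample gives the product rule on rectangles only;
    all moment computations use it in this form, one function per observation.
    *)
Lemma mixture_sample_expectation (h : 'I_n -> nat * (R * R) -> R) (c : 'I_n -> R) :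
  (forall i, measurable_fun setT (h i)) -> (forall i z, (0 <= h i z)%R) ->
  (forall i, \int[obs_law Q F0 F1 e0 e1]_z (h i z)%:E = (c i)%:E) ->
  \int[P]_w (\prod_(i < n) h i (obs i w))%:E = (\prod_(i < n) c i)%:E.
Proof.
apply: (product_expectation size_rect_generated size_rectI size_rect_cover size_rect_coverT).
  exact: measurable_obs.
move=> A GA.
have [[i0 Ai0]|nA] := pselect (exists i, A i = set0).
  rewrite (bigD1 i0)//= Ai0 measure0 mul0e.
  rewrite [X in P X](_ : _ = set0) ?measure0//.
  by apply/seteqP; split => // w /(_ i0); rewrite Ai0.
have /choice[k /choice[B /choice[C HA]]] : forall i, exists k B C, [/\ measurable B, measurable C &
     A i = [set z : nat * (R * R) | [/\ z.1 = k, B z.2.1 & C z.2.2]] ].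
  by move=> i; case: (GA i) => // Ai0; exfalso; apply: nA; exists i.
have mB i : measurable (B i) by have [] := HA i.
have mC i : measurable (C i) by have [] := HA i.
have AE i : A i = [set z : nat * (R * R) | [/\ z.1 = k i, B i z.2.1 & C i z.2.2]] by have [] := HA i.
have -> : [set w | (forall i, A i (obs i w))] =
    [set w | forall i, [/\ K i w = k i, B i (Y i w) & C i (V i w)]].
  by apply/seteqP; split => w /= H i; have := H i; rewrite AE.
rewrite (aux_uniform HS)// (data_given_sizes HS)// (sizes_iid HS).
rewrite -!big_split/=; apply: eq_bigr => i _; rewrite AE.
apply: etrans (esym (obs_lawE Q F0 F1 e0 e1 _)).
rewrite !size_law_rect// -!unif01E.
rewrite (muleCA (1 - e)%:E) (muleCA e%:E) -ge0_muleDr.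
- by rewrite -muleA; congr (_ * _); rewrite muleA muleA -ge0_muleDl// mule_ge0// lee_fin.
- by rewrite !mule_ge0// lee_fin.
- by rewrite !mule_ge0// lee_fin.
Qed.

End MixtureSample.

(** * Convex duality for the phase transition curve *)

Section Duality.
Context {R : realType}.
Variables (Th : set R) (ps : R -> R) (th mu0 a0 : R) (J : R -> R).
Hypotheses (Th0 : Th 0) (Thth : Th th) (th0 : th != 0).
Hypothesis convTh : forall s t l, Th s -> Th t -> 0 <= l <= 1 ->
  Th (l * s + (1 - l) * t) /\ ps (l * s + (1 - l) * t) <= l * ps s + (1 - l) * ps t.
Hypothesis subgrad : forall t, Th t -> ps th + mu0 * (t - th) <= ps t.

Let I0 := th * mu0 - ps th.
Hypotheses (I0_ge0 : 0 <= I0) (a0_gt0 : 0 < a0) (a0I0 : a0 * I0 <= 1).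
Hypothesis J0 : forall a, 0 <= a <= a0 -> J a = 0.
Hypothesis Jmono : forall a b, a0 <= a -> a <= b -> J a <= J b.
Hypothesis Jcont : forall a, a0 <= a -> {within `[a0, a], continuous J}.

Definition rate_le (nu y : R) := forall t, Th t -> t * nu - ps t <= y.

(** The pair [(nu, a)] is admissible for the curve and gives it a value of at
    least [be]. Only the upper bound [y] on the rate at [nu] enters, which
    spares the supremum and infinite rates. *)
Definition curve_point (be nu a y : R) := [/\ rate_le nu y, a * y + J a <= 1 &
  be <= a * (th * nu - ps th) + 2^-1 * (1 - (a * y + J a))].

(** In powers of [n], at relative size [a]: [n] observations, probability
    [- J a] of the size, mixing weight [- be] to the power [s], and cumulant
    of order [s] of the log-likelihood ratio of one observation. *)
Definition moment_exponent (be a s : R) :=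
  1 - J a - be * s + a * (ps (s * th) - s * ps th).

(** The tangent at [th] bounds [ps] from below; its value at the origin is
    [- I0]. *)
Lemma cumulant_gap_ge0 s : 1 <= s -> Th (s * th) -> 0 <= ps (s * th) - s * ps th.
Proof.
move=> s1 /subgrad h; have : 0 <= (s - 1) * I0 by rewrite mulr_ge0// subr_ge0.
by rewrite /I0; lra.
Qed.

(** A line through [(2, 0)] below the exponent, with slope [x <= 0], is a
    certificate for a point of the curve. The exponent is a constant minus a
    linear function of [s] plus [a] times [ps (s * th)], so an affine minorant
    of it is one of [ps], whose slope is [nu] and whose intercept is the rate.
    The abscissa [2] matches the coefficient [1 / 2] of the curve function. *)
Lemma curve_point_of_line be a x : 0 < a -> x <= 0 ->
  (forall s, Th (s * th) -> (s - 2) * x <= moment_exponent be a s) ->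
  exists nu y, curve_point be nu a y.
Proof.
move=> a0' x0 H.
exists ((ps th + (be + x) / a) / th), ((1 - J a + 2 * x) / a).
have tE t : a * (t * ((ps th + (be + x) / a) / th) - ps t) =
    (t / th) * (be + x) + a * ((t / th) * ps th - ps t).
  by field; rewrite th0 gt_eqF.
split.
- move=> t Tht; rewrite ler_pdivlMr// mulrC tE.
  have tth : t / th * th = t by rewrite divfK.
  have := H (t / th); rewrite /moment_exponent tth => /(_ Tht); lra.
- by rewrite mulrCA mulfV ?gt_eqF//; lra.
- rewrite tE mulfV// mulrCA mulfV ?gt_eqF//; lra.
Qed.

(** Convexity of [ps]: the exponent at [2] is at most its interpolation
    between [s1] and [s2]. *)
Lemma moment_exponent_chord be a s1 s2 : 0 < a -> s1 < 2 -> 2 < s2 ->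
  Th (s1 * th) -> Th (s2 * th) -> 0 <= moment_exponent be a 2 ->
  0 <= (s2 - 2) * moment_exponent be a s1 + (2 - s1) * moment_exponent be a s2.
Proof.
move=> a0' h1 h2 T1 T2 G2.
pose l := (s2 - 2) / (s2 - s1).
have d0 : 0 < s2 - s1 by lra.
have l01 : 0 <= l <= 1.
  by rewrite divr_ge0 ?ler_pdivrMr//=; lra.
have [_] := convTh T1 T2 l01.
have -> : l * (s1 * th) + (1 - l) * (s2 * th) = 2 * th by rewrite /l; field; lra.
move=> h.
have h' := ler_wpM2l (ltW d0) h.
have E : (s2 - s1) * (l * ps (s1 * th) + (1 - l) * ps (s2 * th)) =
  (s2 - 2) * ps (s1 * th) + (2 - s1) * ps (s2 * th) by rewrite /l; field; lra.
rewrite E in h'; have h2' := ler_wpM2l (ltW a0') h'.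
have h3 := ler_wpM2l (ltW d0) G2.
move: h2' h3; rewrite /moment_exponent; lra.
Qed.

(** Strong duality. A convex function that is nonnegative on [[1, 2]] lies
    above a line through [(2, 0)] of nonpositive slope, unless it is negative
    somewhere to the left of [1]. In that case, being nonnegative at [1], it
    has a positive slope there, and the optimal observation is the mean [mu0],
    at the relative size [a] or, when [a] violates the constraint, at the
    smaller size where the constraint is active. *)
Lemma curve_point_of_moments be a : a0 <= a ->
  (forall s, 1 <= s <= 2 -> Th (s * th) -> 0 <= moment_exponent be a s) ->
  exists nu a' y, a0 <= a' /\ curve_point be nu a' y.
Proof.
move=> a0a H.
have a_gt0 : 0 < a by exact: lt_le_trans a0_gt0 a0a.
have H1 : 0 <= moment_exponent be a 1 by apply: H; rewrite ?mul1r//; lra.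
have mE : moment_exponent be a 1 = 1 - J a - be.
  by rewrite /moment_exponent !mul1r; lra.
have [[s [s1 [Ts Gs]]]|nA] :=
    pselect (exists s, s < 1 /\ (Th (s * th) /\ moment_exponent be a s < 0)).
  (* The exponent increases between [s] and [1], hence its tangent at [1] has
     a nonnegative slope: this is [be <= a * I0]. *)
  have aI : be <= a * I0.
    have h1 := ler_wpM2l (ltW a_gt0) (subgrad Ts).
    have : 0 < (1 - s) * (a * I0 - be).
      by move: h1 Gs H1; rewrite /moment_exponent /I0 !mul1r; lra.
    by rewrite pmulr_rgt0; lra.
  have mu_le : rate_le mu0 I0 by move=> t /subgrad; rewrite /I0; lra.
  have [g1|g1] := leP (a * I0 + J a) 1.
    exists mu0, a, I0; split => //; split => //.
    by move: aI g1; rewrite -/I0; lra.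
  (* The size [a] is too large for the mean; decrease it until the constraint
     is tight. *)
  have [] := @IVT R (fun b => b * I0 + J b) a0 a 1 a0a.
  - move=> x; apply: cvgD; last exact: Jcont.
    have : {within `[a0, a], continuous (fun b : R => b * I0)}.
      by apply: continuous_subspaceT => z; apply: cvgM => //; exact: cvg_cst.
    exact.
  - have Ja0 : J a0 = 0 by apply: J0; rewrite lexx ltW.
    by rewrite ge_min le_max Ja0 addr0 a0I0/= (ltW g1) orbT.
  move=> b; rewrite in_itv/= => /andP[b1 b2] bE.
  exists mu0, b, I0; split => //; split => //; first by rewrite bE.
  have := Jmono b1 b2; rewrite -/I0; move: bE H1; rewrite mE; lra.
have [[s [s2 [Ts Gs]]]|nB] :=
    pselect (exists s, 2 < s /\ (Th (s * th) /\ moment_exponent be a s < 0)); last first.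
  (* The exponent is nonnegative wherever it is defined, and the horizontal
     line will do. *)
  suff /(curve_point_of_line a_gt0 (lexx 0))[nu [y h]] :
      forall s, Th (s * th) -> (s - 2) * 0 <= moment_exponent be a s.
    by exists nu, a, y.
    move=> s Ts; rewrite mulr0 leNgt; apply/negP => Gs.
    have [s1|s1] := ltP s 1; first by apply: nA; exists s.
    have [s2|s2] := ltP 2 s; first by apply: nB; exists s.
    by have := H s; rewrite s1 s2 => /(_ isT Ts); rewrite leNgt Gs.
have T2 : Th (2 * th).
  have l01 : 0 <= 2 / s <= 1 by rewrite divr_ge0 ?ler_pdivrMr//=; lra.
  have [+ _] := convTh Ts Th0 l01.
  by rewrite mulr0 addr0 mulrA divfK// gt_eqF; lra.
have G2 : 0 <= moment_exponent be a 2 by apply: H => //; lra.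
(* The exponent is negative somewhere beyond [2]: take the largest slope of a
   line through [(2, 0)] that stays below it to the right of [2]; convexity
   keeps the line below it to the left as well. *)
pose S := [set moment_exponent be a u / (u - 2) | u in [set u | 2 < u /\ Th (u * th)]].
have lbS u : u < 2 -> Th (u * th) -> lbound S (moment_exponent be a u / (u - 2)).
  move=> u2 Tu _ [v [v2 Tv] <-].
  have := moment_exponent_chord a_gt0 u2 v2 Tu Tv G2.
  set A := moment_exponent be a u; set B := moment_exponent be a v => h.
  have -> : A / (u - 2) = - A / (2 - u) by field; lra.
  rewrite ler_pdivlMr; last by lra.
  rewrite mulrAC ler_pdivrMr; lra.
have hS : has_inf S.
  split; first by exists (moment_exponent be a s / (s - 2)); exists s.
  by exists (moment_exponent be a 1 / (1 - 2)); apply: lbS; rewrite ?mul1r//; lra.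
have x0 : inf S <= 0.
  apply: (@le_trans _ _ (moment_exponent be a s / (s - 2))).
    by apply: ge_inf; [exact: hS.2|exists s].
  by rewrite ltW// ltr_pdivrMr ?mul0r//; lra.
suff /(curve_point_of_line a_gt0 x0)[nu [y h]] :
    forall u, Th (u * th) -> (u - 2) * inf S <= moment_exponent be a u.
  by exists nu, a, y.
move=> u Tu; case: (ltgtP u 2) => u2.
- have : moment_exponent be a u / (u - 2) <= inf S.
    by apply: lb_le_inf; [exact: hS.1|exact: lbS].
  by rewrite ler_ndivrMr ?subr_lt0// mulrC.
- have : inf S <= moment_exponent be a u / (u - 2).
    by apply: ge_inf; [exact: hS.2|exists u].
  by rewrite ler_pdivlMr ?subr_gt0// mulrC.
- by rewrite u2 subrr mul0r.
Qed.

(** Weak duality: the tilt [s * th] tests the rate at [nu]. With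
    [x = a * (th * nu - ps th) - be], the moment condition reads
    [1 - g + s * x <= 0], where [g = a * y + J a <= 1]; thus [x <= 0], and
    [s <= 2] gives [1 - g + 2 * x <= 0]. *)
Lemma curve_le_of_moment be be' a s nu y : 1 <= s <= 2 -> Th (s * th) -> 0 < a ->
  moment_exponent be a s <= 0 -> curve_point be' nu a y -> be' <= be.
Proof.
move=> /andP[s1 s2] Ts a_gt0 G [ry g1 fb].
have h := ler_wpM2l (ltW a_gt0) (ry _ Ts).
set x := a * (th * nu - ps th) - be.
have h1 : 1 - (a * y + J a) + s * x <= 0.
  by move: G h; rewrite /moment_exponent /x; lra.
have x0 : x <= 0.
  have : s * x <= 0 by lra.
  by rewrite pmulr_rle0//; lra.
have h2 : (2 - s) * x <= 0 by rewrite mulr_ge0_le0//; lra.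
by move: fb h1 h2; rewrite /x; lra.
Qed.

(** On [[0, a0]] the rate [J] vanishes and the exponents increase with the
    relative size, so nothing is lost by replacing a smaller size with [a0].
    *)
Lemma curve_point_large_size be be' nu a y : 0 < a -> curve_point be' nu a y ->
  be < be' -> exists nu' a' y', a0 <= a' /\ curve_point be nu' a' y'.
Proof.
move=> a_gt0 cp bb.
have [a0a|aa0] := leP a0 a.
  by exists nu, a, y; split => //; case: cp => ? ? ?; split => //; lra.
apply: (@curve_point_of_moments be a0) => // s s12 Ts.
rewrite leNgt; apply/negP => G0.
suff : be' <= be by rewrite leNgt bb.
apply: (curve_le_of_moment s12 Ts a_gt0 _ cp).
have Ja : J a = 0 by apply: J0; rewrite !ltW.
have Ja0 : J a0 = 0 by apply: J0; rewrite lexx ltW.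
have [s1 _] := andP s12.
have := ler_wpM2r (cumulant_gap_ge0 s1 Ts) (ltW aa0).
by move: G0; rewrite /moment_exponent Ja Ja0; lra.
Qed.

Lemma curve_point_mean : curve_point (2^-1 * (1 + a0 * I0)) mu0 a0 I0.
Proof.
have Ja0 : J a0 = 0 by apply: J0; rewrite lexx ltW.
split; first by move=> t /subgrad; rewrite /I0; lra.
- by rewrite Ja0 addr0.
- by rewrite Ja0 -/I0; lra.
Qed.

End Duality.

Section CumulantFunction.
Context {R : realType}.
Variable F0 : probability R R.
Local Notation Th := (natural_space F0).
Local Notation ps := (psi F0).

Lemma mgf_integral t : ('M_F0 (idfun : R -> R) t = \int[F0]_x (expR (t * x))%:E)%E.
Proof.
rewrite /mmt_gen_fun unlock; apply: eq_integral => x _ /=.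
by rewrite mulrC.
Qed.

Lemma measurable_expR_linear (t : R) : measurable_fun setT (fun x : R => (expR (t * x))%:E).
Proof. by apply/measurable_EFinP; apply: measurableT_comp => //; exact: measurable_funM. Qed.

Lemma integral0_ae (f : R -> R) : measurable_fun setT f -> (forall x, 0 <= f x) ->
  (\int[F0]_x (f x)%:E = 0)%E -> F0 [set x | f x = 0] = 1%E.
Proof.
move=> mf f0 If.
have mE : measurable [set x | f x = 0].
  by rewrite -[X in measurable X]setTI; exact: (mf measurableT [set 0] (measurable_set1 0)).
have /ae_eq_integral_abs : measurable_fun setT (EFin \o f) by exact/measurable_EFinP.
move=> /(_ F0 measurableT)[+ _].
have -> : (\int[F0]_x `|(EFin \o f) x| = 0)%E.
  by rewrite -[RHS]If; apply: eq_integral => x _ /=; rewrite ger0_norm.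
move=> /(_ erefl)[N [mN N0 HN]].
rewrite -(setCK [set x | f x = 0]) probability_setC; last exact: measurableC.
suff -> : F0 (~` [set x | f x = 0]) = 0%E by rewrite sube0.
apply: (@subset_measure0 _ _ _ F0 _ N) => //; first exact: measurableC.
move=> x /= fx; apply: HN => /= h; apply: fx.
by have := h I => -[].
Qed.

Lemma mgf_gt0 t : (0 < \int[F0]_x (expR (t * x))%:E)%E.
Proof.
rewrite lt0e integral_ge0; last by move=> x _; rewrite lee_fin expR_ge0.
rewrite andbT; apply/eqP => /integral0_ae h.
have : F0 [set x | expR (t * x) = 0] = 1%E.
  apply: h; last by move=> x; exact: expR_ge0.
  by apply/measurable_EFinP; exact: measurable_expR_linear.
rewrite (_ : [set x | _] = set0) ?measure0.
  by move=> /eqP; rewrite eqe eq_sym oner_eq0.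
by apply/seteqP; split => // x /= /eqP; rewrite gt_eqF// expR_gt0.
Qed.

Lemma natural_space_fin t : Th t -> (\int[F0]_x (expR (t * x))%:E = (expR (ps t))%:E)%E.
Proof.
rewrite /natural_space/= mgf_integral => h.
have fn : (\int[F0]_x (expR (t * x))%:E)%E \is a fin_num.
  by rewrite ge0_fin_numE// ltW// mgf_gt0.
rewrite /psi mgf_integral lnK ?fineK//.
by rewrite posrE fine_gt0// mgf_gt0.
Qed.

Lemma integral_expR_shift t c :
  (\int[F0]_x (expR (t * x - c))%:E = (expR (- c))%:E * \int[F0]_x (expR (t * x))%:E)%E.
Proof.
rewrite -ge0_integralZl//; last exact: measurable_expR_linear.
by apply: eq_integral => x _; rewrite -EFinM -expRD addrC.
Qed.

Lemma natural_space_shift t c : Th t ->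
  (\int[F0]_x (expR (t * x - c))%:E = (expR (ps t - c))%:E)%E.
Proof.
by move=> /natural_space_fin h; rewrite integral_expR_shift h -EFinM -expRD addrC.
Qed.

Lemma natural_space_of_le t c :
  (\int[F0]_x (expR (t * x - c))%:E <= 1)%E -> Th t /\ ps t <= c.
Proof.
move=> h.
have Tt : Th t.
  rewrite /natural_space/= mgf_integral.
  have := integral_expR_shift t c; move: h => /[swap] -> h.
  rewrite ltey; apply/eqP => e; move: h.
  by rewrite e gt0_muley ?lte_fin ?expR_gt0.
split => //; move: h; rewrite natural_space_shift// lee_fin -expR0 ler_expR.
by rewrite subr_le0.
Qed.

Lemma natural_space0 : Th 0.
Proof.
rewrite /natural_space/= mgf_integral.
under eq_integral do rewrite mul0r expR0.
by rewrite integral_cst_probability ltry.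
Qed.

Lemma psi0 : ps 0 = 0.
Proof.
rewrite /psi mgf_integral.
under eq_integral do rewrite mul0r expR0.
by rewrite integral_cst_probability ln1.
Qed.

(** Hoelder inequality, in the form of the convexity of the exponential
    applied to the normalised densities. *)
Lemma convex_psi s t l : Th s -> Th t -> 0 <= l <= 1 ->
  Th (l * s + (1 - l) * t) /\ ps (l * s + (1 - l) * t) <= l * ps s + (1 - l) * ps t.
Proof.
move=> Ts Tt /andP[l0 l1]; apply: natural_space_of_le.
have l1' : 0 <= 1 - l by rewrite subr_ge0.
have me u c : measurable_fun setT (fun x : R => (expR (u * x - c))%:E).
  by apply/measurable_EFinP; exact: measurable_expR_affine.
apply: (@le_trans _ _ (\int[F0]_x (l%:E * (expR (s * x - ps s))%:E +
   (1 - l)%:E * (expR (t * x - ps t))%:E))%E).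
  apply: ge0_le_integral => //.
  - by apply: emeasurable_funD; exact: measurable_funeM.
  - move=> x _; rewrite -!EFinM -EFinD lee_fin.
    have -> : (l * s + (1 - l) * t) * x - (l * ps s + (1 - l) * ps t) =
      l * (s * x - ps s) + (1 - l) * (t * x - ps t) by ring.
    have := @convex_expR R (Itv01 l0 l1) (s * x - ps s) (t * x - ps t).
    by rewrite !convRE/=.
rewrite ge0_integralD//; last 4 first.
- by move=> x _; rewrite -EFinM lee_fin mulr_ge0// expR_ge0.
- exact: measurable_funeM.
- by move=> x _; rewrite -EFinM lee_fin mulr_ge0// expR_ge0.
- exact: measurable_funeM.
have one c u : 0 <= c -> Th u ->
    (\int[F0]_x (c%:E * (expR (u * x - ps u))%:E) <= c%:E)%E.
  move=> c0 Tu; rewrite ge0_integralZl//.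
  by rewrite natural_space_shift// subrr expR0 mule1.
apply: (le_trans (leeD (one l s l0 Ts) (one (1 - l) t l1' Tt))).
by rewrite -EFinD lee_fin addrC subrK.
Qed.

(** With [u] the density of [th / 2] normalised by half the cumulant at [th],
    [u ^+ 2] has mean [1], and [(u - 1) ^+ 2] has mean [2 - 2 * E u]. If the
    mean of [u] were at least [1], then [u] would be constant, and so would
    the observable. *)
Lemma psi_half_lt th : (forall c, F0 [set c] <> 1%E) -> th != 0 -> Th th ->
  Th (th / 2) /\ ps (th / 2) < ps th / 2.
Proof.
move=> nd th0 Tth.
have l01 : 0 <= (2^-1 : R) <= 1 by apply/andP; split; lra.
have [Th2 _] := convex_psi Tth natural_space0 l01.
have E2 : 2^-1 * th + (1 - 2^-1) * 0 = th / 2 by rewrite mulr0 addr0 mulrC.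
rewrite E2 in Th2; split => //; rewrite ltNge; apply/negP => hle.
pose u x := expR (th / 2 * x - ps th / 2).
have mu' : measurable_fun setT u by exact: measurable_expR_affine.
have mu2 : measurable_fun setT (fun x => (u x - 1) ^+ 2).
  by apply: measurable_funX; exact: measurable_funB.
have Iu : (\int[F0]_x (u x)%:E = (expR (ps (th / 2) - ps th / 2))%:E)%E.
  exact: natural_space_shift.
have : F0 [set x | (u x - 1) ^+ 2 = 0] = 1%E.
  apply: integral0_ae => //; first by move=> x; exact: sqr_ge0.
  apply/eqP; rewrite eq_le; apply/andP; split; last first.
    by apply: integral_ge0 => x _; rewrite lee_fin sqr_ge0.
  have : (\int[F0]_x ((u x - 1) ^+ 2)%:E + \int[F0]_x (2 * u x)%:E = 2%:E)%E.
    rewrite -ge0_integralD//; last 4 first.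
    - by move=> x _; rewrite lee_fin sqr_ge0.
    - exact/measurable_EFinP.
    - by move=> x _; rewrite lee_fin mulr_ge0// expR_ge0.
    - by apply/measurable_EFinP; exact: measurable_funM.
    transitivity (\int[F0]_x ((expR (th * x - ps th))%:E + 1%:E))%E.
      apply: eq_integral => x _; rewrite -!EFinD; congr EFin.
      have -> : expR (th * x - ps th) = u x ^+ 2.
        by rewrite /u expr2 -expRD; congr expR; field.
      by ring.
    rewrite ge0_integralD//; last first.
      by apply/measurable_EFinP; exact: measurable_expR_affine.
    by rewrite natural_space_shift// subrr expR0 integral_cst_probability -EFinD.
  have -> : (\int[F0]_x (2 * u x)%:E = (2 * expR (ps (th / 2) - ps th / 2))%:E)%E.
    transitivity (\int[F0]_x (2%:E * (u x)%:E))%E; first exact: eq_integral.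
    rewrite ge0_integralZl ?Iu//; first exact/measurable_EFinP.
    by move=> x _; rewrite lee_fin expR_ge0.
  have e1 : 1 <= expR (ps (th / 2) - ps th / 2) by rewrite -[X in X <= _]expR0 ler_expR subr_ge0.
  set A := (\int[F0]_x _)%E.
  have A0 : (0 <= A)%E by apply: integral_ge0 => x _; rewrite lee_fin sqr_ge0.
  case: A A0 => [r|//|//] r0.
  by rewrite -EFinD => -[]; rewrite lee_fin; move: r0; rewrite lee_fin; lra.
have -> : [set x | (u x - 1) ^+ 2 = 0] = [set (ps th / th)].
  apply/seteqP; split => x /=.
    move=> /eqP; rewrite sqrf_eq0 subr_eq0 -expR0 /u => /eqP /expR_inj h.
    by apply: (mulfI th0); rewrite mulrCA mulfV// mulr1; lra.
  move=> ->; rewrite /u.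
  have -> : th / 2 * (ps th / th) - ps th / 2 = 0 by field.
  by rewrite expR0 subrr expr0n.
exact: nd.
Qed.

(** The difference quotients of a convex function are monotone along the
    segment from [th] to [t], and the one-sided derivative at [th] is their
    limit inside the parameter space. *)
Lemma psi_subgradient th : Th th -> psi_derivable F0 th ->
  forall t, Th t -> ps th + mu F0 th * (t - th) <= ps t.
Proof.
move=> Tth der t Tt.
have [->|tth] := eqVneq t th; first by rewrite subrr mulr0 addr0.
have d0 : t - th != 0 by rewrite subr_eq0.
rewrite leNgt; apply/negP => lt.
(* The defect of the inequality, per unit length; a point [s] of the segment
   close enough to [th] contradicts it. *)
pose e := (ps th + mu F0 th * (t - th) - ps t) / `|t - th|.
have nd0 : 0 < `|t - th| by rewrite normr_gt0.
have e0 : 0 < e by rewrite divr_gt0// subr_gt0.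
have cv : psi_slope F0 th --> mu F0 th by exact: der.
have := (@cvgrPdist_lt _ _ _ _ _ (fun s => (ps s - ps th) / (s - th)) (mu F0 th)).1 cv e e0.
move=> /(_ _); rewrite !nearE /within/= /dnbhs /within/= => /nbhs_ballP[r /= r0 Hr].
pose l := Num.min 1 (r / 2 / `|t - th|).
have l0 : 0 < l by rewrite lt_min ltr01 !divr_gt0.
have l1 : l <= 1 by rewrite ge_min lexx.
have lr : l * `|t - th| < r.
  apply: (@le_lt_trans _ _ (r / 2)); last by lra.
  by rewrite -ler_pdivlMr// ge_min lexx orbT.
pose s := l * t + (1 - l) * th.
have sE : s - th = l * (t - th) by rewrite /s; ring.
have l01 : 0 <= l <= 1 by rewrite ltW.
have [Ts hs] := convex_psi Tt Tth l01.
have bs : ball th r s by rewrite /ball/= distrC sE normrM gtr0_norm.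
have sth : s != th by rewrite -subr_eq0 sE mulf_neq0// gt_eqF.
have := Hr s bs sth Ts.
rewrite sE => h.
have h2 : ps s - ps th <= l * (ps t - ps th) by move: hs; rewrite -/s; lra.
set X := _ / _ in h.
have h3 : (mu F0 th - X) * (t - th) < mu F0 th * (t - th) - (ps t - ps th).
  apply: (le_lt_trans (ler_norm _)); rewrite normrM -ltr_pdivlMr//.
  by rewrite opprB addrA (addrC _ (ps th)).
have XE : X * (t - th) = (ps s - ps th) / l.
  by rewrite /X; field; rewrite d0 gt_eqF.
have : (ps s - ps th) / l <= ps t - ps th by rewrite ler_pdivrMr// mulrC.
by rewrite -XE; move: h3; rewrite mulrBl; lra.
Qed.

End CumulantFunction.

Section RateFunctionJ.
Context {R : realType}.
Variables (a0 : R) (J : R -> R).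
Hypotheses (a0_gt0 : 0 < a0) (J_vanishes : rate_vanishes a0 J)
  (J_derivative : rate_derivative a0 J).

Lemma rate_continuous a : a0 <= a -> {within `[a0, a], continuous J}.
Proof.
move=> a0a; apply: derivable_within_continuous => x.
rewrite in_itv/= => /andP[a0x _]; have [h _ _ _ _] := J_derivative.
exact: h.
Qed.

Lemma rate_continuous_at a : a0 <= a -> {for a, continuous J}.
Proof.
move=> a0a; apply: differentiable_continuous; apply/derivable1_diffP.
by have [h _ _ _ _] := J_derivative; exact: h.
Qed.

Lemma rate_deriv_ge0 a : a0 <= a -> 0 <= derive1 J a.
Proof.
move=> a0a; have [_ _ h d0 _] := J_derivative.
move: a0a; rewrite le_eqVlt => /orP[/eqP <-|a0a]; first by rewrite d0.
by rewrite -d0 ltW// h// in_itv/= ?lexx// ltW.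
Qed.

Lemma rate_deriv_gt0 a : a0 < a -> 0 < derive1 J a.
Proof.
move=> a0a; have [_ _ h d0 _] := J_derivative.
by rewrite -d0 h// in_itv/= ?lexx// ltW.
Qed.

(** The derivative of [J] is increasing, so [J] is above its tangents on the
    right. *)
Lemma rate_above_tangent a b : a0 <= a -> a <= b ->
  J a + derive1 J a * (b - a) <= J b.
Proof.
move=> a0a; rewrite le_eqVlt => /orP[/eqP <-|ab]; first by rewrite subrr mulr0 addr0.
have [dJ _ inc _ _] := J_derivative.
have [x|c|c] := @MVT R J (derive1 J) a b ab.
- rewrite in_itv/= => /andP[ax _]; rewrite derive1E.
  by apply/derivableP/dJ; apply: (le_trans a0a); exact: ltW.
- apply: derivable_within_continuous => x; rewrite in_itv/= => /andP[ax _].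
  by apply: dJ; exact: le_trans a0a ax.
rewrite in_itv/= => /andP[ac cb] E.
rewrite addrC -lerBrDr E ler_wpM2r ?subr_ge0 ?(ltW ab)// ltW// inc//.
- by rewrite in_itv/= andbT.
- by rewrite in_itv/= andbT (le_trans a0a)// ltW.
Qed.

Lemma rate_nondecreasing a b : a0 <= a -> a <= b -> J a <= J b.
Proof.
move=> a0a ab; apply: le_trans (rate_above_tangent a0a ab).
by rewrite lerDl mulr_ge0 ?subr_ge0// rate_deriv_ge0.
Qed.

Lemma rate_ge0 a : 0 <= a -> 0 <= J a.
Proof.
move=> age0; have Ja0 : J a0 = 0 by apply: J_vanishes; rewrite lexx ltW.
have [aa0|a0a] := leP a a0; first by rewrite J_vanishes// age0.
by rewrite -Ja0; apply: rate_nondecreasing => //; exact: ltW.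
Qed.

Lemma rate_unbounded C : exists a, a0 < a /\ C < J a.
Proof.
have [_ _ _ _ Jy] := J_derivative.
have /cvgryPge /(_ 1) [M [_ HM]] := Jy.
pose a := Num.max a0 M + 1.
have a0a : a0 <= a by rewrite /a ltW// ltr_pwDr// le_max lexx.
have Ma : M < a by rewrite /a ltr_pwDr// le_max lexx orbT.
have d1 := HM a Ma.
exists (a + (`|C| + 1)).
have C0 := normr_ge0 C.
split; first by apply: (le_lt_trans a0a); rewrite ltrDl; lra.
have ab : a <= a + (`|C| + 1) by rewrite lerDl; lra.
apply: lt_le_trans (rate_above_tangent a0a ab).
have Ja : 0 <= J a by apply: rate_ge0; apply: ltW; exact: lt_le_trans a0a.
have -> : a + (`|C| + 1) - a = `|C| + 1 by ring.
have := ler_wpM2r (_ : 0 <= `|C| + 1) d1; rewrite mul1r => /(_ _) h.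
have := ler_norm C.
have : 0 <= `|C| + 1 by lra.
by move=> /h; lra.
Qed.

End RateFunctionJ.

Section CurveBridge.
Context {R : realType}.
Variables (F0 : probability R R) (th a0 : R) (J : R -> R).
Local Notation Th := (natural_space F0).
Local Notation ps := (psi F0).
Hypothesis nondeg : forall c : R, F0 [set c] <> 1%E.
Hypotheses (a0_gt0 : 0 < a0) (J_vanishes : rate_vanishes a0 J)
  (J_derivative : rate_derivative a0 J).
Hypotheses (Tth : Th th) (th0 : th != 0) (der : psi_derivable F0 th).
Hypothesis theta_rate : (a0%:E * rate_I F0 (mu F0 th) <= 1)%E.

Let I0 := th * mu F0 th - ps th.

Lemma rate_I_leP nu y : (rate_I F0 nu <= y%:E)%E <-> rate_le Th ps nu y.
Proof.
split=> [h t Tt|h].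
  rewrite -lee_fin; apply: le_trans h.
  by apply: ereal_sup_ubound; exists t.
by apply: ge_ereal_sup => _ [t Tt <-]; rewrite lee_fin; exact: h.
Qed.

Lemma rate_I_ge0 nu : (0 <= rate_I F0 nu)%E.
Proof.
apply: ereal_sup_ubound; exists 0; first exact: natural_space0.
by rewrite mul0r psi0 subrr.
Qed.

(** Positivity is the strict convexity of [psi] between [0] and [th], tested
    at the midpoint. *)
Lemma mean_rate_gt0 : 0 < I0.
Proof.
have [T2 h] := psi_half_lt nondeg th0 Tth.
have := psi_subgradient Tth der T2; rewrite /I0; lra.
Qed.

Lemma rate_I_mean : rate_I F0 (mu F0 th) = I0%:E.
Proof.
apply/eqP; rewrite eq_le; apply/andP; split.
  by apply/rate_I_leP => t /(psi_subgradient Tth der); rewrite /I0; lra.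
by apply: ereal_sup_ubound; exists th.
Qed.

Lemma mean_rate_le : a0 * I0 <= 1.
Proof. by rewrite -lee_fin EFinM -rate_I_mean. Qed.

Lemma le_b_curve be nu a y : 0 < a -> curve_point Th ps th J be nu a y ->
  (be%:E <= b_curve F0 J th)%E.
Proof.
move=> a_gt0 [/rate_I_leP ry g1 fb].
have [z zE] : exists z, rate_I F0 nu = z%:E.
  by have := rate_I_ge0 nu; case: (rate_I F0 nu) ry => // z _ _; exists z.
rewrite zE lee_fin in ry.
have azy : a * z <= a * y by rewrite ler_wpM2l// ltW.
apply: (@le_trans _ _ (curve_f F0 J th nu a)).
  rewrite /curve_f /curve_g zE -!(EFinM, EFinD, EFinB) lee_fin.
  by apply: (le_trans fb); lra.
apply: ereal_sup_ubound; exists (nu, a) => //=; split => //.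
rewrite /curve_g zE -EFinM -EFinD lee_fin; lra.
Qed.

Lemma lt_b_curve be : (be%:E < b_curve F0 J th)%E ->
  exists nu a y be', [/\ 0 < a, be < be', rate_I F0 nu = y%:E &
    curve_point Th ps th J be' nu a y].
Proof.
move=> /ereal_sup_gt[_ [[nu a] /= [a_gt0 g1] <-] fb].
have Ja : 0 <= J a by apply: (rate_ge0 a0_gt0 J_vanishes J_derivative); exact: ltW.
have [y yE] : exists y, rate_I F0 nu = y%:E.
  have := rate_I_ge0 nu; case E : (rate_I F0 nu) g1 => [z| |] //; first by exists z.
  by rewrite /curve_g E gt0_muley ?lte_fin// addye.
move: g1 fb; rewrite /curve_f /curve_g yE.
rewrite -!(EFinM, EFinD, EFinB) lee_fin lte_fin => g1 fb.
exists nu, a, y, (a * (th * nu - ps th) + 2^-1 * (1 - (a * y + J a))).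
by split => //; split => //; apply/rate_I_leP; rewrite yE.
Qed.

Let convex_ps := @convex_psi R F0.
Let subgr := psi_subgradient Tth der.

(** At the mean and the relative size [a0] the curve function equals
    [(1 + a0 * I0) / 2]. *)
Lemma b_curve_gt_half : (2^-1%:E < b_curve F0 J th)%E.
Proof.
have cp := curve_point_mean subgr a0_gt0 mean_rate_le J_vanishes.
apply: lt_le_trans (le_b_curve a0_gt0 cp).
rewrite lte_fin; have := mulr_gt0 a0_gt0 mean_rate_gt0; rewrite /I0; lra.
Qed.

(** The contrapositive of strong duality. *)
Lemma moment_of_b_curve_lt be a : (b_curve F0 J th < be%:E)%E -> a0 <= a ->
  exists s, [/\ 1 <= s <= 2, Th (s * th) & moment_exponent ps th J be a s < 0].
Proof.
move=> bb a0a; apply: contrapT => nex.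
have [|nu [a' [y [a0a' cp]]]] := @curve_point_of_moments R Th ps th (mu F0 th) a0 J
    (@natural_space0 R F0) Tth th0 convex_ps subgr
    a0_gt0 mean_rate_le J_vanishes (rate_nondecreasing J_derivative)
    (rate_continuous J_derivative) be a a0a.
  move=> s s12 Ts; rewrite leNgt; apply/negP => neg.
  by apply: nex; exists s.
have := le_b_curve (lt_le_trans a0_gt0 a0a') cp.
by rewrite leNgt bb.
Qed.

(** A value of the curve function above [1 / 2] forces a positive signal
    exponent, since its other term is at most [1 / 2]; as the supremum exceeds
    [1 / 2], such a point can be chosen. *)
Lemma point_of_lt_b_curve be : (be%:E < b_curve F0 J th)%E ->
  exists nu a y be', [/\ a0 <= a, be < be', rate_I F0 nu = y%:E,
    0 < th * nu - ps th & curve_point Th ps th J be' nu a y].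
Proof.
move=> bb.
have [be1 [bebe1 be12 bb1]] : exists be1, [/\ be < be1, 2^-1 < be1 &
    (be1%:E < b_curve F0 J th)%E].
  have := b_curve_gt_half.
  have h : ((Num.max be 2^-1)%:E < b_curve F0 J th)%E.
    by rewrite /Num.max; case: ifP => _ //; exact: b_curve_gt_half.
  move=> _; move: h; case: (b_curve F0 J th) => [b|_|//].
    rewrite lte_fin => h; exists ((Num.max be 2^-1 + b) / 2).
    have h1 : be <= Num.max be 2^-1 by rewrite le_max lexx.
    have h2 : 2^-1 <= Num.max be 2^-1 by rewrite le_max lexx orbT.
    by split; rewrite ?lte_fin; lra.
  have h1 : be <= Num.max be 2^-1 by rewrite le_max lexx.
  have h2 : 2^-1 <= Num.max be 2^-1 by rewrite le_max lexx orbT.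
  by exists (Num.max be 2^-1 + 1); split; rewrite ?ltry//; lra.
have [nu [a [y [be2 [a_gt0 b12 _ cp]]]]] := lt_b_curve bb1.
have [nu' [a' [y' [a0a' cp']]]] := @curve_point_large_size R Th ps th (mu F0 th) a0 J
    (@natural_space0 R F0) Tth th0 convex_ps subgr (ltW mean_rate_gt0)
    a0_gt0 mean_rate_le J_vanishes (rate_nondecreasing J_derivative)
    (rate_continuous J_derivative) be1 be2 nu a y a_gt0 cp b12.
have a'0 : 0 < a' by exact: lt_le_trans a0a'.
have Ja : 0 <= J a' by apply: (rate_ge0 a0_gt0 J_vanishes J_derivative); exact: ltW.
have [ry g1 fb] := cp'.
have /rate_I_leP ry' := ry.
have [z zE] : exists z, rate_I F0 nu' = z%:E.
  by have := rate_I_ge0 nu'; case: (rate_I F0 nu') ry' => // z _ _; exists z.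
have z0 : 0 <= z by have := rate_I_ge0 nu'; rewrite zE lee_fin.
rewrite zE lee_fin in ry'.
have azy : a' * z <= a' * y' by rewrite ler_wpM2l// ltW.
have az0 : 0 <= a' * z by rewrite mulr_ge0// ltW.
exists nu', a', z, be1; split => //.
- have : 0 < a' * (th * nu' - ps th) by lra.
  by rewrite pmulr_rgt0.
- split; last by lra.
  + by apply/rate_I_leP; rewrite zE.
  + lra.
Qed.

End CurveBridge.

(** * Asymptotics of the sample sizes *)

Section SizeAsymptotics.
Context {R : realType}.
Variables (a0 : R) (J : R -> R).
Hypotheses (a0_gt0 : 0 < a0) (J_vanishes : rate_vanishes a0 J)
  (J_derivative : rate_derivative a0 J).
Variables (Q : nat -> probability nat R) (alpha : nat -> nat -> R).
Hypothesis Q_rate : sizes_follow_rate a0 J Q alpha.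

Definition lnn (n : nat) : R := ln n%:R.

Lemma lnn_cvg : lnn n @[n --> \oo] --> +oo.
Proof.
apply/cvgryPge => A.
exists (Num.truncn (expR A)).+1 => //= n /= hn.
rewrite /lnn -[leLHS]expRK ler_ln ?posrE ?expR_gt0//; last first.
  by rewrite ltr0n; exact: leq_ltn_trans hn.
by apply: (le_trans (ltW (truncnS_gt _))); rewrite ler_nat.
Qed.

Lemma near_lnn_ge (A : R) : \forall n \near \oo, A <= lnn n.
Proof. exact: (cvgryPge _).1 lnn_cvg A. Qed.

Lemma expR_lnn n : (0 < n)%N -> expR (lnn n) = n%:R.
Proof. by move=> n0; rewrite lnK// posrE ltr0n. Qed.

Lemma powR_lnn n x : (0 < n)%N -> n%:R `^ x = expR (x * lnn n).
Proof. by case: n => // n _; rewrite /powR pnatr_eq0. Qed.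

(** The factors [alpha] are uniformly subexponential in [k], hence negligible
    against the powers of [n] once [k] is of order [log n]. *)
Lemma size_prob_bounds (dl : R) : 0 < dl -> \forall n \near \oo, forall k,
  (0 < k)%N -> a0 * lnn n <= k%:R ->
  expR (- (dl * k%:R) - lnn n * J (k%:R / lnn n)) <= fine (Q n [set k])
    <= expR (dl * k%:R - lnn n * J (k%:R / lnn n)).
Proof.
move=> dl0; have [QE Qsup] := Q_rate.
have dlE : (0 < dl%:E)%E by rewrite lte_fin.
have [N1 _ H1] := Qsup _ (open_ereal_lt' dlE).
near=> n => k k0 ak.
have Nn : (N1 <= n)%N by near: n; exact: nbhs_infty_ge.
have n0 : (0 < n)%N by near: n; exact: nbhs_infty_gt.
have := H1 n Nn => /= sup_lt.
have kR : 0 < k%:R :> R by rewrite ltr0n.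
have : (`|lne (alpha n k)%:E| * (k%:R^-1)%:E < dl%:E)%E.
  by apply: le_lt_trans sup_lt; apply: ereal_sup_ubound; exists k.
have [al0|al0] := leP (alpha n k) 0.
  by rewrite /lne al0 /= gt0_mulye ?lte_fin ?invr_gt0.
rewrite /lne leNgt al0/= -EFinM lte_fin ltr_pdivrMr// => /ltW.
rewrite ler_norml => /andP[l1 l2].
rewrite QE//= powR_lnn// -{1 2}(lnK (al0 : alpha n k \is Num.pos)) -expRD !ler_expR.
by apply/andP; split; lra.
Unshelve. all: by end_near. Qed.

(** The geometric tail beyond [x], carried along as an invariant of the
    partial sums, which makes the induction immediate. *)
Lemma partial_geometric (c x : R) m : 0 < c ->
  \sum_(0 <= k < m | x <= k%:R) expR (- c * (k%:R - x)) +
    (if x <= m%:R then expR (- c * (m%:R - x)) else 1) / (1 - expR (- c))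
  <= (1 - expR (- c))^-1.
Proof.
move=> c0.
have q1 : 0 < 1 - expR (- c) by rewrite subr_gt0 -[ltRHS]expR0 ltr_expR oppr_lt0.
have ex y : x <= y -> expR (- c * (y - x)) <= 1.
  by move=> xy; rewrite -[leRHS]expR0 ler_expR mulNr oppr_le0 mulr_ge0 ?subr_ge0// ltW.
elim: m => [|m IH].
  rewrite big_geq// add0r -[leRHS]mul1r ler_wpM2r ?invr_ge0 ?(ltW q1)//.
  by case: ifP => // /ex.
rewrite big_mkcond/= big_nat_recr//= -big_mkcond/=.
apply: le_trans IH; rewrite -addrA lerD2l.
have [xm|xm] := leP x m%:R.
  have xm1 : x <= m.+1%:R by apply: (le_trans xm); rewrite ler_nat.
  rewrite xm1.
  have -> : - c * (m.+1%:R - x) = - c + - c * (m%:R - x).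
    by rewrite -addn1 natrD; ring.
  rewrite expRD le_eqVlt; apply/orP; left; apply/eqP.
  by field; rewrite gt_eqF.
rewrite add0r ler_wpM2r ?invr_ge0 ?(ltW q1)//.
by case: ifP => // /ex.
Qed.

Lemma integral_nat_le (P : probability nat R) (f : nat -> \bar R) (B : \bar R) :
  (forall k, (0 <= f k)%E) ->
  (forall m, (\sum_(0 <= k < m) P [set k] * f k <= B)%E) ->
  (\int[P]_k f k <= B)%E.
Proof.
move=> f0 H; rewrite integral_nat//; apply: lime_le; last exact: nearW.
by apply: is_cvg_nneseries => k _ _; rewrite mule_ge0.
Qed.

(** Beyond [a * log n], the convexity of [J] makes the sizes decay at least
    geometrically, so that the tail has the exponent of its first term. *)
Lemma size_tail (a e : R) : a0 <= a -> 0 < e -> \forall n \near \oo,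
  (Q n [set k | (a * lnn n <= k%:R)%R] <= (expR (- (J a - e) * lnn n))%:E)%E.
Proof.
rewrite le_eqVlt => /orP[/eqP <- e0|a0a e0].
  near=> n; apply: (le_trans (probability_le1 _ _)) => //.
  rewrite lee_fin -[leLHS]expR0 ler_expR J_vanishes ?lexx ?(ltW a0_gt0)// sub0r opprK.
  by rewrite mulr_ge0 ?(ltW e0)//; near: n; exact: near_lnn_ge.
pose c := derive1 J a; have c0 : 0 < c by exact: rate_deriv_gt0 J_derivative _ a0a.
have a_gt0 : 0 < a by exact: lt_trans a0a.
(* The error of [size_prob_bounds], [dl * k], must cost at most half of the
   slope of the tangent, and at most [e / 2] at the starting point. *)
pose dl := Num.min (c / 2) (e / (2 * a)).
have dl0 : 0 < dl by rewrite lt_min !divr_gt0// mulr_gt0.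
have dlc : dl <= c / 2 by rewrite ge_min lexx.
have dle : dl * a <= e / 2.
  apply: (@le_trans _ _ (e / (2 * a) * a)).
    by rewrite ler_wpM2r ?(ltW a_gt0)// ge_min lexx orbT.
  by rewrite le_eqVlt; apply/orP; left; apply/eqP; field; rewrite gt_eqF.
pose C := (1 - expR (- (c / 2)))^-1.
have C0 : 0 < C.
  by rewrite invr_gt0 subr_gt0 -[ltRHS]expR0 ltr_expR oppr_lt0 divr_gt0.
near=> n.
have L0 : 0 < lnn n.
  by apply: (@lt_le_trans _ _ 1) => //; near: n; exact: near_lnn_ge.
set L := lnn n in L0 *.
have CL : C <= expR (e / 2 * L).
  rewrite -[leLHS](lnK (C0 : C \is Num.pos)) ler_expR.
  have : 2 / e * ln C <= L by rewrite /L; near: n; exact: near_lnn_ge.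
  move=> h; have := ler_wpM2l (ltW (divr_gt0 e0 (ltr0Sn R 1))) h.
  by rewrite mulrA (_ : e / 2 * (2 / e) = 1) ?mul1r//; field; rewrite gt_eqF.
have QB : forall k : nat, a * L <= k%:R ->
   (Q n [set k] <= (expR (- (J a - e / 2) * L) * expR (- (c / 2) * (k%:R - a * L)))%:E)%E.
  move=> k ak.
  have kR : 0 < k%:R :> R by apply: lt_le_trans ak; rewrite mulr_gt0.
  have k0 : (0 < k)%N by rewrite -(ltr0n R).
  have ak0 : a0 * L <= k%:R by apply: le_trans ak; rewrite ler_wpM2r// ltW.
  have /andP[_] : expR (- (dl * k%:R) - L * J (k%:R / L)) <= fine (Q n [set k])
    <= expR (dl * k%:R - L * J (k%:R / L)).
    rewrite /L in ak0 *; move: k k0 ak0 {ak kR}.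
    by near: n; exact: size_prob_bounds.
  rewrite -lee_fin fineK ?fin_num_measure// => /le_trans; apply.
  rewrite lee_fin -expRD ler_expR.
  have akL : a <= k%:R / L by rewrite ler_pdivlMr.
  have := rate_above_tangent J_derivative (ltW a0a) akL; rewrite -/c => tg.
  have := ler_wpM2l (ltW L0) tg.
  have -> : L * (J a + c * (k%:R / L - a)) = L * J a + c * (k%:R - a * L).
    by field; rewrite gt_eqF.
  have : 0 <= (c / 2 - dl) * (k%:R - a * L) by rewrite mulr_ge0// subr_ge0.
  have := ler_wpM2r (ltW L0) dle.
  clear; lra.
rewrite -integral_indicT//; apply: integral_nat_le => [k|m]; first by rewrite lee_fin.
apply: (@le_trans _ _ (\sum_(0 <= k < m | (a * L <= k%:R)%R)
   (expR (- (J a - e / 2) * L) * expR (- (c / 2) * (k%:R - a * L)))%:E)%E).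
  rewrite [leRHS]big_mkcond/=; apply: lee_sum => k _; rewrite indicE.
  have [ak|ak] := leP (a * L) k%:R; last by rewrite memNset ?mule0//= => h; move: ak; rewrite ltNge h.
  by rewrite mem_set//= mule1; exact: QB.
rewrite sumEFin lee_fin -mulr_sumr.
apply: (@le_trans _ _ (expR (- (J a - e / 2) * L) * C)); last first.
  apply: (le_trans (ler_wpM2l (expR_ge0 _) CL)); rewrite -expRD ler_expR; lra.
rewrite ler_wpM2l ?expR_ge0//.
have c2 : 0 < c / 2 by rewrite divr_gt0.
apply: le_trans (@partial_geometric (c / 2) (a * L) m c2).
rewrite lerDl divr_ge0//; first by case: ifP => // _; exact: expR_ge0.
by rewrite -invr_ge0 ltW.
Unshelve. all: by end_near. Qed.

End SizeAsymptotics.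

(** * Likelihood ratios and total variation *)

Lemma completed_squares (R : realFieldType) (la a b x : R) :
  0 < la -> 0 <= a - b -> 0 <= la / 2 + a - b - 1 + x ->
  1 + b <= 1 + la / 2 + a /\ 1 + b <= x + la / 2 + a.
Proof. by move=> *; split; lra. Qed.

Lemma three_terms_le (R : realFieldType) (x y a b c : R) :
  1 + b <= x + y + c + a -> 1 - c - (a - b) <= x + y.
Proof. lra. Qed.

Section Likelihood.
Local Open Scope ereal_scope.
Context {R : realType}.

Lemma measurable_fun_size d d' (T : measurableType d) (T' : measurableType d')
    (h : nat * T -> T') :
  (forall k, measurable_fun setT (fun z => h (k, z))) -> measurable_fun setT h.
Proof.
move=> mh _ A mA; rewrite setTI.
have -> : h @^-1` A = \bigcup_k ([set k] `*` ((fun z => h (k, z)) @^-1` A)).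
  apply/seteqP; split => [[k z] /= H|[k z] [j _ [/= -> //]]].
  by exists k.
apply: bigcupT_measurable => k; apply: measurableX => //.
by rewrite -[X in measurable X]setTI; exact: mh.
Qed.

Variables (F0 F1 : probability R R) (th ps : R).
Hypothesis F01 : tilted F0 F1 th ps.

Definition lr (z : nat * (R * R)) : R := expR (th * z.2.1 - z.1%:R * ps).

Lemma measurable_lr : measurable_fun setT lr.
Proof.
apply: measurable_fun_size => k; apply: (measurableT_comp (@measurable_expR R)).
apply: measurable_funB => //; apply: measurable_funM => //=.
exact: measurable_fst.
Qed.

Variables (Q : probability nat R) (e : R).
Hypotheses (e0 : (0 <= e)%R) (e1 : (0 <= 1 - e)%R).
Hypotheses (z0 : (0 <= 0 :> R)%R) (z1 : (0 <= 1 - 0 :> R)%R).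

Definition lr_mix (z : nat * (R * R)) : R := (1 - e + e * lr z)%R.

Lemma lr_mix_ge0 z : (0 <= lr_mix z)%R.
Proof. by rewrite addr_ge0// mulr_ge0// expR_ge0. Qed.

Lemma measurable_lr_mix : measurable_fun setT lr_mix.
Proof.
apply: measurable_funD => //; apply: measurable_funM => //; exact: measurable_lr.
Qed.

Lemma integral_obs_law0 h : measurable_fun setT h -> (forall z, 0 <= h z) ->
  \int[obs_law Q F0 F1 z0 z1]_z h z = \int[size_law Q F0]_z h z.
Proof. by move=> mh h0; rewrite integral_obs_law// subr0 mul1e mul0e adde0. Qed.

Lemma integral_size_law_tilted h : measurable_fun setT h -> (forall z, 0 <= h z) ->
  \int[size_law Q F1]_z h z = \int[size_law Q F0]_z ((lr z)%:E * h z).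
Proof.
move=> mh h0.
have mlr : measurable_fun setT (EFin \o lr) by apply/measurable_EFinP; exact: measurable_lr.
have mlh : measurable_fun setT (fun z => (lr z)%:E * h z) by exact: emeasurable_funM.
have lh z : 0 <= (lr z)%:E * h z by rewrite mule_ge0// lee_fin expR_ge0.
rewrite (integral_size_law Q F1 mh h0) (integral_size_law Q F0 mlh lh).
apply: eq_integral => k _.
rewrite (tilted_integral (tilted_conv_pow k F01))//; last 2 first.
- exact: (measurable_section F0).
- by move=> y; exact: integral_ge0.
apply: eq_integral => y _; rewrite -ge0_integralZl//.
- apply: (measurableT_comp mh); apply: measurable_fun_pair => //.
Qed.

Lemma integral_obs_law_density h : measurable_fun setT h -> (forall z, 0 <= h z) ->
  \int[obs_law Q F0 F1 e0 e1]_z h z =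
  \int[obs_law Q F0 F1 z0 z1]_z ((lr_mix z)%:E * h z).
Proof.
move=> mh h0.
have mlr : measurable_fun setT (EFin \o lr) by apply/measurable_EFinP; exact: measurable_lr.
have mlm : measurable_fun setT (EFin \o lr_mix) by apply/measurable_EFinP; exact: measurable_lr_mix.
rewrite integral_obs_law// integral_size_law_tilted// integral_obs_law0//; last 2 first.
- exact: emeasurable_funM.
- by move=> z; rewrite mule_ge0// lee_fin lr_mix_ge0.
have lh z : 0 <= (lr z)%:E * h z by rewrite mule_ge0// lee_fin expR_ge0.
have mlh : measurable_fun setT (fun z => (lr z)%:E * h z) by exact: emeasurable_funM.
rewrite -!ge0_integralZl ?lee_fin// -ge0_integralD//.
- apply: eq_integral => z _; have -> : (lr_mix z)%:E = (1 - e)%:E + e%:E * (lr z)%:E by rewrite -EFinM -EFinD.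
  by rewrite ge0_muleDl ?muleA// mule_ge0// lee_fin expR_ge0.
- by move=> z _; rewrite mule_ge0.
- exact: measurable_funeM.
- by move=> z _; rewrite mule_ge0.
- exact: measurable_funeM.
Qed.

Section Tuples.
Variables (n : nat) (d : measure_display) (Omega : measurableType d).
Variables (P0 P1 : probability Omega R) (K : 'I_n -> {mfun Omega >-> nat})
  (Y V : 'I_n -> {mfun Omega >-> R}).
Hypotheses (H0 : mixture_sample F0 F1 Q 0 P0 K Y V)
  (H1 : mixture_sample F0 F1 Q e P1 K Y V).

Local Notation obs := (obs K Y V).

Definition data (w : Omega) : n.-tuple (nat * R) := [tuple (K i w, Y i w) | i < n].

Lemma measurable_data : measurable_fun setT data.
Proof.
apply/measurable_fun_tnthP => i.
rewrite (_ : _ \o _ = fun w => (K i w, Y i w)); last first.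
  by apply/funext => w; rewrite /= tnth_mktuple.
exact: measurable_fun_pair.
Qed.

Definition tuple_rect : set (set (n.-tuple (nat * R))) :=
  [set S | exists2 E : 'I_n -> set (nat * R), (forall i, measurable (E i)) &
     S = [set t | forall i, E i (tnth t i)]].

Lemma tuple_rect_generated : @measurable _ (n.-tuple (nat * R)) = <<s tuple_rect >>.
Proof.
apply: measurable_generated.
  move=> S [E mE ->]; apply: measurable_forall_fin => i.
  by rewrite -[X in measurable X]setTI; exact: measurable_tnth.
apply/measurable_fun_tnthP => i _ A mA; rewrite setTI.
apply: sub_gen_smallest; exists (fun j => if j == i then A else setT).
  by move=> j; case: ifP.
apply/seteqP; split => t /= H; last by have := H i; rewrite eqxx.
by move=> j; case: eqP => // ->.
Qed.

Lemma tuple_rectI : setI_closed tuple_rect.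
Proof.
move=> _ _ [E mE ->] [E' mE' ->]; exists (fun i => E i `&` E' i).
  by move=> i; exact: measurableI.
by apply/seteqP; split => t /=; [move=> [a b] i|move=> H; split => i; have [] := H i].
Qed.

Let pick_pair (z : nat * (R * R)) : nat * R := (z.1, z.2.1).

Let measurable_pick_pair : measurable_fun setT pick_pair.
Proof. by apply: measurable_fun_pair => //; exact: measurableT_comp. Qed.

(** Change of measure for one observation, multiplied over the sample. It is
    stated for the data without the auxiliary uniform variables, which the
    ratio does not involve. *)
Lemma data_change_of_measure S : measurable S ->
  \int[P0]_w ((\prod_(i < n) lr_mix (obs i w)) * \1_S (data w))%:E =
  P1 (data @^-1` S).
Proof.
move=> mS.
pose D : {mfun Omega >-> n.-tuple (nat * R)} :=
  HB.pack data (isMeasurableFun.Build _ _ _ _ data measurable_data).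
rewrite -[RHS]/(distribution P1 D S) -[RHS]mul1e.
apply: (weight_unique tuple_rect_generated tuple_rectI (cov := fun=> setT)) => //.
- by move=> k; exists (fun=> setT) => //; apply/seteqP; split.
- by apply/seteqP; split => // t _; exists 0%N.
- exact: measurable_data.
- apply: measurable_fun_bigprod => i; apply: measurableT_comp.
    exact: measurable_lr_mix.
  exact: measurable_obs.
- by move=> w; apply: prodr_ge0 => i _; exact: lr_mix_ge0.
move=> _ [E mE ->]; rewrite mul1e.
have mE' i : measurable (pick_pair @^-1` E i).
  by rewrite -[X in measurable X]setTI; exact: measurable_pick_pair.
pose c i := fine (obs_law Q F0 F1 e0 e1 (pick_pair @^-1` E i)).
have cE i : (c i)%:E = obs_law Q F0 F1 e0 e1 (pick_pair @^-1` E i).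
  by rewrite fineK// fin_num_measure.
have indE w : \1_[set t | forall i, E i (tnth t i)] (data w) =
    (\prod_(i < n) \1_(pick_pair @^-1` E i) (obs i w))%R :> R.
  rewrite indicE; case: (boolP (_ \in _)) => /=; rewrite ?inE ?notin_setE /= => H.
    rewrite big1// => i _; rewrite indicE mem_set//=.
    by have := H i; rewrite tnth_mktuple.
  have [i Hi] : exists i, ~ E i (tnth (data w) i).
    by apply: contrapT => /forallNP H'; apply: H => i; apply: contrapT.
  rewrite (bigD1 i)//= indicE memNset ?mul0r//= => h; apply: Hi.
  by rewrite tnth_mktuple.
have mA : measurable [set t : n.-tuple (nat * R) | forall i, E i (tnth t i)].
  by rewrite tuple_rect_generated; apply: sub_gen_smallest; exists E.
transitivity (\int[P0]_w (\prod_(i < n)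
    (lr_mix (obs i w) * \1_(pick_pair @^-1` E i) (obs i w)))%:E).
  by apply: eq_integral => w _; rewrite indE big_split.
rewrite (mixture_sample_expectation H0 (e0 := z0) (e1 := z1) (c := c)
  (h := fun i z => (lr_mix z * \1_(pick_pair @^-1` E i) z)%R)); last 3 first.
- move=> i; apply: measurable_funM; first exact: measurable_lr_mix.
  exact: measurable_indic.
- by move=> i z; rewrite mulr_ge0// lr_mix_ge0.
- move=> i; rewrite cE -integral_indicT// integral_obs_law_density//.
  exact/measurable_EFinP.
rewrite -(mixture_sample_expectation H1 (e0 := e0) (e1 := e1) (c := c)
  (h := fun i => \1_(pick_pair @^-1` E i))); last 3 first.
- by move=> i; exact: measurable_indic.
- by move=> i z.
- by move=> i; rewrite cE integral_indicT.
have mdS : measurable (data @^-1` [set t | forall i, E i (tnth t i)]).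
  by rewrite -[X in measurable X]setTI; apply: measurable_data.
apply: etrans (integral_indicT P1 mdS).
by apply: eq_integral => w _; rewrite -indE.
Qed.

(** Dropping the part of the ratio above [1 / e] can only decrease the
    likelihood, and keeps its second moment finite. *)
Definition lr_trunc (z : nat * (R * R)) : R :=
  (1 - e + e * (lr z * (e * lr z <= 1)%R%:R))%R.

Lemma lr_trunc_ge0 z : (0 <= lr_trunc z)%R.
Proof. by rewrite addr_ge0// !mulr_ge0// expR_ge0. Qed.

Lemma lr_trunc_le z : (lr_trunc z <= lr_mix z)%R.
Proof.
rewrite lerD2l ler_wpM2l// -[leRHS]mulr1 ler_wpM2l ?expR_ge0//.
by rewrite lern1 leq_b1.
Qed.

Lemma measurable_lr_small :
  measurable_fun setT (fun z => (e * lr z <= 1)%R%:R : R).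
Proof.
have -> : (fun z => (e * lr z <= 1)%R%:R : R) = \1_[set z | (e * lr z <= 1)%R].
  by apply/funext => z; rewrite indicE; congr (nat_of_bool _)%:R; apply/idP/idP; rewrite inE.
apply: measurable_indic; rewrite -[X in measurable X]setTI.
have -> : [set z | (e * lr z <= 1)%R] = (fun z => e * lr z)%R @^-1` `]-oo, 1%R].
  by apply/seteqP; split => z /=; rewrite in_itv.
have : measurable_fun setT (fun z => e * lr z)%R.
  by apply: measurable_funM => //; exact: measurable_lr.
by apply.
Qed.

Lemma measurable_lr_trunc : measurable_fun setT lr_trunc.
Proof.
apply: measurable_funD => //; apply: measurable_funM => //.
apply: measurable_funM; [exact: measurable_lr|exact: measurable_lr_small].
Qed.

Variables (m s : R).
Hypothesis trunc1 : \int[obs_law Q F0 F1 z0 z1]_z (lr_trunc z)%:E = m%:E.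
Hypothesis trunc2 : \int[obs_law Q F0 F1 z0 z1]_z ((lr_trunc z) ^+ 2)%:E = s%:E.

(** With [D] the product of the truncated ratios, the sum of the errors is at
    least the mean of [min 1 D] under the null law. As [1 - min 1 D] is at
    most [`|1 - D|], it is at most [la / 2 + (1 - D) ^+ 2 / (2 * la)] for
    every [la > 0], and the right-hand side only involves two moments of [D],
    which are powers by independence. *)
Lemma test_errors_ge S (la : R) : measurable S -> (0 < la)%R ->
  (1 - la / 2 - (1 - 2 * m ^+ n + s ^+ n) / (2 * la) <=
  fine (P0 (data @^-1` S)) + fine (P1 (data @^-1` (~` S))))%R.
Proof.
move=> mS la0.
have mdS A : measurable A -> measurable (data @^-1` A).
  by move=> mA; rewrite -[X in measurable X]setTI; apply: measurable_data.
pose D w : R := (\prod_(i < n) lr_trunc (obs i w))%R.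
have D0 w : (0 <= D w)%R by apply: prodr_ge0 => i _; exact: lr_trunc_ge0.
have mD : measurable_fun setT D.
  apply: measurable_fun_bigprod => i; apply: measurableT_comp.
    exact: measurable_lr_trunc.
  exact: measurable_obs.
have ID : \int[P0]_w (D w)%:E = (m ^+ n)%:E.
  rewrite (mixture_sample_expectation H0 (e0 := z0) (e1 := z1) (c := fun=> m)
    (h := fun=> lr_trunc)) //.
  - by rewrite prodr_const card_ord.
  - by move=> i; exact: measurable_lr_trunc.
  - by move=> i z; exact: lr_trunc_ge0.
have ID2 : \int[P0]_w (D w ^+ 2)%:E = (s ^+ n)%:E.
  transitivity (\int[P0]_w (\prod_(i < n) (lr_trunc (obs i w)) ^+ 2)%:E).
    by apply: eq_integral => w _; rewrite prodrXl.
  rewrite (mixture_sample_expectation H0 (e0 := z0) (e1 := z1) (c := fun=> s)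
    (h := fun=> fun z => (lr_trunc z ^+ 2)%R)) //.
  - by rewrite prodr_const card_ord.
  - by move=> i; apply: measurable_funX; exact: measurable_lr_trunc.
  - by move=> i z; exact: sqr_ge0.
have mSC : measurable (~` S) by exact: measurableC.
have mDS : measurable_fun setT (fun w => D w * \1_(~` S) (data w))%R.
  apply: measurable_funM => //; apply: measurableT_comp => //.
  exact: measurable_data.
have P1S : \int[P0]_w (D w * \1_(~` S) (data w))%:E <= P1 (data @^-1` (~` S)).
  rewrite -data_change_of_measure//; apply: ge0_le_integral => //.
  - by move=> w _; rewrite lee_fin mulr_ge0.
  - exact/measurable_EFinP.
  - apply/measurable_EFinP; apply: measurable_funM; last first.
      by apply: measurableT_comp => //; exact: measurable_data.
    apply: measurable_fun_bigprod => i; apply: measurableT_comp.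
      exact: measurable_lr_mix.
    exact: measurable_obs.
  - move=> w _; rewrite lee_fin ler_wpM2r// ler_prod// => i _.
    by rewrite lr_trunc_ge0 lr_trunc_le.
have pw w : (1 + la^-1 * D w <= \1_(data @^-1` S) w + D w * \1_(~` S) (data w) + la / 2 +
    (2 * la)^-1 * (1 + D w ^+ 2))%R.
  have sq : (0 <= (2 * la)^-1 * (1 - D w - la) ^+ 2)%R.
    by rewrite mulr_ge0 ?sqr_ge0// invr_ge0 mulr_ge0// ltW.
  have sq' : (0 <= (2 * la)^-1 * (1 - D w) ^+ 2)%R.
    by rewrite mulr_ge0 ?sqr_ge0// invr_ge0 mulr_ge0// ltW.
  have E1 : ((2 * la)^-1 * (1 - D w - la) ^+ 2 = la / 2 + (2 * la)^-1 * (1 + D w ^+ 2)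
     - la^-1 * D w - 1 + D w)%R by field; rewrite gt_eqF.
  have E2 : ((2 * la)^-1 * (1 - D w) ^+ 2 = (2 * la)^-1 * (1 + D w ^+ 2) - la^-1 * D w)%R.
    by field; rewrite gt_eqF.
  rewrite E1 in sq; rewrite E2 in sq'.
  have iC : (\1_(~` S) (data w) = 1 - \1_(data @^-1` S) w :> R)%R.
    rewrite !indicE in_setC; have -> : (w \in data @^-1` S) = (data w \in S).
      by apply/idP/idP; rewrite !inE.
    by case: (data w \in S); rewrite /= ?mulr1n ?mulr0n ?subrr ?subr0.
  rewrite iC indicE; case: (w \in _); rewrite /= ?mulr1n ?mulr0n ?subrr ?subr0 ?mulr0 ?mulr1.
    by rewrite addr0; case: (completed_squares la0 sq' sq).
  by rewrite add0r; case: (completed_squares la0 sq' sq).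
have Sfin : P0 (data @^-1` S) \is a fin_num by apply: fin_num_measure; exact: mdS.
have SCfin : P1 (data @^-1` (~` S)) \is a fin_num by apply: fin_num_measure; exact: mdS.
have : (1%:E + (la^-1 * m ^+ n)%:E <= P0 (data @^-1` S) + P1 (data @^-1` (~` S)) +
    (la / 2)%:E + ((2 * la)^-1 * (1 + s ^+ n))%:E)%E.
  have il0 : (0 <= la^-1)%R by rewrite invr_ge0 ltW.
  have il20 : (0 <= (2 * la)^-1)%R by rewrite invr_ge0 mulr_ge0// ltW.
  have l20 : (0 <= la / 2)%R by rewrite divr_ge0// ltW.
  apply: (@le_trans _ _ (\int[P0]_w (1%:E + (la^-1)%:E * (D w)%:E))).
    rewrite ge0_integralD//; last 2 first.
    - by move=> w _; rewrite -EFinM lee_fin mulr_ge0.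
    - by apply: measurable_funeM; exact/measurable_EFinP.
    rewrite integral_cst_probability ge0_integralZl//; first by rewrite ID -EFinM.
    - exact/measurable_EFinP.
    - by move=> w _; rewrite lee_fin.
  apply: (@le_trans _ _ (\int[P0]_w ((\1_(data @^-1` S) w)%:E +
      (D w * \1_(~` S) (data w))%:E + (la / 2)%:E + (2 * la)^-1%:E * (1 + D w ^+ 2)%:E))).
    apply: ge0_le_integral => //.
    - by move=> w _; rewrite -EFinM -EFinD lee_fin addr_ge0// mulr_ge0.
    - by apply: emeasurable_funD => //; apply: measurable_funeM; exact/measurable_EFinP.
    - apply: emeasurable_funD; last first.
        apply: measurable_funeM; apply/measurable_EFinP; apply: measurable_funD => //.
        exact: measurable_funX.
      apply: emeasurable_funD => //; apply: emeasurable_funD; apply/measurable_EFinP => //.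
      by apply: measurable_indic; exact: mdS.
    - by move=> w _; rewrite -!EFinM -!EFinD lee_fin; exact: pw.
  have mA : measurable_fun setT (fun w => (\1_(data @^-1` S) w)%:E : \bar R).
    by apply/measurable_EFinP; apply: measurable_indic; exact: mdS.
  have mB : measurable_fun setT (fun w => (D w * \1_(~` S) (data w))%:E).
    exact/measurable_EFinP.
  have mE : measurable_fun setT (fun w => (1 + D w ^+ 2)%:E).
    by apply/measurable_EFinP; apply: measurable_funD => //; exact: measurable_funX.
  have A0 w : 0 <= (\1_(data @^-1` S) w)%:E :> \bar R by rewrite lee_fin.
  have B0 w : 0 <= (D w * \1_(~` S) (data w))%:E by rewrite lee_fin mulr_ge0.
  have E0 w : 0 <= (1 + D w ^+ 2)%:E by rewrite lee_fin addr_ge0// sqr_ge0.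
  rewrite ge0_integralD//; last 4 first.
  - by move=> w _; rewrite !adde_ge0// lee_fin.
  - by do 2 apply: emeasurable_funD => //.
  - by move=> w _; rewrite mule_ge0// lee_fin.
  - exact: measurable_funeM.
  rewrite ge0_integralD//; last 2 first.
  - by move=> w _; rewrite !adde_ge0// lee_fin.
  - exact: emeasurable_funD.
  rewrite ge0_integralD// integral_indicT; last exact: mdS.
  rewrite integral_cst_probability ge0_integralZl//.
  have -> : \int[P0]_w (1 + D w ^+ 2)%:E = (1 + s ^+ n)%:E.
    transitivity (\int[P0]_w (1%:E + (D w ^+ 2)%:E)); first exact: eq_integral.
    rewrite ge0_integralD//; last 2 first.
    - by move=> w _; rewrite lee_fin sqr_ge0.
    - by apply/measurable_EFinP; exact: measurable_funX.
    by rewrite integral_cst_probability ID2 -EFinD.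
  by rewrite -EFinM leeD2r// leeD2r// leeD2l.
rewrite -(fineK Sfin) -(fineK SCfin) -!EFinD lee_fin.
set x := fine _; set y := fine _.
have E3 : ((1 - 2 * m ^+ n + s ^+ n) / (2 * la) = (2 * la)^-1 * (1 + s ^+ n) - la^-1 * m ^+ n)%R.
  by field; rewrite gt_eqF.
by rewrite E3; exact: three_terms_le.
Qed.

End Tuples.

End Likelihood.

Section TruncationCost.
Local Open Scope ereal_scope.
Context {R : realType}.
Variables (F0 F1 : probability R R) (th ps : R).
Hypothesis F01 : tilted F0 F1 th ps.
Variables (Q : probability nat R) (e : R).
Hypotheses (e0 : (0 <= e)%R) (e1 : (0 <= 1 - e)%R).
Hypotheses (z0 : (0 <= 0 :> R)%R) (z1 : (0 <= 1 - 0 :> R)%R).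

(** With [x = e * lr], the part [x] lost by the truncation when [x > 1], and
    the contribution [x ^+ 2] to the second moment otherwise. *)
Definition trunc_cost (x : R) : R := (Num.min x (x ^+ 2))%R.

Lemma trunc_cost_ge0 x : (0 <= x)%R -> (0 <= trunc_cost x)%R.
Proof. by move=> x0; rewrite le_min x0 sqr_ge0. Qed.

Lemma trunc_costE x : (0 <= x)%R ->
  trunc_cost x = if (x <= 1)%R then (x ^+ 2)%R else x.
Proof.
move=> x0; rewrite /trunc_cost; case: ifP => [x1|/negbT].
  by rewrite min_r// expr2 -[leRHS]mulr1 ler_wpM2l.
by rewrite -ltNge => x1; rewrite min_l// expr2 -[leLHS]mulr1 ler_wpM2l// ltW.
Qed.

(** Any moment of order between one and two controls both the mass lost by
    the truncation and the second moment that remains. *)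
Lemma trunc_cost_le_power (u s : R) : (1 <= s <= 2)%R ->
  (trunc_cost (expR u) <= expR (s * u))%R.
Proof.
move=> /andP[s1 s2]; rewrite trunc_costE ?expR_ge0// (_ : (expR u <= 1)%R = (u <= 0)%R); last first.
  by rewrite -[1%R]expR0 ler_expR.
case: ifP => [u0|/negbT]; first by rewrite -expRM_natl ler_expR; nra.
by rewrite -ltNge ler_expR => u0; nra.
Qed.

Lemma trunc_mean_pointwise (x : R) : (0 <= x)%R ->
  (1 - e + x <= 1 - e + x * (x <= 1)%R%:R + trunc_cost x)%R.
Proof.
by move=> x0; rewrite trunc_costE//; case: ifP => _;
  rewrite ?mulr1 ?mulr0 ?addr0 ?lerDl ?sqr_ge0.
Qed.

Lemma trunc_square_pointwise (x : R) : (0 <= x)%R ->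
  ((1 - e + x * (x <= 1)%R%:R) ^+ 2 <=
  (1 - e) ^+ 2 + 2 * (1 - e) * x + trunc_cost x)%R.
Proof.
move=> x0; rewrite trunc_costE//; case: ifP => _; rewrite ?mulr1 ?mulr0 ?addr0.
  by rewrite sqrrD; rewrite -mulrnAl -mulr_natl lexx.
rewrite -addrA lerDl addr_ge0// !mulr_ge0//.
Qed.

Let cost (z : nat * (R * R)) : \bar R := (trunc_cost (e * lr th ps z))%:E.

Let elr_ge0 z : (0 <= e * lr th ps z)%R.
Proof. by rewrite mulr_ge0// expR_ge0. Qed.

Let cost_ge0 z : 0 <= cost z.
Proof. by rewrite lee_fin trunc_cost_ge0. Qed.

Let measurable_elr : measurable_fun setT (fun z => (e * lr th ps z)%:E).
Proof.
apply/measurable_EFinP; apply: measurable_funM => //; exact: measurable_lr.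
Qed.

Lemma measurable_trunc_cost_lr : measurable_fun setT cost.
Proof.
apply/measurable_EFinP; apply: measurable_minr; last apply: measurable_funX;
  exact/measurable_EFinP.
Qed.
Let measurable_cost := measurable_trunc_cost_lr.

Local Notation rho := (obs_law Q F0 F1 z0 z1).

Lemma integral_elr : \int[rho]_z (e * lr th ps z)%:E = e%:E.
Proof.
under eq_integral do rewrite EFinM.
have mlr : measurable_fun setT (EFin \o lr th ps) by apply/measurable_EFinP; exact: measurable_lr.
rewrite ge0_integralZl//; last by move=> z _; rewrite lee_fin expR_ge0.
rewrite integral_obs_law0//; last by move=> z; rewrite lee_fin expR_ge0.
have := integral_size_law_tilted F01 Q (measurable_cst (1 : \bar R)) (fun=> lee01).
under [X in _ = X]eq_integral do rewrite mule1.
move=> <-; rewrite integral_size_law//.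
under eq_integral do under eq_integral do rewrite integral_cst_probability.
under eq_integral do rewrite integral_cst_probability.
by rewrite integral_cst_probability mule1.
Qed.

(** One and the same integral bounds the loss of mean and the excess of the
    second moment: the means of [1 - e] and [e * lr] sum to one. *)
Lemma trunc_moments (B : R) : \int[rho]_z cost z <= B%:E ->
  exists m s, [/\ \int[rho]_z (lr_trunc th ps e z)%:E = m%:E,
   \int[rho]_z ((lr_trunc th ps e z) ^+ 2)%:E = s%:E,
   (1 - B <= m)%R, (0 <= m)%R & (0 <= s <= 1 + B)%R].
Proof.
move=> hB.
have mt := measurable_lr_trunc th ps e.
have t0 := lr_trunc_ge0 th ps e0 e1.
have mEt : measurable_fun setT (fun z => (lr_trunc th ps e z)%:E) by exact/measurable_EFinP.
have mEt2 : measurable_fun setT (fun z => (lr_trunc th ps e z ^+ 2)%:E).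
  by apply/measurable_EFinP; exact: measurable_funX.
have tE z : lr_trunc th ps e z =
    (1 - e + (e * lr th ps z) * (e * lr th ps z <= 1)%R%:R)%R by rewrite /lr_trunc mulrA.
have Imix : \int[rho]_z ((1 - e)%:E + (e * lr th ps z)%:E) = 1.
  rewrite ge0_integralD//; last by move=> z _; rewrite lee_fin.
  by rewrite integral_cst_probability integral_elr -EFinD subrK.
have Ile : \int[rho]_z (lr_trunc th ps e z)%:E <= 1.
  rewrite -Imix; apply: ge0_le_integral => //.
  - by move=> z _; rewrite lee_fin.
  - exact: emeasurable_funD.
  - by move=> z _; rewrite -EFinD lee_fin; exact: lr_trunc_le.
have I0 : 0 <= \int[rho]_z (lr_trunc th ps e z)%:E.
  by apply: integral_ge0 => z _; rewrite lee_fin.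
have Ifin : \int[rho]_z (lr_trunc th ps e z)%:E \is a fin_num.
  by rewrite ge0_fin_numE// (le_lt_trans Ile) ?ltry.
have I20 : 0 <= \int[rho]_z (lr_trunc th ps e z ^+ 2)%:E.
  by apply: integral_ge0 => z _; rewrite lee_fin sqr_ge0.
have c0 : (0 <= 2 * (1 - e))%R by rewrite mulr_ge0.
have I2le : \int[rho]_z (lr_trunc th ps e z ^+ 2)%:E <= (1 + B)%:E.
  apply: (@le_trans _ _ (\int[rho]_z (((1 - e) ^+ 2)%:E +
      (2 * (1 - e))%:E * (e * lr th ps z)%:E + cost z))).
    apply: ge0_le_integral => //.
    - by move=> z _; rewrite lee_fin sqr_ge0.
    - apply: emeasurable_funD => //; apply: emeasurable_funD => //.
      exact: measurable_funeM.
    - by move=> z _; rewrite -EFinM -!EFinD lee_fin tE; exact: trunc_square_pointwise.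
  rewrite ge0_integralD//; last 2 first.
  - move=> z _; rewrite adde_ge0//; first by rewrite lee_fin sqr_ge0.
    by rewrite -EFinM lee_fin mulr_ge0.
  - by apply: emeasurable_funD => //; exact: measurable_funeM.
  rewrite ge0_integralD//; last 3 first.
  - by move=> z _; rewrite lee_fin sqr_ge0.
  - by move=> z _; rewrite -EFinM lee_fin mulr_ge0.
  - exact: measurable_funeM.
  rewrite integral_cst_probability ge0_integralZl//; last by move=> z _; rewrite lee_fin.
  rewrite integral_elr -EFinM -EFinD [leRHS]EFinD leeD// lee_fin.
  have -> : ((1 - e) ^+ 2 + 2 * (1 - e) * e = 1 - e ^+ 2)%R by ring.
  by rewrite lerBlDr lerDl sqr_ge0.
have I2fin : \int[rho]_z (lr_trunc th ps e z ^+ 2)%:E \is a fin_num.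
  by rewrite ge0_fin_numE// (le_lt_trans I2le) ?ltry.
exists (fine (\int[rho]_z (lr_trunc th ps e z)%:E)),
  (fine (\int[rho]_z (lr_trunc th ps e z ^+ 2)%:E)).
split; rewrite ?fineK//; last 2 first.
- by rewrite fine_ge0.
- by rewrite fine_ge0//= -lee_fin fineK.
rewrite lerBlDr -lee_fin EFinD fineK//.
apply: (@le_trans _ _ (\int[rho]_z ((lr_trunc th ps e z)%:E + cost z))); last first.
  by rewrite ge0_integralD ?leeD2l// => z _; rewrite lee_fin.
rewrite -Imix; apply: ge0_le_integral => //.
- by move=> z _; rewrite -EFinD lee_fin addr_ge0.
- exact: emeasurable_funD.
- exact: emeasurable_funD.
- by move=> z _; rewrite -!EFinD lee_fin tE; exact: trunc_mean_pointwise.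
Qed.

(** The order [s] may be chosen for each size separately. The moment of order
    [s] of the likelihood ratio of [k] summands is the [k]-th power of that of
    one of them. *)
Lemma integral_trunc_cost_le (be L : R) (r : nat -> R) : e = expR (- be * L) ->
  (forall k, exists s, [/\ (1 <= s <= 2)%R, natural_space F0 (s * th)%R &
     (- be * s * L + k%:R * (psi F0 (s * th)%R - s * ps) <= r k)%R]) ->
  \int[rho]_z cost z <= \int[Q]_k (expR (r k))%:E.
Proof.
move=> eE H; rewrite integral_obs_law0// integral_size_law//.
apply: ge0_le_integral => //.
- by move=> k _; apply: integral_ge0 => y _; exact: integral_ge0.
move=> k _; have [s [s12 Ts hs]] := H k.
apply: (@le_trans _ _ (\int[conv_pow F0 k]_y ((expR (- be * s * L))%:E *
    (expR ((s * th) * y - k%:R * (s * ps)))%:E))).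
  apply: ge0_le_integral => //.
  - by move=> y _; exact: integral_ge0.
  - exact: (measurable_section F0 k measurable_cost).
  - apply: measurable_funeM; apply/measurable_EFinP; exact: measurable_expR_affine.
  move=> y _; under eq_integral do rewrite /cost /lr /=.
  rewrite integral_cst_probability -EFinM lee_fin eE -!expRD.
  apply: (le_trans (trunc_cost_le_power _ s12)).
  by rewrite ler_expR le_eqVlt; apply/orP; left; apply/eqP; ring.
rewrite ge0_integralZl//; last first.
  by apply/measurable_EFinP; exact: measurable_expR_affine.
rewrite conv_pow_mgf natural_space_shift// -EFin_expe -EFinM lee_fin.
by rewrite -expRM_natl -expRD ler_expR.
Qed.

End TruncationCost.

(** Bernoulli inequality, including the range [B > 1] where [1 - B] is
    negative. *)
Lemma bernoulli_le (R : realFieldType) (m B : R) n :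
  0 <= B -> 0 <= m -> 1 - B <= m -> 1 - n%:R * B <= m ^+ n.
Proof.
move=> B0 m0 mB; elim: n => [|n IH]; first by rewrite mul0r subr0 expr0.
have mn0 : 0 <= m ^+ n by rewrite exprn_ge0.
rewrite exprS -natr1 mulrDl mul1r.
have nB : 0 <= n%:R * B by rewrite mulr_ge0.
move: IH mn0 nB; move: (m ^+ n) (n%:R * B) => x y IH x0 y0.
have [y1|y1] := leP y 1; first by nra.
by apply: (@le_trans _ _ 0); [lra|rewrite mulr_ge0].
Qed.

Lemma expr1D_le_expR (R : realType) (s B : R) n : 0 <= s <= 1 + B -> s ^+ n <= expR (n%:R * B).
Proof.
move=> /andP[s0 sB]; rewrite expRM_natl lerXn2r ?nnegrE ?expR_ge0//.
exact: le_trans (expR_ge1Dx _).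
Qed.

(** * Tests above the curve *)

(** A power of [n] dominates every power of [log n]. *)
Lemma near_expR_ge (R : realType) (C c : R) p : 0 < c ->
  \forall n \near \oo, C * lnn n ^+ p <= expR (c * lnn n).
Proof.
move=> c0; pose q := c / p.+1%:R; have q0 : 0 < q by rewrite divr_gt0.
near=> n; set L := lnn n.
have L0 : 0 <= L by rewrite /L; near: n; exact: near_lnn_ge.
have LC : C / q ^+ p.+1 <= L by rewrite /L; near: n; exact: near_lnn_ge.
have -> : c * L = p.+1%:R * (q * L) by rewrite mulrA [_ * q]mulrC /q divfK// pnatr_eq0.
rewrite expRM_natl.
have h : q * L <= expR (q * L) by apply: le_trans (expR_ge1Dx _); rewrite lerDr.
apply: (@le_trans _ _ ((q * L) ^+ p.+1)); last first.
  by rewrite lerXn2r// nnegrE ?expR_ge0// mulr_ge0// ltW.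
rewrite exprMn (exprSr L) mulrA mulrAC ler_wpM2r ?exprn_ge0//.
by rewrite mulrC -ler_pdivrMr// exprn_gt0.
Unshelve. all: by end_near.
Qed.

Lemma sum_nat_le_bounded (R : realType) (x c : R) m : 0 <= x -> 0 <= c ->
  \sum_(0 <= k < m) (if k%:R <= x then c else 0) <= (x + 1) * c.
Proof.
move=> x0 c0; rewrite -big_mkcond/=.
have H j : \sum_(0 <= k < j | k%:R <= x) c <= j%:R * c.
  rewrite mulr_natl big_mkcond/=.
  rewrite -[j in leRHS]subn0 -sumr_const_nat; apply: ler_sum => i _.
  by case: ifP.
have [mx|mx] := leP m%:R (x + 1).
  by apply: (le_trans (H m)); rewrite ler_wpM2r.
pose j := (Num.truncn x).+1.
have jm : (j <= m)%N.
  rewrite -(ler_nat R) /j -natr1; apply: le_trans (ltW mx); rewrite lerD2r.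
  by rewrite truncn_le.
rewrite (big_cat_nat (n := j))//= [X in _ + X]big_nat_cond [X in _ + X]big1 ?addr0; last first.
  move=> i /andP[/andP[ji _] ix]; exfalso; move: ix; rewrite leNgt => /negP; apply.
  by apply: lt_le_trans (truncnS_gt x) _; rewrite ler_nat.
apply: (le_trans (H j)); rewrite ler_wpM2r// /j -natr1 lerD2r.
by rewrite truncn_le.
Qed.

Section Undetectable.
Context {R : realType}.
Variables (F0 F1 : probability R R) (th a0 : R) (J : R -> R).
Local Notation Th := (natural_space F0).
Local Notation ps := (psi F0).
Hypothesis nondeg : forall c : R, F0 [set c] <> 1%E.
Hypotheses (a0_gt0 : 0 < a0) (J_vanishes : rate_vanishes a0 J)
  (J_derivative : rate_derivative a0 J).
Hypotheses (Tth : Th th) (th0 : th != 0) (der : psi_derivable F0 th).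
Hypothesis theta_rate : (a0%:E * rate_I F0 (mu F0 th) <= 1)%E.
Hypothesis F01 : tilted F0 F1 th (ps th).
Variables (Q : nat -> probability nat R) (alpha : nat -> nat -> R).
Hypothesis Q_rate : sizes_follow_rate a0 J Q alpha.
Variable be : R.
Hypotheses (be_gt0 : 0 < be) (curve_lt : (b_curve F0 J th < be%:E)%E).

(** The exponents are continuous in the relative size, so each order is good
    on a neighbourhood with a definite margin, and compactness of [[a0, a1]]
    makes the margin uniform. *)
Lemma moment_margin a1 : exists2 dl, 0 < dl & forall a, a0 <= a <= a1 ->
  exists s, [/\ 1 <= s <= 2, Th (s * th) & moment_exponent ps th J be a s <= - dl].
Proof.
have /compact_near_coveringP cov := @segment_compact _ a0 a1.
pose good (dl a : R) := exists s,
  [/\ 1 <= s <= 2, Th (s * th) & moment_exponent ps th J be a s <= - dl].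
have [a /=|x /= [x0 Hx]] := cov _ (0 : R)^'+ good.
  rewrite in_itv/= => /andP[a0a _].
  have [s [s12 Ts neg]] := moment_of_b_curve_lt a0_gt0 J_vanishes
    J_derivative Tth th0 der theta_rate curve_lt a0a.
  have ct : {for a, continuous (fun a => moment_exponent ps th J be a s)}.
    apply: cvgD; last by apply: cvgM; [exact: cvg_id|exact: cvg_cst].
    apply: cvgB; last exact: cvg_cst.
    by apply: cvgB; [exact: cvg_cst|exact: rate_continuous_at J_derivative _ a0a].
  set m := moment_exponent ps th J be a s in neg.
  have near_a : \forall a' \near a, moment_exponent ps th J be a' s < m / 2.
    by apply: (cvgr_lt _ ct); rewrite -/m; lra.
  have near_dl : \forall dl \near (0 : R)^'+, dl < - m / 2.
    by apply: nbhs_right_lt; lra.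
  near=> a' dl => /=; exists s; split => //.
  have h1 : moment_exponent ps th J be a' s < m / 2 by near: a'.
  have h2 : dl < - m / 2 by near: dl.
  by apply: ltW; apply: (lt_trans h1); rewrite ltrNr -mulNr.
exists (x / 2); first by rewrite divr_gt0.
move=> a aa; apply: (Hx (x / 2)) => /=.
- by rewrite sub0r normrN gtr0_norm ?divr_gt0//; lra.
- by rewrite divr_gt0.
- by rewrite in_itv.
Unshelve. all: by end_near.
Qed.

Hypotheses (z0 : (0 <= 0 :> R)%R) (z1 : (0 <= 1 - 0 :> R)%R).

(** Three ranges of sizes. Below [a0 * log n] the best exponent is at most its
    value at [a0]. Up to [a1 * log n] the margin of the exponents applies, and
    there are only logarithmically many sizes. Beyond, where [J > 1], the
    sizes alone are rare enough and the first moment suffices. *)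
Lemma trunc_cost_integral_small ep : 0 < ep -> \forall n \near \oo,
  exists2 B, 0 <= B /\ n%:R * B <= ep &
  (\int[obs_law (Q n) F0 F1 z0 z1]_z
     (trunc_cost (expR (- be * lnn n) * lr th (ps th) z))%:E <= B%:E)%E.
Proof.
move=> ep0.
have [a1 [a01 Ja1]] := rate_unbounded a0_gt0 J_vanishes J_derivative 1.
have a1_gt0 : 0 < a1 by exact: lt_trans a01.
have [dl2 dl20 Hdl] := moment_margin a1.
pose dl := dl2 / 2; have dl0 : 0 < dl by rewrite divr_gt0.
have dl2E : dl2 = dl + dl by rewrite /dl; lra.
pose ka := Num.min dl (be / 2).
have ka0 : 0 < ka by rewrite lt_min dl0 divr_gt0.
have kadl : ka <= dl by rewrite ge_min lexx.
have kabe : ka <= be / 2 by rewrite ge_min lexx orbT.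
have eta0 : 0 < dl / a1 by rewrite divr_gt0.
have be20 : 0 < be / 2 by rewrite divr_gt0.
have tail := size_tail a0_gt0 J_vanishes J_derivative Q_rate (ltW a01) be20.
have bnds := size_prob_bounds Q_rate eta0.
near=> n; set L := lnn n.
have L1 : 1 <= L by rewrite /L; near: n; exact: near_lnn_ge.
have L0 : 0 < L by exact: lt_le_trans L1.
have n0 : (0 < n)%N by near: n; exact: nbhs_infty_gt.
have Htail : (Q n [set k | (a1 * L <= k%:R)%R] <= (expR (- (J a1 - be / 2) * L))%:E)%E.
  by rewrite /L; near: n.
have Hb k : (0 < k)%N -> a0 * L <= k%:R ->
    fine (Q n [set k]) <= expR (dl / a1 * k%:R - L * J (k%:R / L)).
  move=> k0 ka'; suff /(_ k k0 ka')/andP[] : forall k : nat, (0 < k)%N -> a0 * L <= k%:R ->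
    expR (- (dl / a1 * k%:R) - L * J (k%:R / L)) <= fine (Q n [set k])
      <= expR (dl / a1 * k%:R - L * J (k%:R / L)) by [].
  by rewrite /L; near: n.
have Hbig : (a1 + 3) / ep * L ^+ 1 <= expR (ka * L).
  by rewrite /L; near: n; exact: near_expR_ge.
(* Exponent of the cost at size [k]: that of a good moment, or [- be] from the
   first moment beyond [a1 * L]. *)
pose r (k : nat) : R := if k%:R <= a1 * L then L * (J (k%:R / L) - 1 - dl2) else - be * L.
pose c1 := expR (- (1 + ka) * L).
have c1_gt0 : 0 < c1 by exact: expR_gt0.
exists ((a1 * L + 3) * c1).
  split; first by rewrite mulr_ge0 ?expR_ge0// addr_ge0// mulr_ge0 ?ltW.
  rewrite -(expR_lnn n0) -/L mulrCA /c1 -expRD.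
  have -> : L + - (1 + ka) * L = - (ka * L) by ring.
  rewrite expRN ler_pdivrMr ?expR_gt0// [leRHS]mulrC -ler_pdivrMr//.
  apply: le_trans Hbig; rewrite expr1 -mulrA [ep^-1 * L]mulrC mulrA ler_pM2r ?invr_gt0//.
  by nra.
apply: (@le_trans _ _ (\int[Q n]_k (expR (r k))%:E)%E).
  apply: (@integral_trunc_cost_le R F0 F1 th (ps th) (Q n) _ (expR_ge0 _) z0 z1 be L r erefl) => k.
  rewrite /r.
  have kL : k%:R = L * (k%:R / L) by rewrite mulrCA divff ?mulr1// gt_eqF.
  case: ifPn => [ka1|_]; last first.
    by exists 1; rewrite mul1r lexx ler1n; split => //; rewrite mul1r subrr mulr0 addr0 mulr1.
  have a'0 : 0 <= k%:R / L by rewrite divr_ge0// ltW.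
  pose a := Num.max a0 (k%:R / L).
  have aa : a0 <= a <= a1.
    by rewrite le_max lexx/= ge_max (ltW a01)/= ler_pdivrMr.
  have [s [s12 Ts hs]] := Hdl a aa; exists s; split => //.
  have gap := cumulant_gap_ge0 (psi_subgradient Tth der)
    (ltW (mean_rate_gt0 nondeg Tth th0 der)) (proj1 (andP s12)) Ts.
  have JE : J (k%:R / L) = J a.
    rewrite /a; case: (leP a0 (k%:R / L)) => // h.
    by rewrite !J_vanishes ?lexx ?(ltW a0_gt0)// a'0 ltW.
  have agap : k%:R / L * (ps (s * th) - s * ps th) <= a * (ps (s * th) - s * ps th).
    by rewrite ler_wpM2r// le_max lexx orbT.
  rewrite JE [X in _ + X * _]kL -[L * _ * _]mulrA [- be * s * L]mulrC -mulrDr ler_pM2l//.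
  apply: (le_trans (y := - be * s + a * (ps (s * th) - s * ps th))); first by rewrite lerD2l.
  by move: hs; rewrite /moment_exponent; move: (a * _) => u; rewrite !mulNr; lra.
pose f2 (k : nat) : R := if (a0 * L <= k%:R) && (k%:R <= a1 * L) then expR (r k) else 0.
have f20 k : 0 <= f2 k by rewrite /f2; case: ifP => // _; exact: expR_ge0.
have cbe0 : 0 <= expR (- be * L) by exact: expR_ge0.
apply: (@le_trans _ _ (\int[Q n]_k (c1%:E + (f2 k)%:E +
   (expR (- be * L))%:E * (\1_[set k : nat | (a1 * L <= k%:R)%R] k)%:E))%E).
  apply: ge0_le_integral => //.
  move=> k _; rewrite -EFinM -!EFinD lee_fin indicE /f2 /r.
  have [ka1|ka1] := leP (k%:R) (a1 * L); last first.
    by rewrite andbF addr0 mem_set/= ?(ltW ka1)// mulr1 lerDr (ltW c1_gt0).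
  rewrite andbT; apply: (@le_trans _ _ (c1 + if a0 * L <= k%:R then
      expR (L * (J (k%:R / L) - 1 - dl2)) else 0)); last by rewrite lerDl mulr_ge0.
  have [ka0'|ka0'] := leP (a0 * L) (k%:R); first by rewrite lerDr ltW.
  rewrite addr0 /c1 J_vanishes; last by rewrite divr_ge0 ?(ltW L0)//= ler_pdivrMr// ltW.
  by rewrite ler_expR; nra.
have I0 k : setT k -> (0 <= (expR (- be * L))%:E * (\1_[set j : nat | (a1 * L <= j%:R)%R] k)%:E)%E.
  by rewrite -EFinM lee_fin mulr_ge0.
have F0' k : setT k -> (0 <= (f2 k)%:E)%E by rewrite lee_fin.
have C0 (k : nat) : setT k -> (0 <= c1%:E)%E by rewrite lee_fin ltW.
have S0 k : setT k -> (0 <= c1%:E + (f2 k)%:E)%E by rewrite -EFinD lee_fin addr_ge0// ltW.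
rewrite ge0_integralD// ge0_integralD//.
rewrite integral_cst_probability ge0_integralZl// integral_indicT//.
have -> : ((a1 * L + 3) * c1)%:E = (c1%:E + ((a1 * L + 1) * c1)%:E + c1%:E)%E.
  by rewrite -!EFinD; congr EFin; ring.
apply: leeD; first apply: leeD => //.
- apply: integral_nat_le; first by move=> k; rewrite lee_fin.
  move=> m; apply: (@le_trans _ _ (\sum_(0 <= k < m) (if k%:R <= a1 * L then c1 else 0))%:E).
    rewrite -sumEFin; apply: lee_sum => k _.
    rewrite -[Q n _]fineK ?fin_num_measure// -EFinM lee_fin /f2 /r.
    have [ka1|ka1] := leP (k%:R) (a1 * L); last by rewrite andbF mulr0.
    have [ka0'|ka0'] /= := leP (a0 * L) (k%:R); last by rewrite mulr0 ltW.
    have k0 : (0 < k)%N.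
      by rewrite -(ltr0n R); apply: lt_le_trans ka0'; rewrite mulr_gt0.
    apply: (@le_trans _ _ (expR (dl / a1 * k%:R - L * J (k%:R / L)) *
       expR (L * (J (k%:R / L) - 1 - dl2)))).
      by rewrite ler_wpM2r ?expR_ge0// Hb.
    rewrite -expRD ler_expR.
    have : dl / a1 * k%:R <= dl * L.
      by rewrite -mulrA ler_pM2l// mulrC ler_pdivrMr// mulrC.
    by rewrite dl2E; move: (J _) (dl / a1 * _) => u v h; nra.
  by rewrite lee_fin sum_nat_le_bounded// ltW// mulr_gt0.
- apply: (@le_trans _ _ ((expR (- be * L))%:E * (expR (- (J a1 - be / 2) * L))%:E)%E).
    by rewrite lee_wpmul2l.
  by rewrite -EFinM -expRD lee_fin ler_expR; nra.
Unshelve. all: by end_near.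
Qed.

End Undetectable.

Lemma cvge_of_bounds (R : realType) (u : nat -> \bar R) (x : R) :
  (forall e, 0 < e -> \forall n \near \oo, ((x - e)%:E <= u n <= (x + e)%:E)%E) ->
  u n @[n --> \oo] --> x%:E.
Proof.
move=> H; apply/fine_cvgP; split.
  near=> n; have /andP[h1 h2] : ((x - 1)%:E <= u n <= (x + 1)%:E)%E by near: n; exact: H.
  by rewrite fin_numElt (lt_le_trans _ h1) ?ltNyr//= (le_lt_trans h2) ?ltry.
apply/cvgrPdist_le => e e0; near=> n.
have /andP[] : ((x - e)%:E <= u n <= (x + e)%:E)%E by near: n; exact: H.
rewrite /=; case: (u n) => [r| |] //; rewrite !lee_fin => h1 h2.
by rewrite ler_distlC h1 h2.
Unshelve. all: by end_near.
Qed.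

Section RiskBounds.
Local Open Scope ereal_scope.
Context {R : realType} {d : measure_display} {Omega : measurableType d}.
Variables (P0 P1 : probability Omega R) (T : Omega -> R).
Hypothesis mT : measurable_fun setT T.

Lemma risk_ge (x : \bar R) :
  (forall c, x <= P0 [set w | T w <= c]%R + P1 [set w | c < T w]%R) ->
  (forall c, x <= P0 [set w | c <= T w]%R + P1 [set w | T w < c]%R) ->
  x <= risk P0 P1 T.
Proof.
by move=> h1 h2; rewrite /risk; case: ifP => _;
  apply: le_ereal_inf_tmp => _ [c _ <-].
Qed.

Let X : {mfun Omega >-> R} := HB.pack T (isMeasurableFun.Build _ _ _ _ T mT).

Lemma upper_tail_small (P : probability Omega R) (e : R) : (0 < e)%R ->
  exists c, P [set w | c < T w]%R <= e%:E.
Proof.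
move=> e0; have := cvg_ccdfy0 (X : {RV P >-> R}).
move=> /fine_cvgP[_ /cvgrPdist_le /(_ e e0)] [M [_ HM]].
exists (M + 1)%R; have := HM (M + 1)%R; rewrite sub0r normrN /= => /(_ _).
have -> : [set w | (M + 1 < T w)%R] = X @^-1` `](M + 1)%R, +oo[%classic.
  by apply/seteqP; split => w /=; rewrite in_itv/= andbT.
rewrite -[X in X <= _]fineK; last first.
  apply: fin_num_measure; rewrite -[X in measurable X]setTI; exact: mT.
rewrite lee_fin => h; apply: (le_trans (ler_norm _)); apply: h.
by rewrite ltrDl.
Qed.

(** Tests that almost always, or almost never, reject have total error close
    to [1]; a cut-off far in the tail is one. *)
Lemma risk_le1 : risk P0 P1 T <= 1.
Proof.
have mle c : measurable [set w | (c < T w)%R].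
  have -> : [set w | (c < T w)%R] = setT `&` T @^-1` `]c, +oo[%classic.
    by rewrite setTI; apply/seteqP; split => w /=; rewrite in_itv/= andbT.
  exact: mT.
apply/lee_addgt0Pr => e e0.
rewrite /risk; case: ifP => _.
  have [c hc] := upper_tail_small P1 e0.
  apply: (@le_trans _ _ (P0 [set w | T w <= c]%R + P1 [set w | c < T w]%R)).
    by apply: ereal_inf_lbound; exists c.
  by apply: leeD => //; apply: probability_le1; rewrite -[X in measurable X]setCK;
    apply: measurableC; rewrite (_ : ~` _ = [set w | c < T w]%R) //;
    apply/seteqP; split => w /=; [move/negP; rewrite -ltNge|move=> h; apply/negP; rewrite -ltNge].
have [c hc] := upper_tail_small P0 e0.
have mge : measurable [set w | (c + 1 <= T w)%R].
  have -> : [set w | (c + 1 <= T w)%R] = setT `&` T @^-1` `[(c + 1)%R, +oo[%classic.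
    by rewrite setTI; apply/seteqP; split => w /=; rewrite in_itv/= andbT.
  exact: mT.
apply: (@le_trans _ _ (P0 [set w | c + 1 <= T w]%R + P1 [set w | T w < c + 1]%R)).
  by apply: ereal_inf_lbound; exists (c + 1)%R.
rewrite addeC; apply: leeD.
  apply: probability_le1.
  rewrite (_ : [set w | (T w < c + 1)%R] = ~` [set w | (c + 1 <= T w)%R]); last first.
    by apply/seteqP; split => w /=; [move=> h; apply/negP; rewrite -ltNge|move/negP; rewrite -ltNge].
  exact: measurableC.
apply: le_trans hc; apply: le_measure; rewrite ?inE// => w /=.
by apply: lt_le_trans; rewrite ltrDl.
Qed.

End RiskBounds.

Lemma second_moment_gap (R : realFieldType) (x y z t c e : R) :
  1 - t <= x -> y <= z -> z <= 1 + 2 * t -> t <= c -> c <= e ^+ 2 / 4 ->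
  1 - 2 * x + y <= e / 2 * (2 * e).
Proof. by rewrite expr2 => *; lra. Qed.

Section Powerless.
Context {R : realType}.
Variables (F0 F1 : probability R R) (th a0 : R) (J : R -> R).
Local Notation Th := (natural_space F0).
Local Notation ps := (psi F0).
Hypothesis nondeg : forall c : R, F0 [set c] <> 1%E.
Hypotheses (a0_gt0 : 0 < a0) (J_vanishes : rate_vanishes a0 J)
  (J_derivative : rate_derivative a0 J).
Hypotheses (Tth : Th th) (th0 : th != 0) (der : psi_derivable F0 th).
Hypothesis theta_rate : (a0%:E * rate_I F0 (mu F0 th) <= 1)%E.
Hypothesis F01 : tilted F0 F1 th (ps th).
Variables (Q : nat -> probability nat R) (alpha : nat -> nat -> R).
Hypothesis Q_rate : sizes_follow_rate a0 J Q alpha.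
Variable be : R.
Hypotheses (be_gt0 : 0 < be) (curve_lt : (b_curve F0 J th < be%:E)%E).
Variables (d : nat -> measure_display) (Omega : forall n, measurableType (d n))
  (P0 P1 : forall n, probability (Omega n) R)
  (K : forall n, 'I_n -> {mfun Omega n >-> nat})
  (Y V : forall n, 'I_n -> {mfun Omega n >-> R})
  (H0 : forall n, mixture_sample F0 F1 (Q n) 0 (P0 n) (@K n) (@Y n) (@V n))
  (H1 : forall n, mixture_sample F0 F1 (Q n) (n%:R `^ (- be))
                    (P1 n) (@K n) (@Y n) (@V n)).

Lemma expR_le_twice (x : R) : 0 <= x <= 2^-1 -> expR x <= 1 + 2 * x.
Proof.
move=> /andP[x0 x1]; apply: (le_trans (expR_le_quadratic x1)); nra.
Qed.

(** The truncated product has mean close to [1] and second moment close to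
    [1], by [bernoulli_le] and [expr1D_le_expR]. *)
Lemma all_tests_powerless ep : 0 < ep -> \forall n \near \oo,
  forall S : set (n.-tuple (nat * R)), measurable S ->
  1 - ep <= fine (P0 n (data (@K n) (@Y n) @^-1` S)) +
            fine (P1 n (data (@K n) (@Y n) @^-1` (~` S))).
Proof.
move=> ep0.
have z0 : (0 <= 0 :> R) by [].
have z1 : (0 <= 1 - 0 :> R) by rewrite subr0.
(* The bound [1 - 2 * (1 - c) + (1 + 2 * c) = 4 * c] on the second moment of
   [1 - D] has to be at most [ep ^+ 2]. *)
pose c := Num.min 2^-1 (ep ^+ 2 / 4).
have c0 : 0 < c by rewrite lt_min invr_gt0 ltr0n/= divr_gt0// exprn_gt0.
have c12 : c <= 2^-1 by rewrite ge_min lexx.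
have cep : c <= ep ^+ 2 / 4 by rewrite ge_min lexx orbT.
have small := trunc_cost_integral_small F1 nondeg a0_gt0 J_vanishes J_derivative
  Tth th0 der theta_rate Q_rate be_gt0 curve_lt z0 z1 c0.
near=> n => S mS.
have n0 : (0 < n)%N by near: n; exact: nbhs_infty_gt.
have [B [B0 nB] hB] : exists2 B, 0 <= B /\ n%:R * B <= c &
  (\int[obs_law (Q n) F0 F1 z0 z1]_z
     (trunc_cost (expR (- be * lnn n) * lr th (ps th) z))%:E <= B%:E)%E by near: n.
have L0 : 0 <= lnn n :> R by near: n; exact: near_lnn_ge.
have eE : n%:R `^ (- be) = expR (- be * lnn n) by rewrite powR_lnn.
have e0 : 0 <= expR (- be * lnn n) by exact: expR_ge0.
have e1 : 0 <= 1 - expR (- be * lnn n).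
  by rewrite subr_ge0 -[leRHS]expR0 ler_expR mulNr oppr_le0 mulr_ge0// ltW.
have H1n := H1 n; rewrite eE in H1n.
have [m [s [m1 s1 mB m0 sB]]] := trunc_moments F01 e0 e1 hB.
apply: le_trans (test_errors_ge F01 e0 e1 (H0 n) H1n m1 s1 mS ep0).
have mn := bernoulli_le n B0 m0 mB.
have sn := expr1D_le_expR n sB.
have nB0 : 0 <= n%:R * B by rewrite mulr_ge0.
have ex : expR (n%:R * B) <= 1 + 2 * (n%:R * B).
  by apply: expR_le_twice; rewrite nB0 (le_trans nB).
have : (1 - 2 * m ^+ n + s ^+ n) / (2 * ep) <= ep / 2.
  rewrite ler_pdivrMr ?mulr_gt0//.
  exact: second_moment_gap mn sn ex nB cep.
lra.
Unshelve. all: by end_near.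
Qed.

Lemma powerless_above_curve (T : forall n, {mfun n.-tuple (nat * R)%type >-> R}) :
  asymptotically_powerless P0 P1
    (fun n w => T n [tuple (@K n i w, @Y n i w) | i < n]).
Proof.
apply: cvge_of_bounds => ep ep0.
have tests := all_tests_powerless ep0.
near=> n.
have errs : forall S : set (n.-tuple (nat * R)), measurable S ->
  1 - ep <= fine (P0 n (data (@K n) (@Y n) @^-1` S)) +
            fine (P1 n (data (@K n) (@Y n) @^-1` (~` S))) by near: n.
have mD := @measurable_data R n (d n) (Omega n) (@K n) (@Y n).
have errsE (S : set (n.-tuple (nat * R))) : measurable S -> ((1 - ep)%:E <=
    P0 n (data (@K n) (@Y n) @^-1` S) + P1 n (data (@K n) (@Y n) @^-1` (~` S)))%E.
  move=> mS; rewrite -[P0 n _]fineK ?fin_num_measure//; last first.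
    by rewrite -[X in measurable X]setTI; exact: mD.
  rewrite -[P1 n _]fineK ?fin_num_measure//; last first.
    by rewrite -[X in measurable X]setTI; apply: mD => //; exact: measurableC.
  by rewrite -EFinD lee_fin errs.
have mT : measurable_fun setT (T n) by [].
have mS (I : set R) : measurable I -> measurable (T n @^-1` I).
  by move=> mI; rewrite -[X in measurable X]setTI; exact: mT.
apply/andP; split; last first.
  apply: le_trans (risk_le1 _ _ _) _; last by rewrite lee_fin lerDl ltW.
  by apply: (measurableT_comp mT); exact: mD.
apply: risk_ge => c.
  have := errsE _ (mS _ (measurable_itv `]-oo, c])).
  congr (_ <= P0 n _ + P1 n _)%E; apply/seteqP; split => w /=; rewrite ?in_itv//=.
    by move/negP; rewrite -ltNge.
  by move=> h; apply/negP; rewrite -ltNge.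
have := errsE _ (mS _ (measurable_itv `[c, +oo[)).
congr (_ <= P0 n _ + P1 n _)%E; apply/seteqP; split => w /=; rewrite ?in_itv/= ?andbT//.
  by move/negP; rewrite -ltNge.
by move=> h; apply/negP; rewrite -ltNge.
Unshelve. all: by end_near.
Qed.

End Powerless.

(** * Law of the p-values *)

Section RandomizedTail.
Context {R : realType}.
Local Open Scope ereal_scope.

Lemma unif01_le (x : R) : (0 <= x <= 1)%R -> unif01 [set v | v <= x]%R = x%:E.
Proof.
move=> /andP[x0 x1]; rewrite unif01E /uniform_prob integral_uniform_pdf.
have -> : [set v : R | v <= x]%R `&` `[0%R, 1%R] = `[0%R, x]%classic.
  apply/seteqP; split => v /=; rewrite !in_itv/=; first by move=> [-> /andP[->]].
  by move=> /andP[v0 vx]; rewrite v0 (le_trans vx x1).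
transitivity (\int[lebesgue_measure]_(v in `[0%R, x]) (cst 1 v : \bar R)).
  apply: eq_integral => v; rewrite inE/= in_itv/= => /andP[v0 vx].
  by rewrite /uniform_pdf v0 (le_trans vx x1) subr0 invr1.
rewrite integral_cst//= mul1e lebesgue_measure_itv/= lte_fin.
by case: ltP => // x0'; rewrite ?sube0//; congr EFin; apply/le_anti; rewrite x0 x0'.
Qed.

Lemma unif01_range : unif01 [set v : R | 0 <= v <= 1]%R = 1.
Proof.
have -> : [set v : R | 0 <= v <= 1]%R = `[0%R, 1%R]%classic.
  by apply/seteqP; split => v /=; rewrite in_itv.
rewrite unif01E /uniform_prob integral_uniform_pdf1//.
Qed.

Lemma measurable_unit : measurable [set v : R | 0 <= v <= 1]%R.
Proof.
have -> : [set v : R | 0 <= v <= 1]%R = `[0%R, 1%R]%classic.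
  by apply/seteqP; split => v /=; rewrite in_itv.
exact: measurable_itv.
Qed.

Lemma unif01_null (A : set R) : measurable A ->
  (forall v, A v -> ~~ (0 <= v <= 1)%R) -> unif01 A = 0.
Proof.
move=> mA H; apply/eqP; rewrite eq_le measure_ge0 andbT.
have := @probability_setC _ _ _ (@unif01 R) _ measurable_unit.
rewrite unif01_range subee// => <-.
apply: le_measure; rewrite ?inE//; first by apply: measurableC; exact: measurable_unit.
by move=> v /H /negP.
Qed.

Variable nu : probability R R.

Definition upper_tail (y : R) : R := fine (nu `]y, +oo[%classic).
Definition atom (y : R) : R := fine (nu [set y]).
Definition randomized_tail (y v : R) : R := (upper_tail y + v * atom y)%R.

Lemma upper_tailE y : (upper_tail y)%:E = nu `]y, +oo[%classic.
Proof. by rewrite fineK// fin_num_measure. Qed.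

Lemma atomE y : (atom y)%:E = nu [set y].
Proof. by rewrite fineK// fin_num_measure. Qed.

Lemma atom_ge0 y : (0 <= atom y)%R.
Proof. by rewrite fine_ge0. Qed.

Lemma closed_tailE y : (upper_tail y + atom y)%R%:E = nu `[y, +oo[%classic.
Proof.
rewrite EFinD upper_tailE atomE addeC -measureU//; first by rewrite setU1itv.
by apply/seteqP; split => // z /= [->]; rewrite in_itv/= ltxx.
Qed.

Lemma closed_tail_le (x y : R) : (x < y)%R -> (upper_tail y + atom y <= upper_tail x)%R.
Proof.
move=> xy; rewrite -lee_fin closed_tailE upper_tailE le_measure ?inE//.
by move=> z /=; rewrite !in_itv/= !andbT; exact: lt_le_trans.
Qed.

Lemma upper_tail_nonincreasing : nonincreasing_fun upper_tail.
Proof.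
move=> x y xy; rewrite -lee_fin !upper_tailE le_measure ?inE//.
by move=> z /=; rewrite !in_itv/= !andbT; exact: le_lt_trans.
Qed.

Lemma measurable_upper_tail : measurable_fun setT upper_tail.
Proof. exact: nonincreasing_measurable upper_tail_nonincreasing. Qed.

Lemma measurable_atom : measurable_fun setT atom.
Proof.
have -> : atom = (fun y => (upper_tail y + atom y) - upper_tail y)%R.
  by apply/funext => y; rewrite addrC addKr.
apply: measurable_funB; last exact: measurable_upper_tail.
apply: nonincreasing_measurable => // x y; rewrite le_eqVlt => /orP[/eqP ->//|xy].
by apply: (le_trans (closed_tail_le xy)); rewrite lerDl atom_ge0.
Qed.

Lemma measurable_randomized_tail :
  measurable_fun setT (fun z : R * R => randomized_tail z.1 z.2).
Proof.
apply: measurable_funD; first by apply: (measurableT_comp measurable_upper_tail).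
apply: measurable_funM => //; exact: (measurableT_comp measurable_atom).
Qed.

Let idR : R -> R := idfun.

Let X : {mfun R >-> R} :=
  HB.pack idR (isMeasurableFun.Build _ _ _ _ idR (@measurable_id _ R setT)).

Let ccdfE y : ccdf (X : {RV nu >-> R}) y = (upper_tail y)%:E.
Proof. by rewrite upper_tailE. Qed.

(** Continuity from above of the measure along open half-lines decreasing to
    the closed one. *)
Lemma left_limit_tail (a u : R) : (forall y, (y < a)%R -> (u <= upper_tail y)%R) ->
  (u <= upper_tail a + atom a)%R.
Proof.
move=> H; rewrite -lee_fin closed_tailE.
pose F (n : nat) : set R := `](a - n.+1%:R^-1)%R, +oo[%classic.
have FE : \bigcap_n F n = `[a, +oo[%classic.
  apply/seteqP; split => y; rewrite /F /= in_itv/= andbT.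
    move=> h; rewrite leNgt; apply/negP => ya.
    have ay0 : (0 < a - y)%R by rewrite subr_gt0.
    have [n hn] : exists n : nat, (n.+1%:R^-1 < a - y)%R.
      exists (Num.truncn (a - y)^-1); rewrite invf_plt ?posrE//.
      exact: truncnS_gt.
    by have := h n I; rewrite /= in_itv/= andbT ltNge; apply/negP; rewrite negbK lerBrDr -lerBrDl ltW.
  move=> ay n _; rewrite /= in_itv/= andbT; apply: lt_le_trans ay.
  by rewrite ltrBlDr ltrDl invr_gt0.
have cv : nu \o F @ \oo --> nu (\bigcap_n F n).
  apply: nonincreasing_cvg_mu.
  - by rewrite -ge0_fin_numE// fin_num_measure//; exact: measurable_itv.
  - by move=> n; exact: measurable_itv.
  - by rewrite FE.
  - move=> m n mn; apply/subsetPset => y; rewrite /F /= !in_itv/= !andbT.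
    by apply: le_lt_trans; rewrite lerB// lef_pV2 ?posrE// ler_nat.
rewrite -FE -(cvg_lim _ cv)//; apply: lime_ge; first by apply/cvg_ex; exists (nu (\bigcap_n F n)).
apply: nearW => n /=; rewrite /F -upper_tailE lee_fin; apply: H.
by rewrite ltrBlDr ltrDl invr_gt0.
Qed.

(** The quantile is the infimum of the points whose upper tail is at most [u];
    right continuity keeps it in the set, and the left limit gives the second
    bound. *)
Lemma tail_quantile (u : R) : (0 < u < 1)%R -> exists a,
  [/\ (upper_tail a <= u)%R, (u <= upper_tail a + atom a)%R &
      forall y, (y < a)%R -> (u < upper_tail y)%R].
Proof.
move=> /andP[u0 u1].
pose A : set R := [set y | upper_tail y <= u]%R.
have [y1 Ay1] : A !=set0.
  have /fine_cvgP[_ /cvgrPdist_le /(_ u u0)] := cvg_ccdfy0 (X : {RV nu >-> R}).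
  move=> [M [_ HM]]; exists (M + 1)%R.
  have := HM (M + 1)%R; rewrite ltrDl ltr01 /= => /(_ isT).
  rewrite sub0r normrN ccdfE/= => h; exact: le_trans (ler_norm _) h.
have [y2 Hy2] : exists y, (u < upper_tail y)%R.
  have u1' : (0 < 1 - u)%R by rewrite subr_gt0.
  have /fine_cvgP[_ /cvgrPdist_lt /(_ _ u1')] := cvg_ccdfNy1 (X : {RV nu >-> R}).
  move=> [M [_ HM]]; exists (M - 1)%R.
  have := HM (M - 1)%R; rewrite ltrBlDr ltrDl ltr01 /= => /(_ isT).
  rewrite ccdfE/= => h; have := le_lt_trans (ler_norm _) h; lra.
have lbA : lbound A y2.
  move=> y Ay; rewrite leNgt; apply/negP => yy2.
  have := upper_tail_nonincreasing (ltW yy2); rewrite leNgt => /negP; apply.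
  exact: le_lt_trans Ay Hy2.
have infA : has_inf A by split; [exists y1|exists y2].
pose a := inf A.
have below y : (y < a)%R -> (u < upper_tail y)%R.
  move=> ya; rewrite ltNge; apply/negP => Ay.
  have : (a <= y)%R by apply: ge_inf => //; exists y2.
  by rewrite leNgt ya.
have Aa : (upper_tail a <= u)%R.
  have cv := @ccdf_right_continuous _ _ _ nu X a.
  rewrite -lee_fin -ccdfE -(cvg_lim _ cv)//.
  apply: lime_le; first by apply/cvg_ex; exists (ccdf (X : {RV nu >-> R}) a).
  near=> y; rewrite ccdfE lee_fin.
  have ay : (a < y)%R by near: y; exact: nbhs_right_gt.
  have [z Az zy] := inf_lt infA.1 ay.
  exact: le_trans (upper_tail_nonincreasing (ltW zy)) Az.
by exists a; split => //; apply: left_limit_tail => y /below /ltW.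
Unshelve. all: by end_near.
Qed.

Let measurable_tail_le y (u : R) : measurable [set v | randomized_tail y v <= u]%R.
Proof.
have -> : [set v | randomized_tail y v <= u]%R = setT `&` (randomized_tail y) @^-1` `]-oo, u].
  by rewrite setTI; apply/seteqP; split => v /=; rewrite in_itv.
by apply: measurable_funD => //; exact: measurable_funM.
Qed.

(** Randomization at the atoms makes the tail probability exactly uniform: the
    quantile [a] splits the line, and the randomization at [a] fills the gap. *)
Lemma randomized_tail_uniform (u : R) : (0 < u < 1)%R ->
  \int[nu]_y unif01 [set v | randomized_tail y v <= u]%R = u%:E.
Proof.
move=> u01; have /andP[u0 u1] := u01.
have [a [Ga Ha below]] := tail_quantile u01.
have qa : unif01 [set v | randomized_tail a v <= u]%R * nu [set a] =
    (u - upper_tail a)%:E.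
  have := atom_ge0 a; rewrite le_eqVlt => /orP[/eqP m0|m0].
    rewrite -atomE -m0 mule0; congr EFin; apply/esym/eqP.
    by rewrite subr_eq0 eq_le Ga andbT; move: Ha; rewrite -m0 addr0.
  have -> : [set v | randomized_tail a v <= u]%R = [set v | v <= (u - upper_tail a) / atom a]%R.
    by apply/seteqP; split => v /=; rewrite /randomized_tail ler_pdivlMr// lerBrDl.
  rewrite unif01_le; first by rewrite -atomE -EFinM divfK// gt_eqF.
  by rewrite divr_ge0 ?subr_ge0 ?(ltW m0)//= ler_pdivrMr// mul1r lerBlDl.
transitivity (\int[nu]_y ((\1_(`]a, +oo[%classic) y)%:E +
    unif01 [set v | randomized_tail a v <= u]%R * (\1_[set a] y)%:E)).
  apply: eq_integral => y _; rewrite !indicE in_set1.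
  have [->|ya] := eqVneq y a.
    by rewrite memNset/= ?in_itv/= ?ltxx// add0e mule1.
  rewrite /= mule0 adde0; have [ay|ya'] := ltP a y.
    rewrite mem_set/= ?in_itv/= ?ay//; apply/eqP; rewrite eq_le probability_le1//=; last exact: measurable_tail_le.
    rewrite -unif01_range; apply: le_measure; rewrite ?inE.
    - exact: measurable_unit.
    - exact: measurable_tail_le.
    move=> v /= /andP[_ v1]; apply: le_trans Ga; apply: le_trans (closed_tail_le ay).
    by rewrite lerD2l -[leRHS]mul1r ler_wpM2r// atom_ge0.
  rewrite memNset/=; last by rewrite in_itv/= andbT => /lt_geF; rewrite ya'.
  apply: unif01_null => // v /= h; apply/negP => /andP[v0 _].
  have ya2 : (y < a)%R by rewrite lt_neqAle ya.
  have := lt_le_trans (below y ya2) (le_trans _ h); rewrite ltxx => H.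
  by apply/notF/H; rewrite lerDl mulr_ge0// atom_ge0.
rewrite ge0_integralD//; last 2 first.
- by move=> y _; rewrite mule_ge0// lee_fin.
- by apply: measurable_funeM; apply/measurable_EFinP.
rewrite integral_indicT// ge0_integralZl//; first last.
- exact/measurable_EFinP.
rewrite integral_indicT// qa -[X in X + _](upper_tailE a) -EFinD.
  by congr EFin; rewrite addrC subrK.
by apply/measurable_EFinP; apply: measurable_indic; exact: measurable_itv.
Qed.

End RandomizedTail.

Section PvalueLaw.
Context {R : realType}.
Local Open Scope ereal_scope.

Definition randomized (nu : probability R R) : probability (R * R)%type R :=
  nu \x unif01.

Section RandomizedTailProduct.
Variable nu : probability R R.
Local Notation joint := (randomized nu).
Local Notation T := (fun z : R * R => randomized_tail nu z.1 z.2).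

Let measurable_T_itv (I : interval R) : measurable (T @^-1` [set` I]).
Proof.
rewrite -[X in measurable X]setTI; exact: measurable_randomized_tail.
Qed.

Lemma joint_tail_le (u : R) : (0 < u < 1)%R -> joint (T @^-1` `]-oo, u]) = u%:E.
Proof.
move=> u01; rewrite -[RHS](randomized_tail_uniform nu u01) /randomized/= /product_measure1/=.
apply: eq_integral => y _ /=; congr (unif01 _).
by apply/seteqP; split => v; rewrite /xsection/= inE/= in_itv.
Qed.

(** Left continuity at [u] of the uniform distribution function excludes an
    atom of the randomized tail. *)
Lemma joint_tail_lt (u : R) : (0 < u < 1)%R -> joint (T @^-1` `]-oo, u[) = u%:E.
Proof.
move=> /andP[u0 u1]; apply/eqP; rewrite eq_le; apply/andP; split.
  apply: (@le_trans _ _ (joint (T @^-1` `]-oo, u]))); last by rewrite joint_tail_le// u0.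
  apply: (le_measure joint); rewrite ?inE; [exact: measurable_T_itv|exact: measurable_T_itv|].
  by move=> z /=; rewrite !in_itv/=; exact: ltW.
apply/lee_addgt0Pr => e e0.
pose w := Num.max (u - e)%R (u / 2)%R.
have w0 : (0 < w)%R by rewrite lt_max divr_gt0 ?orbT.
have wu : (w < u)%R by rewrite gt_max; apply/andP; split; lra.
have -> : u%:E = (u - e)%:E + e%:E by rewrite -EFinD subrK.
rewrite leeD2r//; apply: (@le_trans _ _ w%:E); first by rewrite lee_fin le_max lexx.
apply: (@le_trans _ _ (joint (T @^-1` `]-oo, w]))).
  by rewrite joint_tail_le// w0 (lt_trans wu).
apply: (le_measure joint); rewrite ?inE; [exact: measurable_T_itv|exact: measurable_T_itv|].
by move=> z /=; rewrite !in_itv/= => h; exact: le_lt_trans wu.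
Qed.

Let p (z : R * R) : R := (2 * Num.min (T z) (1 - T z))%R.

Lemma joint_pvalue_le (t : R) : (0 < t < 1)%R -> joint (p @^-1` `]-oo, t]) = t%:E.
Proof.
move=> /andP[t0 t1].
have t2 : (0 < t / 2 < 1)%R by apply/andP; split; lra.
have t2' : (0 < 1 - t / 2 < 1)%R by apply/andP; split; lra.
have -> : p @^-1` `]-oo, t] = (T @^-1` `]-oo, (t / 2)%R]) `|` ~` (T @^-1` `]-oo, (1 - t / 2)%R[).
  apply/seteqP; split => z; rewrite /p /= !in_itv/= minr_pMr//.
    rewrite ge_min => /orP[h|h]; [left|right; apply/negP; rewrite -leNgt]; lra.
  rewrite ge_min => -[h|/negP]; first by apply/orP; left; lra.
  by rewrite -leNgt => h; apply/orP; right; lra.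
have mB : measurable (T @^-1` `]-oo, (1 - t / 2)%R[) by exact: measurable_T_itv.
have -> : joint ((T @^-1` `]-oo, (t / 2)%R]) `|` ~` (T @^-1` `]-oo, (1 - t / 2)%R[)) =
    joint (T @^-1` `]-oo, (t / 2)%R]) + joint (~` (T @^-1` `]-oo, (1 - t / 2)%R[)).
  apply: measureU => //; first exact: measurableC.
  apply/seteqP; split => // z /= [] /=; rewrite !in_itv/= => h /negP; rewrite -leNgt => h'.
  by move: t1; rewrite ltNge => /negP; apply; lra.
rewrite joint_tail_le// (probability_setC joint mB) joint_tail_lt//.
by rewrite -EFinB -EFinD; congr EFin; lra.
Qed.

Lemma joint_pvalue_le0 : joint (p @^-1` `]-oo, 0%R]) = 0.
Proof.
have mp (t : R) : measurable (p @^-1` `]-oo, t]).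
  rewrite -[X in measurable X]setTI.
  have : measurable_fun setT p; last by apply.
  have mT := measurable_randomized_tail nu.
  by apply: measurable_funM => //; apply: measurable_minr => //; exact: measurable_funB.
apply/eqP; rewrite eq_le measure_ge0 andbT; apply/lee_addgt0Pr => e e0; rewrite add0e.
pose w := Num.min e (2^-1 : R)%R.
have w0 : (0 < w)%R by rewrite lt_min e0 invr_gt0 ltr0n.
have w1 : (w < 1)%R by rewrite gt_min invf_lt1// ltr1n orbT.
apply: (@le_trans _ _ w%:E); last by rewrite lee_fin ge_min lexx.
apply: (@le_trans _ _ (joint (p @^-1` `]-oo, w]))); last by rewrite joint_pvalue_le// w0.
apply: (le_measure joint); rewrite ?inE//.
by move=> z /=; rewrite !in_itv/= => h; rewrite (le_trans h)// ltW.
Qed.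

End RandomizedTailProduct.

Variable F0 : probability R R.

Definition pval (z : nat * (R * R)) : R := pvalue F0 z.1 z.2.1 z.2.2.

Lemma pvalE k y v : pval (k, (y, v)) =
  (2 * Num.min (randomized_tail (conv_pow F0 k) y v)
     (1 - randomized_tail (conv_pow F0 k) y v))%R.
Proof. by []. Qed.

Lemma measurable_pval : measurable_fun setT pval.
Proof.
apply: measurable_fun_size => k.
have mT := measurable_randomized_tail (conv_pow F0 k).
by apply: measurable_funM => //; apply: measurable_minr => //; exact: measurable_funB.
Qed.

(** For events, the two inner integrals combine into one law on the plane, the
    form in which the law of the p-value is known. *)
Lemma size_lawE Q F A : measurable A ->
  size_law Q F A = \int[Q]_k randomized (conv_pow F k) [set z | A (k, z)].
Proof.
move=> mA; rewrite -(integral_indicT (size_law Q F) mA) integral_size_law; last 2 first.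
- by apply/measurable_EFinP; exact: measurable_indic.
- by move=> z; rewrite lee_fin.
apply: eq_integral => k _; rewrite /randomized/= /product_measure1/=.
apply: eq_integral => y _ /=.
have mAy : measurable [set v | A (k, (y, v))].
  have -> : [set v | A (k, (y, v))] = setT `&` (fun v => (k, (y, v))) @^-1` A by rewrite setTI.
  by apply: measurable_fun_pair => //; exact: measurable_fun_pair.
transitivity (\int[unif01]_v (\1_[set v | A (k, (y, v))] v)%:E).
  by apply: eq_integral => v _; rewrite !indicE; congr ((nat_of_bool _)%:R)%:E; apply/idP/idP; rewrite !inE.
rewrite integral_indicT//; congr (unif01 _).
by apply/seteqP; split => v; rewrite /xsection/= inE.
Qed.

Lemma measurable_small_pval k (t : R) : measurable [set z | (k <= z.1)%N /\ (pval z <= t)%R].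
Proof.
have -> : [set z : nat * (R * R) | (k <= z.1)%N /\ (pval z <= t)%R] =
    (setT `&` (fst : nat * (R * R) -> nat) @^-1` [set j | (k <= j)%N]) `&`
    (setT `&` pval @^-1` `]-oo, t]).
  by apply/seteqP; split => z /=; rewrite in_itv/= => -[? ?]; split; tauto.
apply: measurableI; last exact: measurable_pval.
exact: measurable_fst.
Qed.

(** Under the null hypothesis the p-value is uniform given the size. *)
Lemma null_pval_law Q k (t : R) : (0 < t < 1)%R ->
  size_law Q F0 [set z | (k <= z.1)%N /\ (pval z <= t)%R] =
  Q [set j | (k <= j)%N] * t%:E.
Proof.
move=> t01; rewrite size_lawE; last exact: measurable_small_pval.
transitivity (\int[Q]_j ((\1_[set j | (k <= j)%N] j)%:E * t%:E)).
  apply: eq_integral => j _; rewrite indicE/=; case: (boolP (k <= j)%N) => kj.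
    rewrite mem_set// mul1e -(joint_pvalue_le (conv_pow F0 j) t01); congr (randomized _ _).
    by apply/seteqP; split => z /=; rewrite in_itv/= => // -[].
  rewrite memNset/= ?mul0e; last by move/negP: kj.
  by rewrite (_ : [set _ | _] = set0) ?measure0//; apply/seteqP; split => z //= [].
rewrite ge0_integralZr//; last by case/andP: t01 => t0 _; rewrite lee_fin ltW.
by rewrite integral_indicT.
Qed.

Lemma null_pval_le0 Q : size_law Q F0 [set z | (pval z <= 0)%R] = 0.
Proof.
have -> : [set z | (pval z <= 0)%R] = [set z | (0 <= z.1)%N /\ (pval z <= 0)%R].
  by apply/seteqP; split => z /=; [|move=> []].
rewrite size_lawE; last exact: measurable_small_pval.
transitivity (\int[Q]_j (cst 0 j : \bar R)); last by rewrite integral_cst// mul0e.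
apply: eq_integral => j _; rewrite -(joint_pvalue_le0 (conv_pow F0 j)).
congr (randomized _ _).
by apply/seteqP; split => z /=; rewrite in_itv/= => // -[].
Qed.

Lemma conv_pow_shift (t : R) k : natural_space F0 t ->
  \int[conv_pow F0 k]_x (expR (t * x - k%:R * psi F0 t))%:E = 1.
Proof.
by move=> Tt; rewrite conv_pow_mgf natural_space_shift// subrr expR0 -EFin_expe expr1n.
Qed.

(** Exponential Markov inequality, for either tail according to the sign of
    the tilt. *)
Lemma conv_pow_tail (t y : R) k (A : set R) : measurable A -> natural_space F0 t ->
  (forall x, A x -> 0 <= t * (x - y))%R ->
  conv_pow F0 k A <= (expR (k%:R * psi F0 t - t * y))%:E.
Proof.
move=> mA Tt H; rewrite -integral_indicT// -[leRHS]mule1 -(conv_pow_shift k Tt).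
rewrite -ge0_integralZl//; last by apply/measurable_EFinP; exact: measurable_expR_affine.
apply: ge0_le_integral => //.
- exact/measurable_EFinP.
- by apply: measurable_funeM; apply/measurable_EFinP; exact: measurable_expR_affine.
move=> x _; rewrite -EFinM -expRD lee_fin indicE.
have -> : (k%:R * psi F0 t - t * y + (t * x - k%:R * psi F0 t) = t * (x - y))%R by ring.
case: (boolP (x \in A)) => [|_]; last exact: expR_ge0.
by rewrite inE -[leLHS]expR0 ler_expR; exact: H.
Qed.

(** Near [k * nu] the p-value is exponentially small, at a rate close to the
    one given by the tilt [t]. *)
Lemma pval_window (t nu eta y v : R) k : natural_space F0 t -> (0 <= v <= 1)%R ->
  window (k%:R * nu) (k%:R * eta) y ->
  (pval (k, (y, v)) <= 2 * expR (- (k%:R * (t * nu - psi F0 t - `|t| * eta))))%R.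
Proof.
move=> Tt /andP[v0 v1] /windowP yw; rewrite pvalE ler_pM2l//.
set nk := conv_pow F0 k.
have bd : (k%:R * psi F0 t - t * y <= - (k%:R * (t * nu - psi F0 t - `|t| * eta)))%R.
  have : (- (t * (y - k%:R * nu)) <= `|t| * (k%:R * eta))%R.
    by rewrite (le_trans (ler_norm _))// normrN normrM ler_wpM2l.
  by rewrite !mulrBr; lra.
rewrite ge_min; have [t0|t0] := leP 0%R t; apply/orP; [left|right].
  apply: (@le_trans _ _ (upper_tail nk y + atom nk y)%R).
    by rewrite lerD2l -[leRHS]mul1r ler_wpM2r// atom_ge0.
  rewrite -lee_fin closed_tailE; apply: (@le_trans _ _ (expR (k%:R * psi F0 t - t * y))%:E).
    apply: conv_pow_tail => // x /=; rewrite in_itv/= andbT => yx.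
    by rewrite mulr_ge0// subr_ge0.
  by rewrite lee_fin ler_expR.
apply: (@le_trans _ _ (1 - upper_tail nk y)%R).
  by rewrite lerD2l lerN2 lerDl mulr_ge0// atom_ge0.
have -> : (1 - upper_tail nk y)%R = fine (nk `]-oo, y]%classic).
  apply: EFin_inj; rewrite EFinB upper_tailE fineK ?fin_num_measure//.
  by rewrite -(setCitvr (BRight y)) probability_setC.
rewrite -lee_fin fineK ?fin_num_measure//.
apply: (@le_trans _ _ (expR (k%:R * psi F0 t - t * y))%:E); last by rewrite lee_fin ler_expR.
apply: conv_pow_tail => // x /=; rewrite in_itv/= => xy.
by rewrite mulr_le0 ?(ltW t0)// subr_le0.
Qed.

End PvalueLaw.

(** * Higher criticism and counts of small p-values *)

Section OrderStatistics.
Context {R : realType} {n : nat}.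
Variables (K : 'I_n -> nat) (p : 'I_n -> R).

Definition count_below (k : nat) (x : R) : nat :=
  #|[set i | (k <= K i)%N && (p i <= x)]%SET|.

Lemma size_sorted_pvalues k : size (sorted_pvalues K p k) = n_above K k.
Proof.
rewrite size_sort size_map size_filter /n_above -sum1_count big_enum_cond/=.
by rewrite -sum1_card; apply: eq_bigl => i; rewrite inE.
Qed.

Lemma count_sorted_pvalues k x : count (<= x) (sorted_pvalues K p k) = count_below k x.
Proof.
rewrite (permP (permEl (perm_sort _ _))) count_map count_filter.
rewrite -sum1_count big_enum_cond/= /count_below -sum1_card.
by apply: eq_bigl => i; rewrite inE/= andbC.
Qed.

(** This turns statements on sorted p-values into statements on counts, to
    which the bounds for sums of independent terms apply. *)
Lemma order_statistic_le k i x : (i < n_above K k)%N ->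
  (nth 0 (sorted_pvalues K p k) i <= x) = (i < count_below k x)%N.
Proof.
move=> ik; rewrite -count_sorted_pvalues.
have ss : sorted <=%O (sorted_pvalues K p k) by exact: sort_le_sorted.
apply/idP/idP => [h|]; last exact: nth_count_le.
rewrite ltnNge; apply/negP => ci.
have := @nth_count_gt _ _ x 0 _ i ss; rewrite ci size_sorted_pvalues ik => /(_ isT).
by rewrite ltNge h.
Qed.

Lemma count_below_le k x : (count_below k x <= n_above K k)%N.
Proof.
apply: subset_leq_card; apply/fintype.subsetP => i; rewrite !inE.
by case/andP.
Qed.

Lemma n_above_le k : (n_above K k <= n)%N.
Proof. by rewrite -[leqRHS]card_ord max_card. Qed.

Lemma n_above_max k : (0 < n_above K k)%N -> (k <= \max_(i < n) K i)%N.
Proof.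
by rewrite card_gt0 => /set0Pn[i]; rewrite inE => /leq_trans; apply; exact: leq_bigmax.
Qed.

Lemma hc_term_le_HC k i : (1 <= i <= (n_above K k)./2)%N -> hc_term K p k i <= HC K p k.
Proof. by move=> ik; apply: le_bigmax_seq => //; rewrite mem_index_iota ltnS. Qed.

Lemma HC_le_HC_thres k : (1 <= k)%N -> (2 <= n_above K k)%N -> HC K p k <= HC_thres K p.
Proof.
move=> k1 nk; apply: le_bigmax_seq => //; rewrite mem_index_iota k1 ltnS.
by apply: n_above_max; exact: leq_trans nk.
Qed.

Lemma bigmax_exceeded (I : eqType) (r : seq I) (P : pred I) (f : I -> R) (x0 c : R) :
  c <= \big[Num.max/x0]_(i <- r | P i) f i ->
  c <= x0 \/ exists2 i, (i \in r) && P i & c <= f i.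
Proof.
rewrite big_seq_cond; elim/big_rec: _ => [|i x rP IH]; first by left.
by rewrite le_max => /orP[h|/IH//]; right; exists i.
Qed.

(** The initial values of the two maxima are themselves terms of the
    statistic, because all sizes are positive. *)
Lemma hc_term_of_HC_thres (c : R) : (2 <= n)%N -> (forall i, 0 < K i)%N ->
  c <= HC_thres K p -> exists k i, [/\ (1 <= k)%N, (1 <= i <= (n_above K k)./2)%N &
  c <= hc_term K p k i].
Proof.
move=> n2 K0 cT.
have n1 : n_above K 1 = n.
  rewrite /n_above -[RHS]card_ord; apply: eq_card => i.
  by rewrite !inE K0.
have [k [k1 nk ck]] : exists k, [/\ (1 <= k)%N, (2 <= n_above K k)%N & c <= HC K p k].
  case: (bigmax_exceeded cT) => [h|[k /andP[kr nk] h]].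
    by exists 1; rewrite n1.
  by exists k; split => //; move: kr; rewrite mem_index_iota => /andP[].
have nk2 : (1 <= (n_above K k)./2)%N by rewrite half_gt0.
exists k; case: (bigmax_exceeded ck) => [h|[i /andP[ir _] h]].
  by exists 1; rewrite nk2.
by exists i; split => //; move: ir; rewrite mem_index_iota ltnS.
Qed.

(** If [q] is the [i]-th p-value and [x ^+ 2 = m * q], with [m] the number of
    large sizes, a large term gives [x ^+ 2 + b * x <= i]: the hypothesis on
    [tau] is what this quadratic constraint implies for the p-value. The
    factor [sqrt 2] accounts for [1 - q >= 1 / 2] in the denominator. *)
Lemma count_of_hc_term (k i : nat) (b tau : R) : 0 < b ->
  (1 <= i <= (n_above K k)./2)%N -> Num.sqrt 2 * b <= hc_term K p k i ->
  (forall x, 0 <= x -> x ^+ 2 + b * x <= i%:R -> x ^+ 2 <= tau) ->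
  (i <= count_below k (tau / (n_above K k)%:R))%N.
Proof.
move=> b0 /andP[i1 i2] big tauP.
have i2' : (i.*2 <= n_above K k)%N by rewrite (leq_trans (_ : _ <= (n_above K k)./2.*2)%N) ?leq_double// -[leqRHS]odd_double_half leq_addl.
have in' : (i.-1 < n_above K k)%N.
  by rewrite prednK//; apply: leq_trans i2'; rewrite -addnn leq_addr.
move: big; rewrite /hc_term; set q := nth _ _ _; set m := (n_above K k)%:R.
have m0 : 0 < m by rewrite ltr0n; exact: leq_ltn_trans in'.
have im : i%:R * 2 <= m :> R by rewrite -natrM ler_nat muln2.
have c0 : 0 < Num.sqrt 2 * b by rewrite mulr_gt0// sqrtr_gt0.
set D := m * q * (1 - q) => big.
have D0 : 0 < Num.sqrt D.
  rewrite lt_neqAle sqrtr_ge0 andbT; apply/eqP => E; move: big.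
  by rewrite -E invr0 mulr0 leNgt c0.
have num0 : Num.sqrt 2 * b * Num.sqrt D <= i%:R - m * q by rewrite -ler_pdivlMr.
have q2 : q <= 2^-1.
  rewrite leNgt; apply/negP => q2.
  have : 0 < i%:R - m * q by apply: lt_le_trans num0; rewrite mulr_gt0.
  by rewrite subr_gt0 ltNge => /negP; apply; nra.
have q0 : 0 < q.
  rewrite ltNge; apply/negP => q0; move: D0.
  rewrite (_ : Num.sqrt D = 0) ?ltxx//; apply/eqP; rewrite sqrtr_eq0.
  by rewrite /D -mulrA pmulr_rle0// mulr_le0_ge0//; lra.
pose x := Num.sqrt (m * q).
have mq0 : 0 <= m * q by rewrite mulr_ge0// ltW.
have xE : x ^+ 2 = m * q by rewrite sqr_sqrtr.
have : x ^+ 2 <= tau.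
  apply: tauP; first exact: sqrtr_ge0.
  rewrite xE -lerBrDl; apply: le_trans num0.
  rewrite [Num.sqrt 2 * b]mulrC -mulrA ler_pM2l// -sqrtrM// ler_wsqrtr//.
  by rewrite /D; nra.
rewrite xE mulrC -ler_pdivlMr// => qt.
by have := order_statistic_le (tau / m) in'; rewrite -/q qt => /esym; rewrite prednK.
Qed.

(** Conversely an excess of small p-values makes the statistic large: if fewer
    than half of the p-values are small, look at the last small one, otherwise
    at the median. *)
Lemma HC_of_count (k : nat) (t z : R) : (forall i, 0 < p i) -> 0 < t -> t <= 4^-1 ->
  2 <= z -> z + (n_above K k)%:R * t <= (count_below k t)%:R ->
  z / (12 * Num.sqrt ((n_above K k)%:R * t)) <= HC K p k.
Proof.
move=> p0 t0 t4 z2 big; set m := n_above K k in big *; set N := count_below k t in big.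
have Nm : (N <= m)%N by exact: count_below_le.
have NmR : N%:R <= m%:R :> R by rewrite ler_nat.
have mt0 : 0 <= m%:R * t by rewrite mulr_ge0// ltW.
have zN : z <= N%:R by lra.
have N2 : (2 <= N)%N by rewrite -(ler_nat R); lra.
have m2 : (2 <= m)%N by exact: leq_trans Nm.
have mR0 : 0 < m%:R :> R by rewrite ltr0n; exact: ltn_trans m2.
have s0 : 0 < Num.sqrt (m%:R * t) by rewrite sqrtr_gt0 mulr_gt0.
(* In the first case the excess is [N - m * t >= z]. In the second, the median
   rank is at least [m / 3] and [t <= 1 / 4], so the excess is at least
   [m / 12 >= z / 12]: this is where the constant comes from. *)
pose i := minn N m./2.
have i1 : (1 <= i)%N by rewrite leq_min (ltn_trans _ N2)//= half_gt0.
have im2 : (i <= m./2)%N by exact: geq_minr.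
have im : (i.-1 < m)%N.
  by rewrite prednK//; apply: (leq_trans im2); rewrite -[leqRHS]odd_double_half -addnn addnA leq_addl.
apply: (le_trans _ (hc_term_le_HC (k := k) (i := i) _)); last by rewrite i1.
rewrite /hc_term -/m; set q := nth _ _ _.
have qt : q <= t by rewrite order_statistic_le// prednK// geq_minl.
have q0 : 0 < q.
  have : q \in sorted_pvalues K p k by rewrite mem_nth// size_sorted_pvalues.
  by rewrite mem_sort => /mapP[j _ ->].
have q1 : 0 < 1 - q by lra.
have sq0 : 0 < Num.sqrt (m%:R * q * (1 - q)) by rewrite sqrtr_gt0 !mulr_gt0.
have sq : Num.sqrt (m%:R * q * (1 - q)) <= Num.sqrt (m%:R * t).
  apply: ler_wsqrtr; rewrite -mulrA ler_pM2l//; nra.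
have mq : m%:R * q <= m%:R * t by rewrite ler_pM2l.
have num : z / 12 <= i%:R - m%:R * q.
  rewrite /i; have [Nm2|mN2] := leqP N m./2; first by lra.
  have h : m%:R <= 3 * (m./2)%:R :> R.
    rewrite -natrM ler_nat -[leqLHS]odd_double_half -muln2.
    have : (1 <= m./2)%N by rewrite half_gt0.
    by move=> h; rewrite mulSn leq_add ?(leq_trans (leq_b1 _))// mulnC.
  have mt4 : m%:R * t <= m%:R * 4^-1 by rewrite ler_pM2l.
  by move: h mt4 mq zN NmR; move: (m./2)%:R => h'; lra.
rewrite invfM mulrA ler_pM//.
- by rewrite divr_ge0//; lra.
- by rewrite lef_pV2 ?posrE.
Qed.

End OrderStatistics.

Section HCMeasurable.
Context {R : realType} {d : measure_display} {Omega : measurableType d} {n : nat}.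
Variables (K : 'I_n -> Omega -> nat) (p : 'I_n -> Omega -> R).
Hypotheses (mK : forall i, measurable_fun setT (K i))
  (mp : forall i, measurable_fun setT (p i)).

Lemma measurable_inv_sqrt : measurable_fun setT (fun x : R => (Num.sqrt x)^-1).
Proof.
have -> : (fun x : R => (Num.sqrt x)^-1) = (fun x => Num.sqrt x `^ (-1)).
  by apply/funext => x; rewrite powR_inv1// sqrtr_ge0.
apply: (measurableT_comp (measurable_powR (-1))).
by apply: nondecreasing_measurable => // x y; exact: ler_wsqrtr.
Qed.

Lemma measurable_bigmaxr (I : Type) (r : seq I) (P : pred I) (f : I -> Omega -> R) g :
  measurable_fun setT g -> (forall i, measurable_fun setT (f i)) ->
  measurable_fun setT (fun w => \big[Num.max/g w]_(i <- r | P i) f i w).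
Proof.
move=> mg mf; elim: r => [|i r IH].
  by under eq_fun do rewrite big_nil.
under eq_fun do rewrite big_cons.
by case: (P i) => //; exact: measurable_maxr.
Qed.

Lemma measurable_count_below (k : 'I_n -> nat) j x :
  measurable_fun setT (fun w => (count_below k (fun i => p i w) j x)%:R : R).
Proof.
have mA i : measurable [set w | p i w <= x].
  have -> : [set w | p i w <= x] = setT `&` p i @^-1` `]-oo, x].
    by rewrite setTI; apply/seteqP; split => w /=; rewrite in_itv.
  exact: mp.
rewrite (_ : (fun w => _) = (fun w => \sum_(i < n)
    (if (j <= k i)%N then \1_[set w | p i w <= x] w else 0))).
  apply: measurable_sum => i; case: (j <= k i)%N => //.
  exact: measurable_indic.
apply/funext => w; rewrite /count_below -sum1_card big_mkcond/= natr_sum.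
apply: eq_bigr => i _; rewrite inE indicE; case: (j <= k i)%N => //=.
have -> : (w \in [set w | p i w <= x]) = (p i w <= x) by apply/idP/idP; rewrite inE.
by case: (p i w <= x).
Qed.

Lemma measurable_order_statistic (k : 'I_n -> nat) j i :
  measurable_fun setT (fun w => nth 0 (sorted_pvalues k (fun i => p i w) j) i).
Proof.
have [ik|ki] := ltnP i (n_above k j); last first.
  rewrite (_ : (fun w => _) = cst 0); first exact: measurable_cst.
  by apply/funext => w; rewrite nth_default// size_sorted_pvalues.
move=> _; apply: (measurability _ (RGenOInfty.measurableE R)) => //.
move=> /= _ [_ [x ->] <-]; rewrite setTI.
set f := fun w => _.
have -> : f @^-1` `]x, +oo[%classic =
    setT `&` (fun w => (count_below k (fun i => p i w) j x)%:R : R) @^-1` `]-oo, i%:R].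
  rewrite setTI; apply/seteqP; split => w /=; rewrite !in_itv/= andbT ler_nat ltNge /f order_statistic_le// -leqNgt //.
exact: measurable_count_below.
Qed.

Lemma measurable_HC_thres_fixed (k : 'I_n -> nat) :
  measurable_fun setT (fun w => HC_thres k (fun i => p i w)).
Proof.
have mterm j i : measurable_fun setT (fun w => hc_term k (fun i => p i w) j i).
  have mo := measurable_order_statistic k j i.-1.
  apply: measurable_funM.
    by apply: measurable_funB => //; exact: measurable_funM.
  apply: (measurableT_comp measurable_inv_sqrt); apply: measurable_funM.
    exact: measurable_funM.
  exact: measurable_funB.
have mHC j : measurable_fun setT (fun w => HC k (fun i => p i w) j).
  exact: measurable_bigmaxr.
exact: measurable_bigmaxr.
Qed.

(** The statistic is measurable for fixed sizes, by reduction to counts; the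
    ranges of the maxima depend on the sizes, which take countably many
    values. *)
Lemma measurable_HC_thres :
  measurable_fun setT (fun w => HC_thres (fun i => K i w) (fun i => p i w)).
Proof.
move=> _ B mB; rewrite setTI.
have -> : (fun w => HC_thres (fun i => K i w) (fun i => p i w)) @^-1` B =
    \bigcup_(k : {ffun 'I_n -> nat}) ([set w | forall i, K i w = k i] `&`
      (setT `&` (fun w => HC_thres k (fun i => p i w)) @^-1` B)).
  apply/seteqP; split => w /=.
    move=> Bw; exists [ffun i => K i w] => //=; split; first by move=> i; rewrite ffunE.
    have E : ([ffun i => K i w] : 'I_n -> nat) = (fun i => K i w).
      by apply/funext => i; rewrite ffunE.
    by split => //; rewrite E.
  by move=> [k _ [/= Kk [_]]]; rewrite (_ : (fun i => K i w) = k)//; apply/funext.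
apply: countable_bigcupT_measurable; first exact: countableP.
move=> k; apply: measurableI; last exact: measurable_HC_thres_fixed.
apply: measurable_forall_fin => i.
by rewrite -[X in measurable X]setTI; exact: (mK i measurableT (Y := [set k i])).
Qed.

End HCMeasurable.

(** * The statistic under the null hypothesis *)

Section SizeEvents.
Local Open Scope ereal_scope.
Context {R : realType}.
Variable F0 : probability R R.

Definition large_size (k : nat) : set (nat * (R * R)) := [set z | (k <= z.1)%N].

Definition small_pval (k : nat) (t : R) : set (nat * (R * R)) :=
  [set z | (k <= z.1)%N /\ (pval F0 z <= t)%R].

Lemma measurable_size_event (A : set nat) :
  measurable [set z : nat * (R * R) | A z.1].
Proof.
rewrite -[X in measurable X]setTI.
exact: (@measurable_fst _ _ nat (R * R)%type measurableT A).
Qed.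

Lemma measurable_large_size k : measurable (large_size k).
Proof. exact: (measurable_size_event [set j | (k <= j)%N]). Qed.

Lemma measurable_small_pval_set k t : measurable (small_pval k t).
Proof. exact: measurable_small_pval. Qed.

Lemma size_law_size (Q : probability nat R) (F : probability R R) (A : set nat) :
  size_law Q F [set z | A z.1] = Q A.
Proof.
rewrite size_lawE; last exact: measurable_size_event.
rewrite -integral_indicT//; apply: eq_integral => j _; rewrite indicE.
case: (boolP (j \in A)); rewrite ?inE ?notin_setE => Aj.
  rewrite -[RHS](@probability_setT _ _ _ (randomized (conv_pow F j))).
  by congr (randomized _ _); apply/seteqP; split.
rewrite -[RHS](measure0 (randomized (conv_pow F j))); congr (randomized _ _).
by apply/seteqP; split.
Qed.

Lemma size_law_large Q F k : size_law Q F (large_size k) = Q [set j | (k <= j)%N].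
Proof. exact: (size_law_size Q F [set j | (k <= j)%N]). Qed.

Lemma null_pval_le Q k (t : R) : (0 <= t)%R ->
  size_law Q F0 (small_pval k t) <= Q [set j | (k <= j)%N] * t%:E.
Proof.
move=> t0; have [t1|t1] := ltP t 1%R; last first.
  apply: (@le_trans _ _ (size_law Q F0 (large_size k))).
    apply: le_measure; rewrite ?inE; [exact: measurable_small_pval_set|exact: measurable_large_size|].
    by move=> z [].
  by rewrite size_law_large -[leLHS]mule1 lee_wpmul2l// lee_fin.
move: t0; rewrite le_eqVlt => /orP[/eqP <-|t0]; last by rewrite null_pval_law// t0.
rewrite mule0 -(null_pval_le0 F0 Q); apply: le_measure; rewrite ?inE.
- exact: measurable_small_pval_set.
- have -> : [set z | (pval F0 z <= 0)%R] = setT `&` pval F0 @^-1` `]-oo, 0%R].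
    by rewrite setTI; apply/seteqP; split => z /=; rewrite in_itv.
  exact: measurable_pval.
- by move=> z [].
Qed.

End SizeEvents.

Section Marginal.
Local Open Scope ereal_scope.
Context {R : realType}.
Variables (F0 F1 : probability R R) (Q : probability nat R) (e : R).
Hypotheses (e0 : (0 <= e)%R) (e1 : (0 <= 1 - e)%R).
Variables (n : nat) (d : measure_display) (Omega : measurableType d).
Variables (P : probability Omega R) (K : 'I_n -> {mfun Omega >-> nat})
  (Y V : 'I_n -> {mfun Omega >-> R}).
Hypothesis HS : mixture_sample F0 F1 Q e P K Y V.

Lemma mixture_sample_marginal i A : measurable A ->
  P [set w | A (obs K Y V i w)] = obs_law Q F0 F1 e0 e1 A.
Proof.
move=> mA.
have mE : measurable [set w | A (obs K Y V i w)].
  by rewrite -[X in measurable X]setTI; exact: measurable_obs.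
rewrite -integral_indicT//.
pose h j : nat * (R * R) -> R := if j == i then \1_A else cst 1%R.
transitivity (\int[P]_w (\prod_(j < n) h j (obs K Y V j w))%:E).
  apply: eq_integral => w _; rewrite (bigD1 i)//= big1 ?mulr1; last first.
    by move=> j ji; rewrite /h (negbTE ji).
  rewrite /h eqxx !indicE.
  have -> : (w \in [set w | A (obs K Y V i w)]) = (obs K Y V i w \in A).
    by apply/idP/idP; rewrite !inE.
  by [].
have fE : (fine (obs_law Q F0 F1 e0 e1 A))%:E = obs_law Q F0 F1 e0 e1 A.
  by rewrite fineK// fin_num_measure.
rewrite (mixture_sample_expectation HS (e0 := e0) (e1 := e1)
  (c := fun j => if j == i then fine (obs_law Q F0 F1 e0 e1 A) else 1%R)).
- by rewrite (bigD1 i)//= eqxx big1 ?mulr1// => j /negbTE ->.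
- by move=> j; rewrite /h; case: eqP => // _; exact: measurable_indic.
- by move=> j z; rewrite /h; case: eqP.
- move=> j; rewrite /h; case: eqP => _; last by rewrite integral_cst_probability.
  by rewrite fE integral_indicT.
Qed.

End Marginal.

Lemma markov_bound (R : realType) d (Omega : measurableType d)
    (P : probability Omega R) (Z : Omega -> R) (c B : R) :
  measurable_fun setT Z -> (forall w, 0 <= Z w) -> 0 < c ->
  (\int[P]_w (Z w)%:E <= B%:E)%E ->
  measurable [set w | c <= Z w] /\ (P [set w | (c <= Z w)%R] <= (B / c)%:E)%E.
Proof.
move=> mZ Z0 c0 IZ; have mE : measurable [set w | c <= Z w].
  have -> : [set w | c <= Z w] = setT `&` Z @^-1` `[c, +oo[.
    by rewrite setTI; apply/seteqP; split => w /=; rewrite in_itv/= andbT.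
  exact: mZ.
split => //; rewrite -(fineK (fin_num_measure P _ mE)) lee_fin ler_pdivlMr// -lee_fin.
apply: le_trans IZ; rewrite mulrC EFinM (fineK (fin_num_measure P _ mE)).
rewrite -(integral_indicT P mE) -ge0_integralZl//; last 2 first.
- by apply/measurable_EFinP; exact: measurable_indic.
- by rewrite lee_fin ltW.
apply: ge0_le_integral => //.
- by move=> w _; rewrite -EFinM lee_fin mulr_ge0// ltW.
- by apply: measurable_funeM; apply/measurable_EFinP; exact: measurable_indic.
- exact/measurable_EFinP.
move=> w _; rewrite -EFinM lee_fin indicE.
by case: (boolP (w \in _)); rewrite ?inE ?mulr1 ?mulr0.
Qed.

Lemma expR_ge_power (R : realType) (x : R) m : 0 <= x ->
  (1 + x / m%:R) ^+ m <= expR x.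
Proof.
case: m => [|m] x0; first by rewrite expr0 -[leLHS]expR0 ler_expR.
have -> : expR x = expR (x / m.+1%:R) ^+ m.+1.
  by rewrite -expRM_natl mulrCA divff ?mulr1// pnatr_eq0.
by rewrite lerXn2r ?nnegrE ?expR_ge0 ?addr_ge0 ?divr_ge0// expR_ge1Dx.
Qed.

Section NullCounts.
Local Open Scope ereal_scope.
Context {R : realType}.
Variables (F0 F1 : probability R R) (Q : probability nat R).
Variables (n : nat) (d : measure_display) (Omega : measurableType d).
Variables (P : probability Omega R) (K : 'I_n -> {mfun Omega >-> nat})
  (Y V : 'I_n -> {mfun Omega >-> R}).
Hypothesis HS : mixture_sample F0 F1 Q 0 P K Y V.

Local Notation obs := (obs K Y V).
Local Notation sizes w := (fun i => K i w).
Local Notation pvals w := (fun i => pval F0 (obs i w)).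

Lemma null_obs_law (z0 : (0 <= 0 :> R)%R) (z1 : (0 <= 1 - 0 :> R)%R) A :
  obs_law Q F0 F1 z0 z1 A = size_law Q F0 A.
Proof. by rewrite obs_lawE subr0 mul1e mul0e adde0. Qed.

Section Factors.
Variables (k : nat) (la tau : R).
Hypotheses (la0 : (0 <= la)%R) (tau0 : (0 <= tau)%R).

Let t (A : {set 'I_n}) : R := (tau / #|A|%:R)%R.

(** Exponential moment of the count on the event that exactly the sizes
    indexed by [A] are large, as a product with one factor per observation. *)
Let factor (A : {set 'I_n}) (i : 'I_n) (z : nat * (R * R)) : R :=
  if i \in A then (\1_(large_size k) z + (expR la - 1) * \1_(small_pval F0 k (t A)) z)%R
  else \1_(~` large_size k) z.

Let el : (0 <= expR la - 1)%R.
Proof. by rewrite subr_ge0 -[leLHS]expR0 ler_expR. Qed.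

Let factor_ge0 A i z : (0 <= factor A i z)%R.
Proof. by rewrite /factor; case: ifP => // _; rewrite addr_ge0// mulr_ge0. Qed.

Let measurable_factor A i : measurable_fun setT (factor A i).
Proof.
rewrite /factor; case: (i \in A).
  apply: measurable_funD; first by apply: measurable_indic; exact: measurable_large_size.
  apply: measurable_funM => //; apply: measurable_indic.
  exact: measurable_small_pval_set.
by apply: measurable_indic; apply: measurableC; exact: measurable_large_size.
Qed.

Let q : R := fine (Q [set j | (k <= j)%N]).

Let qE : q%:E = Q [set j | (k <= j)%N].
Proof. by rewrite fineK// fin_num_measure. Qed.

Let pA (A : {set 'I_n}) : R := fine (size_law Q F0 (small_pval F0 k (t A))).

Let pA_le (A : {set 'I_n}) : (0 <= pA A <= q * t A)%R /\ (pA A)%:E = size_law Q F0 (small_pval F0 k (t A)).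
Proof.
have t0 : (0 <= t A)%R by rewrite divr_ge0.
have h := null_pval_le F0 Q k t0.
have fn : size_law Q F0 (small_pval F0 k (t A)) \is a fin_num.
  by rewrite ge0_fin_numE// (le_lt_trans h)// -qE -EFinM ltry.
by rewrite /pA fine_ge0// fineK//; split => //; rewrite -lee_fin fineK// EFinM qE.
Qed.

Let mean (A : {set 'I_n}) (i : 'I_n) : R := if i \in A then (q + (expR la - 1) * pA A)%R else (1 - q)%R.

Let factor_mean (z0 : (0 <= 0 :> R)%R) (z1 : (0 <= 1 - 0 :> R)%R) A i :
  \int[obs_law Q F0 F1 z0 z1]_z (factor A i z)%:E = (mean A i)%:E.
Proof.
have mL := @measurable_large_size R k.
have mS := measurable_small_pval_set F0 k (t A).
have IE D : measurable D -> \int[obs_law Q F0 F1 z0 z1]_z (\1_D z)%:E = size_law Q F0 D.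
  by move=> mD; exact: etrans (integral_indicT (obs_law Q F0 F1 z0 z1) mD) (null_obs_law _ _ _).
rewrite /factor /mean; case: (i \in A); last first.
  rewrite integral_indicT; last exact: measurableC.
  apply: etrans (probability_setC (obs_law Q F0 F1 z0 z1) mL) _.
  by rewrite null_obs_law size_law_large -qE EFinB.
transitivity (\int[obs_law Q F0 F1 z0 z1]_z ((\1_(large_size k) z)%:E +
   (expR la - 1)%:E * (\1_(small_pval F0 k (t A)) z)%:E)).
  by apply: eq_integral => z _; rewrite -EFinM -EFinD.
rewrite ge0_integralD//; last 3 first.
- by apply/measurable_EFinP; exact: measurable_indic.
- by move=> z _; rewrite -EFinM lee_fin mulr_ge0.
- by apply: measurable_funeM; apply/measurable_EFinP; exact: measurable_indic.
rewrite ge0_integralZl//; last by apply/measurable_EFinP; exact: measurable_indic.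
rewrite !IE// size_law_large -qE.
by have [_ <-] := pA_le A; rewrite -EFinM -EFinD.
Qed.

(** Given that the sizes in [A] are the large ones, the count is a sum of
    [#|A|] variables of success probability at most [tau / #|A|]; its
    exponential moment is bounded by that of a Poisson variable of mean [tau].
    *)
Let prod_mean_le (A : {set 'I_n}) : (\prod_(i < n) mean A i <=
  expR ((expR la - 1) * tau) * \prod_(i < n) (if i \in A then q else 1 - q))%R.
Proof.
have q01 : (0 <= q <= 1)%R by rewrite fine_ge0//= -lee_fin qE probability_le1.
have [/andP[q0 q1]] := q01; have q1' : (0 <= 1 - q)%R by rewrite subr_ge0.
pose x := ((expR la - 1) * tau)%R; have x0 : (0 <= x)%R by rewrite mulr_ge0.
apply: (@le_trans _ _ (\prod_(i < n) ((if i \in A then 1 + x / #|A|%:R else 1) *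
    (if i \in A then q else 1 - q)))%R).
  apply: ler_prod => i _; have [/andP[pA0 pA1] _] := pA_le A.
  rewrite /mean; case: ifP => _; last by rewrite q1' mul1r lexx.
  rewrite addr_ge0 ?mulr_ge0//= [leRHS]mulrDl mul1r lerD2l.
  apply: (@le_trans _ _ ((expR la - 1) * (q * t A))%R); first by rewrite ler_wpM2l.
  by rewrite /x /t mulrCA [leLHS]mulrC mulrA.
rewrite big_split/= ler_wpM2r//.
  by apply: prodr_ge0 => i _; case: ifP.
rewrite -big_mkcond/= prodr_const.
exact: expR_ge_power.
Qed.

(** The remaining products are the probabilities of the sets of large sizes,
    which sum to one. *)
Let sum_mean_le : (\sum_(A : {set 'I_n}) \prod_(i < n) mean A i <=
  expR ((expR la - 1) * tau))%R.
Proof.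
apply: (@le_trans _ _ (\sum_(A : {set 'I_n}) (expR ((expR la - 1) * tau) *
    \prod_(i < n) (if i \in A then q else 1 - q)))%R).
  by apply: ler_sum => A _; exact: prod_mean_le.
rewrite -mulr_sumr -[leRHS]mulr1 ler_wpM2l ?expR_ge0//.
have := @bigA_distr R 0%R 1%R *%R +%R 'I_n (fun=> q) (fun=> 1 - q)%R.
by rewrite /= big1 => [<-//|i _]; rewrite addrC subrK.
Qed.

(** Chernoff bound. The threshold may depend on the number of large sizes,
    because the set of large sizes is fixed first and summed over afterwards.
    *)
Lemma count_upper_tail (i : nat) : (1 <= i)%N ->
  exists E, [/\ measurable E, forall w, (i <= count_below (sizes w) (pvals w) k
      (tau / (n_above (sizes w) k)%:R))%N -> E w &
    P E <= (expR ((expR la - 1) * tau - la * i%:R))%:E].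
Proof.
move=> i1.
have z0 : (0 <= 0 :> R)%R by [].
have z1 : (0 <= 1 - 0 :> R)%R by rewrite subr0.
pose Z w : R := (\sum_(A : {set 'I_n}) \prod_(j < n) factor A j (obs j w))%R.
have mprod A : measurable_fun setT (fun w => \prod_(j < n) factor A j (obs j w))%R.
  apply: measurable_fun_bigprod => j; apply: measurableT_comp => //.
  exact: measurable_obs.
have prod0 A w : (0 <= \prod_(j < n) factor A j (obs j w))%R.
  by apply: prodr_ge0 => j _; exact: factor_ge0.
have mZ : measurable_fun setT Z by exact: measurable_sum.
have IZ : \int[P]_w (Z w)%:E <= (expR ((expR la - 1) * tau))%:E.
  rewrite /Z; under eq_integral do rewrite -sumEFin.
  rewrite ge0_integral_sum//; last 2 first.
  - by move=> A; exact/measurable_EFinP.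
  - by move=> A w _; rewrite lee_fin.
  under eq_bigr do rewrite (mixture_sample_expectation HS (e0 := z0) (e1 := z1)
    (measurable_factor _) (factor_ge0 _) (factor_mean z0 z1 _)).
  by rewrite sumEFin lee_fin.
have ZE w : (i <= count_below (sizes w) (pvals w) k
      (tau / (n_above (sizes w) k)%:R))%N -> (expR (la * i%:R) <= Z w)%R.
  move=> ic; pose A := [set j | (k <= K j w)%N]%SET.
  rewrite /Z (bigD1 A)//= -[leLHS]addr0 lerD//; last by apply: sumr_ge0.
  apply: (@le_trans _ _ (\prod_(j < n) (if (k <= K j w)%N && (pval F0 (obs j w) <= t A)
      then expR la else 1))%R).
    rewrite -big_mkcond/= prodr_const expRM_natr.
    have el1 : (1 <= expR la)%R by rewrite -[leLHS]expR0 ler_expR.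
    rewrite ler_weXn2l//.
    apply: leq_trans ic _; rewrite /count_below.
    by rewrite [leqRHS]cardE -cardE; apply: subset_leq_card; apply/fintype.subsetP => j; rewrite inE.
  apply: ler_prod => j _; apply/andP; split; first by case: ifP => _; rewrite ?expR_ge0.
  rewrite /factor inE; case: (boolP (k <= K j w)%N) => kj /=.
    rewrite !indicE mem_set//=; case: ifP => pj.
      by rewrite mem_set//= mulr1 addrC subrK.
    by rewrite memNset ?mulr0 ?addr0// => -[_]; rewrite pj.
  by rewrite indicE mem_set//= /large_size/=; apply/negP.
have Z0 w : (0 <= Z w)%R by apply: sumr_ge0.
have [mE PE] := markov_bound mZ Z0 (expR_gt0 (la * i%:R)) IZ.
exists [set w | (expR (la * i%:R) <= Z w)%R]; split => //.
by rewrite expRD expRN.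
Qed.

End Factors.
End NullCounts.

Section OuterBound.
Local Open Scope ereal_scope.
Context {R : realType} {d : measure_display} {Omega : measurableType d}.
Variable P : probability Omega R.

(** Outer bound: unions and inclusions of events need no measurability. *)
Definition covered (A : set Omega) (x : R) :=
  exists E, [/\ measurable E, A `<=` E & P E <= x%:E].

Lemma covered_le A x : measurable A -> covered A x -> P A <= x%:E.
Proof.
by move=> mA [E [mE AE h]]; apply: le_trans h; apply: le_measure; rewrite ?inE.
Qed.

Lemma covered_measurable A x : measurable A -> P A <= x%:E -> covered A x.
Proof. by move=> mA h; exists A; split. Qed.

Lemma covered_sub A B x y : A `<=` B -> (x <= y)%R -> covered B x -> covered A y.
Proof.
move=> AB xy [E [mE BE h]]; exists E; split => //; first exact: subset_trans BE.
by apply: (le_trans h); rewrite lee_fin.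
Qed.

Lemma coveredU A B x y : covered A x -> covered B y -> covered (A `|` B) (x + y).
Proof.
move=> [E [mE AE hE]] [F [mF BF hF]]; exists (E `|` F); split.
- exact: measurableU.
- exact: setUSS.
- apply: (@le_trans _ _ (P E + P F)); first exact: measureU2.
  by rewrite EFinD leeD.
Qed.

Lemma covered_bigcup m (A : nat -> set Omega) (b : nat -> R) :
  (forall j, (j < m)%N -> covered (A j) (b j)) ->
  covered [set w | exists2 j, (j < m)%N & A j w] (\sum_(0 <= j < m) b j).
Proof.
elim: m => [|m IH] H.
  rewrite big_geq//; apply: covered_sub (covered_measurable measurable0 _) => //.
  - by move=> w [].
  - by rewrite measure0.
rewrite big_nat_recr//=; apply: covered_sub (coveredU (IH _) (H m (ltnSn m))) => //.
  move=> w [j]; rewrite ltnS leq_eqVlt => /orP[/eqP ->|jm] Aj; [by right|by left; exists j].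
by move=> j jm; apply: H; exact: ltnW.
Qed.

End OuterBound.

(** For an index [i] that is not much larger than [c], only the linear part of
    the constraint [x ^+ 2 + b * x <= i] is used: the mean [(i / b) ^+ 2] is
    much smaller than [i], and the tilt may be taken as large as the logarithm
    of [c]. *)
Lemma small_index_exponent (R : realType) (i : nat) (c b : R) :
  0 < b -> b ^+ 2 = c ^+ 2 / 2 -> 4 * expR 1 <= c -> (1 <= i)%N -> i%:R <= 2 * c ->
  exists2 la, 0 <= la &
    (expR la - 1) * (i%:R / b) ^+ 2 - la * i%:R <= i%:R * (1 - ln (c / 4)).
Proof.
move=> b0 bE ec i1 ic; have e1 : 1 <= expR 1 :> R by rewrite -[leLHS]expR0 ler_expR.
have c4 : 1 <= c / 4 by lra.
have c0 : 0 < c by lra.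
exists (ln (c / 4)); first exact: ln_ge0.
rewrite lnK ?posrE ?divr_gt0// mulrBr mulr1 [ln _ * _]mulrC lerD2r.
have i0 : 0 < i%:R :> R by rewrite ltr0n.
rewrite exprMn exprVn bE invf_div expr2.
have -> : (c / 4 - 1) * (i%:R * i%:R * (2 / c ^+ 2)) =
   i%:R * ((c - 4) * i%:R / (2 * c ^+ 2)) by field; rewrite gt_eqF.
rewrite -[leRHS]mulr1 ler_pM2l// ler_pdivrMr ?mulr_gt0 ?exprn_gt0// mul1r.
apply: (@le_trans _ _ (c * i%:R)); first by rewrite ler_pM2r//; lra.
by rewrite expr2 mulrCA ler_pM2l.
Qed.

(** The solution [u] of [u ^+ 2 + b * u = i] has [u ^+ 2] as the null mean of
    the count and [b * u] as its deviation. The optimal tilt is of order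
    [b / u], cut at [1 / 2] when the deviation is at least twice the mean. *)
Lemma large_index_exponent (R : realType) (i : nat) (b : R) :
  2 <= b -> 1 + b <= i%:R ->
  exists u la, [/\ 0 <= u, 0 <= la, forall x, 0 <= x -> x ^+ 2 + b * x <= i%:R -> x ^+ 2 <= u ^+ 2 &
    (expR la - 1) * u ^+ 2 - la * i%:R <= - (b / 4)].
Proof.
move=> b2 bi; pose s := Num.sqrt (b ^+ 2 + 4 * i%:R).
have sE : s ^+ 2 = b ^+ 2 + 4 * i%:R.
  by rewrite sqr_sqrtr// addr_ge0 ?sqr_ge0// mulr_ge0.
have s0 : 0 <= s by exact: sqrtr_ge0.
pose u := (s - b) / 2.
have uE : u ^+ 2 + b * u = i%:R.
  by rewrite /u; move: sE; rewrite !expr2 => sE; lra.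
have u1 : 1 <= u.
  have : b + 2 <= s.
    rewrite -[leLHS]ger0_norm ?addr_ge0//; last lra.
    by rewrite -[s]ger0_norm// -ler_sqr ?nnegrE//; move: sE; rewrite !real_normK ?num_real//; rewrite !expr2; nra.
  by rewrite /u; lra.
have u0 : 0 <= u by lra.
have xu x : 0 <= x -> x ^+ 2 + b * x <= i%:R -> x ^+ 2 <= u ^+ 2.
  move=> x0; rewrite -uE => h; rewrite lerXn2r ?nnegrE// leNgt; apply/negP => ux.
  by move: h; rewrite leNgt => /negP; apply; rewrite !expr2; nra.
have bound la : 0 <= la -> la <= 2^-1 -> (expR la - 1) * u ^+ 2 - la * i%:R <=
    la * u * (2 * la * u - b).
  move=> la0 la2; have := expR_le_quadratic la2; rewrite -uE => h.
  have : (expR la - 1) * u ^+ 2 <= (la + 2 * la ^+ 2) * u ^+ 2.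
    by rewrite ler_wpM2r ?sqr_ge0//; lra.
  by rewrite !expr2; lra.
have [ub|bu] := leP u (b / 2).
  exists u, 2^-1; split => //.
  apply: (le_trans (bound _ _ _)) => //.
  by nra.
have u_gt0 : 0 < u by lra.
exists u, (b / (4 * u)).
have la0 : 0 <= b / (4 * u) by rewrite divr_ge0//; lra.
have la2 : b / (4 * u) <= 2^-1 by rewrite ler_pdivrMr; lra.
split => //; apply: (le_trans (bound _ la0 la2)).
have -> : b / (4 * u) * u = b / 4 by field; rewrite gt_eqF.
have -> : 2 * (b / (4 * u)) * u = b / 2 by field; rewrite gt_eqF.
by nra.
Qed.

Section TermBound.
Context {R : realType}.
Variable c : R.
Hypothesis c_large : 4 * expR 1 <= c.

Let b := c / Num.sqrt 2.
Let x := 4 * expR 1 / c.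

Let c4 : 4 <= c.
Proof.
apply: le_trans c_large; rewrite -[leLHS]mulr1 ler_pM2l//.
by rewrite -[leLHS]expR0 ler_expR.
Qed.

Let c0 : 0 < c.
Proof. exact: lt_le_trans c4. Qed.

Let sqrt2_gt0 : 0 < Num.sqrt 2 :> R. Proof. by rewrite sqrtr_gt0. Qed.

Let b0 : 0 < b. Proof. exact: divr_gt0. Qed.

Lemma half_root_sqr : b ^+ 2 = c ^+ 2 / 2.
Proof. by rewrite /b expr_div_n sqr_sqrtr. Qed.

Lemma half_rootE : Num.sqrt 2 * b = c.
Proof. by rewrite /b mulrC divfK// gt_eqF. Qed.

Lemma half_root_ge2 : 2 <= b.
Proof. by rewrite -ler_sqr ?nnegrE ?(ltW b0)// half_root_sqr; move: c4; rewrite !expr2; nra. Qed.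

Let x0 : 0 < x. Proof. by apply: divr_gt0 => //; rewrite mulr_gt0// expR_gt0. Qed.
Let x1 : x <= 1. Proof. by rewrite /x ler_pdivrMr// mul1r. Qed.

(** The tail of the first term is only polynomial in [c], since it is governed
    by the smallest p-value; the ranks up to [2 * c] are bounded by the square
    of that bound, and the others exponentially. *)
Definition term_bound (i : nat) : R :=
  (if (i < 2)%N then x else 0) + (if i%:R <= 2 * c then x ^+ 2 else 0) + expR (- (b / 4)).

Lemma term_bound_ge (i : nat) (y : R) : (1 <= i)%N ->
  (i%:R <= 2 * c -> y <= i%:R * (1 - ln (c / 4))) ->
  (2 * c < i%:R -> y <= - (b / 4)) -> expR y <= term_bound i.
Proof.
move=> i1 small large; rewrite /term_bound.
have x20 : 0 <= x ^+ 2 by exact: sqr_ge0.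
have xE : expR (1 - ln (c / 4)) = x.
  rewrite expRB lnK ?posrE ?divr_gt0// /x; field; rewrite gt_eqF//.
have [ic|ci] := leP i%:R (2 * c); last first.
  rewrite addr0; apply: (@le_trans _ _ (expR (- (b / 4)))); first by rewrite ler_expR large.
  by rewrite lerDr; case: ifP => // _; exact: ltW.
have yx : expR y <= x ^+ i.
  by rewrite -xE -expRM_natl ler_expR small.
have [i2|i2] := ltnP i 2.
  have -> : x = x ^+ i by have -> : i = 1 by apply/eqP; rewrite eqn_leq i1 -ltnS i2.
  rewrite -addrA; apply: (le_trans yx); rewrite lerDl addr_ge0 ?expR_ge0//.
  by rewrite exprn_ge0// exprn_ge0// ltW.
rewrite add0r; apply: (le_trans yx); apply: (@le_trans _ _ (x ^+ 2)).
  by apply: ler_wiXn2l => //; exact: ltW.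
by rewrite lerDl expR_ge0.
Qed.

Lemma sum_term_bound n : \sum_(0 <= i < n.+1) term_bound i <=
  2 * x + (2 * c + 1) * x ^+ 2 + n.+1%:R * expR (- (b / 4)).
Proof.
rewrite /term_bound !big_split/=; apply: lerD; first apply: lerD.
- apply: (@le_trans _ _ (\sum_(0 <= i < n.+1) (if i%:R <= 1 :> R then x else 0))).
    by apply: ler_sum => i _; rewrite lern1.
  have -> : 2 * x = (1 + 1) * x by [].
  exact: sum_nat_le_bounded (ltW x0).
- by apply: sum_nat_le_bounded; [rewrite mulr_ge0 ?(ltW c0)|exact: sqr_ge0].
- by rewrite sumr_const_nat subn0 mulr_natl.
Qed.

End TermBound.

Section NullStatistic.
Context {R : realType}.
Variables (F0 F1 : probability R R) (Q : probability nat R).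
Variables (n : nat) (d : measure_display) (Omega : measurableType d).
Variables (P : probability Omega R) (K : 'I_n -> {mfun Omega >-> nat})
  (Y V : 'I_n -> {mfun Omega >-> R}).
Hypothesis HS : mixture_sample F0 F1 Q 0 P K Y V.

Local Notation obs := (obs K Y V).
Local Notation sizes w := (fun i => K i w).
Local Notation pvals w := (fun i => pval F0 (obs i w)).

Variable c : R.
Hypothesis c_large : 4 * expR 1 <= c.

Local Notation b := (c / Num.sqrt 2).
Local Notation x := (4 * expR 1 / c).

Let c0 : 0 < c.
Proof. by apply: lt_le_trans c_large; rewrite mulr_gt0// expR_gt0. Qed.

Let b0 : 0 < b.
Proof. by rewrite divr_gt0// sqrtr_gt0. Qed.

Let x0 : 0 < x.
Proof. by rewrite divr_gt0// mulr_gt0// expR_gt0. Qed.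

Definition exceedance (k i : nat) : set Omega :=
  [set w | (1 <= i <= (n_above (sizes w) k)./2)%N /\ c <= hc_term (sizes w) (pvals w) k i].

(** The thresholds and tilts of the two regimes, fed to the Chernoff bound for
    the counts. *)
Lemma covered_exceedance k i : covered P (exceedance k i) (term_bound c i).
Proof.
have [i0|i1] := posnP i.
  apply: covered_sub (covered_measurable measurable0 _).
  - by move=> w [/andP[]]; rewrite i0.
  - by apply: lexx.
  - rewrite measure0 lee_fin /term_bound i0 /= !addr_ge0 ?expR_ge0 ?(ltW x0)//.
    by case: ifP => // _; exact: sqr_ge0.
suff [la [tau [la0 tau0 tauP H]]] : exists la tau, [/\ 0 <= la, 0 <= tau,
    forall y, 0 <= y -> y ^+ 2 + b * y <= i%:R -> y ^+ 2 <= tau &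
    expR ((expR la - 1) * tau - la * i%:R) <= term_bound c i].
  have [E [mE subE PE]] := count_upper_tail HS k la0 tau0 i1.
  exists E; split => //; last by apply: (le_trans PE); rewrite lee_fin.
  move=> w [ik hc]; apply: subE.
  by apply: (count_of_hc_term b0 ik _ tauP) ; rewrite half_rootE.
have [ic|ci] := leP i%:R (2 * c).
  have [la la0 hla] := small_index_exponent b0 (half_root_sqr c) c_large i1 ic.
  exists la, ((i%:R / b) ^+ 2); split => //; first exact: sqr_ge0.
    move=> y y0 hy; have ib0 : 0 <= i%:R / b by rewrite divr_ge0// ltW.
    rewrite lerXn2r ?nnegrE//.
    rewrite ler_pdivlMr// mulrC; apply: le_trans hy.
    by rewrite lerDr sqr_ge0.
  by apply: (term_bound_ge c_large) => // h; move: ic; rewrite leNgt h.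
have bi : 1 + b <= i%:R.
  apply/ltW; apply: le_lt_trans ci.
  have : b <= c by rewrite ler_pdivrMr// -[leLHS]mulr1 ler_pM2l// -[leLHS]sqrtr1 ler_wsqrtr// ler1n.
  have := half_root_ge2 c_large; move: b => y; lra.
have [u [la [u0 la0 uP hla]]] := large_index_exponent (half_root_ge2 c_large) bi.
exists la, (u ^+ 2); split => //; first exact: sqr_ge0.
by apply: (term_bound_ge c_large) => // h; move: ci; rewrite ltNge h.
Qed.

(** Union bound over the terms: at most [M] lower bounds on the sizes, unless
    some size exceeds [M], and at most [n] ranks for each. *)
Lemma null_HC_thres_bound (M : nat) (y : R) : (2 <= n)%N -> Q [set 0%N] = 0%E ->
  (Q [set k | (M < k)%N] <= y%:E)%E ->
  (P [set w | (c <= HC_thres (sizes w) (pvals w))%R] <=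
   (n%:R * y + M.+1%:R * (2 * x + (2 * c + 1) * x ^+ 2 + n.+1%:R * expR (- (b / 4))))%:E)%E.
Proof.
move=> n2 Q0 QM.
have z0 : (0 <= 0 :> R)%R by [].
have z1 : (0 <= 1 - 0 :> R)%R by rewrite subr0.
have mK i : measurable_fun setT (K i) by [].
have mp i : measurable_fun setT (fun w => pval F0 (obs i w)).
  by apply: measurableT_comp; [exact: measurable_pval|exact: measurable_obs].
have mH := measurable_HC_thres mK mp.
apply: covered_le.
  rewrite [X in measurable X](_ : _ = setT `&` (fun w => HC_thres (sizes w) (pvals w)) @^-1` `[c, +oo[).
    exact: mH.
  by rewrite setTI; apply/seteqP; split => w /=; rewrite in_itv/= andbT.
have csize (A : set nat) (z : R) i : (Q A <= z%:E)%E -> covered P [set w | A (K i w)] z.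
  move=> QA; apply: covered_measurable.
    by rewrite -[X in measurable X]setTI; exact: (mK i measurableT A).
  by rewrite (mixture_sample_marginal z0 z1 HS i (measurable_size_event A))
    null_obs_law size_law_size.
have cov0 := covered_bigcup (P := P) (m := n) (A := fun i => [set w | exists j : 'I_n, j = i :> nat /\ (M < K j w)%N])
  (b := fun=> y).
have cov1 := covered_bigcup (P := P) (m := n) (A := fun i => [set w | exists j : 'I_n, j = i :> nat /\ K j w = 0%N])
  (b := fun=> 0).
have cov2 := covered_bigcup (P := P) (m := M.+1)
  (A := fun k => [set w | exists2 i, (i < n.+1)%N & exceedance k i w])
  (b := fun=> \sum_(0 <= i < n.+1) term_bound c i).
apply: (covered_sub _ _ (coveredU (coveredU (cov1 _) (cov0 _)) (cov2 _))).
- move=> w /= hw.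
  have [[j Kj]|noK0] := pselect (exists j : 'I_n, K j w = 0%N).
    by left; left; exists j => //; exists j.
  have [[j Kj]|noM] := pselect (exists j : 'I_n, (M < K j w)%N).
    by left; right; exists j => //; exists j.
  right; have Kpos i : (0 < K i w)%N.
    by rewrite lt0n; apply/eqP => Ki; apply: noK0; exists i.
  have [k [i [k1 ik hk]]] := hc_term_of_HC_thres n2 Kpos hw.
  exists k.
    rewrite ltnS; have nk : (0 < n_above (sizes w) k)%N.
      by rewrite lt0n; apply/eqP => n_0; move: ik; rewrite n_0 => /andP[]; case: (i).
    apply: leq_trans (n_above_max nk) _; apply/bigmax_leqP => j _.
    by rewrite leqNgt; apply/negP => Mj; apply: noM; exists j.
  exists i; last by split.
  rewrite ltnS; case/andP: ik => _ /leq_trans; apply.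
  by apply: leq_trans (n_above_le (sizes w) k); rewrite -[leqRHS]odd_double_half -addnn addnA leq_addl.
- rewrite !sumr_const_nat !subn0 mul0rn add0r; set S := \sum_(_ <= _ < _) _.
  by rewrite -[y *+ n]mulr_natl -[S *+ _]mulr_natl lerD2l ler_wpM2l// sum_term_bound.
- move=> j jn; apply: (covered_sub _ (lexx _) (csize [set 0%N] 0 (Ordinal jn) _)); last by rewrite Q0.
  by move=> w [i [ij Ki]] /=; rewrite (_ : Ordinal jn = i)//; apply/val_inj.
- move=> j jn; apply: (covered_sub _ (lexx _) (csize _ y (Ordinal jn) QM)).
  by move=> w [i [ij Ki]] /=; rewrite (_ : Ordinal jn = i)//; apply/val_inj.
- by move=> k _; apply: covered_bigcup => i _; exact: covered_exceedance.
Qed.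

End NullStatistic.

(** The union bound at [c = L ^+ 2], with [L = log n]: of the order of [log n]
    lower bounds on the sizes, each with a first rank of probability
    [O (L ^- 2)], some [L ^+ 2] ranks of probability [O (L ^- 4)], and [n]
    ranks of probability smaller than any power of [1 / n]. *)
Lemma null_bound_numeric (R : realType) (C L ep N E b : R) :
  0 < C -> 24 <= L -> 1 <= E -> 0 < ep -> 0 <= N -> 0 <= b ->
  b <= 2 * expR (- (2 * L)) / expR L ->
  N <= expR (- L) ->
  4 * (C + 1) * (8 * E + 48 * E ^+ 2) / ep <= L ->
  8 * (C + 2) / ep * L <= expR L ->
  N + (C * L + 1) * (2 * (4 * E / L ^+ 2) +
    (2 * L ^+ 2 + 1) * (4 * E / L ^+ 2) ^+ 2 + (expR L + 1) * b) <= ep.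
Proof.
move=> C0 L24 E1 ep0 N0 b0 bb NL hL hexp.
have L0 : 0 < L by lra.
have Ln0 : L != 0 by rewrite gt_eqF.
have ex0 : 0 < expR L by exact: expR_gt0.
have exm0 : 0 < expR (- L) by exact: expR_gt0.
have ex1 : 1 <= expR L by rewrite -[leLHS]expR0 ler_expR ltW.
have exm1 : expR (- L) <= 1 by rewrite -[leRHS]expR0 ler_expR oppr_le0 ltW.
have small : L * expR (- L) <= ep / (8 * (C + 2)).
  rewrite expRN -ler_pdivlMr ?invr_gt0// invrK -ler_pdivrMl ?divr_gt0//; last lra.
  by rewrite invf_div.
have T1 : (C * L + 1) * (2 * (4 * E / L ^+ 2) + (2 * L ^+ 2 + 1) * (4 * E / L ^+ 2) ^+ 2) <= ep / 4.
  have -> : 2 * (4 * E / L ^+ 2) + (2 * L ^+ 2 + 1) * (4 * E / L ^+ 2) ^+ 2 =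
    (8 * E * L ^+ 2 + 16 * E ^+ 2 * (2 * L ^+ 2 + 1)) / (L ^+ 2 * L ^+ 2) by field.
  apply: (@le_trans _ _ ((C + 1) * L * ((8 * E + 48 * E ^+ 2) * L ^+ 2 / (L ^+ 2 * L ^+ 2)))).
    apply: ler_pM.
    - by rewrite addr_ge0// mulr_ge0 ?ltW.
    - apply: divr_ge0; last by rewrite mulr_ge0 ?sqr_ge0.
      apply: addr_ge0; first by rewrite !mulr_ge0 ?sqr_ge0//; lra.
      apply: mulr_ge0; first by rewrite mulr_ge0 ?sqr_ge0.
      by have := sqr_ge0 L; move: (L ^+ 2) => l; lra.
    - by rewrite mulrDl mul1r lerD2l; lra.
    - apply: ler_wpM2r; first by rewrite invr_ge0 mulr_ge0 ?sqr_ge0.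
      have : 1 <= L ^+ 2 by rewrite expr2; nra.
      have : 0 <= E ^+ 2 by exact: sqr_ge0.
      by move: (L ^+ 2) (E ^+ 2) => l e; nra.
  have -> : (C + 1) * L * ((8 * E + 48 * E ^+ 2) * L ^+ 2 / (L ^+ 2 * L ^+ 2)) =
     (C + 1) * (8 * E + 48 * E ^+ 2) / L by field.
  rewrite ler_pdivrMr//.
  move: hL; rewrite ler_pdivrMr//; move: (8 * E + _) => D; lra.
have T2 : (C * L + 1) * ((expR L + 1) * b) <= ep / 2.
  have h1 : (expR L + 1) * b <= 4 * expR (- L).
    apply: (@le_trans _ _ ((2 * expR L) * (2 * expR (- (2 * L)) / expR L))).
      by apply: ler_pM => //; lra.
    have -> : 2 * expR L * (2 * expR (- (2 * L)) / expR L) = 4 * expR (- (2 * L)).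
      by field; rewrite gt_eqF.
    by rewrite ler_pM2l// ler_expR; lra.
  apply: (@le_trans _ _ ((C + 1) * L * (4 * expR (- L)))).
    apply: ler_pM => //.
    - by rewrite addr_ge0// mulr_ge0 ?ltW.
    - by rewrite mulr_ge0//; lra.
    - by rewrite mulrDl mul1r lerD2l; lra.
  apply: (@le_trans _ _ (4 * (C + 2) * (ep / (8 * (C + 2))))).
    have -> : (C + 1) * L * (4 * expR (- L)) = 4 * (C + 1) * (L * expR (- L)) by ring.
    by apply: ler_pM => //; rewrite ?mulr_ge0 ?ltW//; lra.
  have -> : 4 * (C + 2) * (ep / (8 * (C + 2))) = ep / 2 by field; lra.
  exact: lexx.
have T3 : N <= ep / 8.
  apply: (le_trans NL); apply: (@le_trans _ _ (L * expR (- L))).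
    by rewrite -[leLHS]mul1r ler_pM2r//; lra.
  apply: (le_trans small); rewrite ler_pdivrMr; last lra.
  by nra.
rewrite [X in _ + X]mulrDr; move: T1 T2 T3.
set X1 := (C * L + 1) * (_ + _); set X2 := (C * L + 1) * _.
by move: X1 X2 => X1 X2; move: ep0; clear; lra.
Qed.

Section NullAsymptotics.
Context {R : realType}.
Variables (a0 : R) (J : R -> R).
Hypotheses (a0_gt0 : 0 < a0) (J_vanishes : rate_vanishes a0 J)
  (J_derivative : rate_derivative a0 J).
Variables (Q : nat -> probability nat R) (alpha : nat -> nat -> R).
Hypothesis Q_rate : sizes_follow_rate a0 J Q alpha.
Hypothesis Q_pos : forall n, Q n [set 0%N] = 0%E.
Variables (F0 F1 : probability R R).
Variables (d : nat -> measure_display) (Omega : forall n, measurableType (d n))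
  (P : forall n, probability (Omega n) R)
  (K : forall n, 'I_n -> {mfun Omega n >-> nat})
  (Y V : forall n, 'I_n -> {mfun Omega n >-> R}).
Hypothesis HS : forall n, mixture_sample F0 F1 (Q n) 0 (P n) (@K n) (@Y n) (@V n).

(** Any cut-off of larger order than [log n] would do, as the first rank costs
    the inverse of the cut-off for each of the [O (log n)] sizes. *)
Lemma null_HC_thres_small (ep : R) : 0 < ep -> \forall n \near \oo,
  (P n [set w | (lnn n ^+ 2 <= HC_thres (fun i => @K n i w)
      (fun i => pval F0 (obs (@K n) (@Y n) (@V n) i w)))%R] <= ep%:E)%E.
Proof.
move=> ep0.
have [C [a0C JC]] := rate_unbounded a0_gt0 J_vanishes J_derivative 3.
have C0 : 0 < C by exact: lt_trans a0C.
have tail := size_tail a0_gt0 J_vanishes J_derivative Q_rate (ltW a0C) (@ltr01 R).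
pose E : R := expR 1.
near=> n; set L := lnn n : R.
have n2 : (2 <= n)%N by near: n; exact: nbhs_infty_ge.
have n0 : (0 < n)%N by exact: ltnW.
have L24 : 24 <= L by rewrite /L; near: n; exact: near_lnn_ge.
have LE : 4 * E <= L by rewrite /L; near: n; exact: near_lnn_ge.
have hL : 4 * (C + 1) * (8 * E + 48 * E ^+ 2) / ep <= L.
  by rewrite /L; near: n; exact: near_lnn_ge.
have hexp : 8 * (C + 2) / ep * L <= expR L.
  rewrite -[X in _ <= expR X]mul1r -[X in _ * X]expr1 /L; near: n; exact: near_expR_ge.
have QT : (Q n [set k | (C * L <= k%:R)%R] <= (expR (- (J C - 1) * L))%:E)%E.
  by rewrite /L; near: n.
have nE : n%:R = expR L :> R by rewrite expR_lnn.
have L0 : 0 < L by lra.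
have E1 : 1 <= E by rewrite /E -[leLHS]expR0 ler_expR.
have cl : 4 * expR 1 <= L ^+ 2.
  apply: (le_trans LE); rewrite expr2 -[leLHS]mulr1 ler_pM2l//; lra.
pose M := Num.truncn (C * L).
have QM : (Q n [set k | (M < k)%N] <= (expR (- (2 * L)))%:E)%E.
  apply: le_trans (le_trans QT _).
    apply: le_measure; rewrite ?inE// => k /= Mk.
    apply: ltW; apply: lt_le_trans (truncnS_gt _) _; by rewrite ler_nat.
  by rewrite lee_fin ler_expR mulNr lerN2 ler_pM2r//; lra.
apply: (le_trans (null_HC_thres_bound (HS n) cl n2 (Q_pos n) QM)).
rewrite lee_fin.
pose b := expR (- (L ^+ 2 / Num.sqrt 2 / 4)).
have bb : b <= 2 * expR (- (2 * L)) / expR L.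
  rewrite /b -expRN -[leRHS]mulrA -[X in _ <= _ * X]expRD; apply: (@le_trans _ _ (expR (- (2 * L) - L))).
    rewrite ler_expR.
    have s2 : 0 < Num.sqrt 2 :> R by rewrite sqrtr_gt0.
    have s22 : Num.sqrt 2 <= 2 :> R.
      by rewrite -ler_sqr ?nnegrE ?ltW// sqr_sqrtr// expr2; lra.
    have : L ^+ 2 / 2 <= L ^+ 2 / Num.sqrt 2.
      by rewrite ler_wpM2l ?sqr_ge0// lef_pV2 ?posrE.
    have : 24 * L <= L ^+ 2 by rewrite expr2 ler_pM2r.
    by move: (L ^+ 2 / Num.sqrt 2) (L ^+ 2) => u v; lra.
  by rewrite ler_peMl ?expR_ge0// ler1n.
have NL : n%:R * expR (- (2 * L)) <= expR (- L).
  by rewrite nE -expRD ler_expR; lra.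
have ML : M.+1%:R <= C * L + 1 :> R.
  by rewrite -natr1 lerD2r truncn_le// mulr_ge0 ?ltW.
apply: le_trans (null_bound_numeric C0 L24 E1 ep0 _ (expR_ge0 _) bb NL hL hexp).
  have n1E : n.+1%:R = expR L + 1 by rewrite -natr1 nE.
  rewrite lerD2l n1E; apply: ler_pM => //.
  apply: addr_ge0; last by rewrite mulr_ge0 ?addr_ge0 ?expR_ge0.
  apply: addr_ge0; first by rewrite mulr_ge0 ?divr_ge0 ?sqr_ge0 ?mulr_ge0 ?expR_ge0.
  by rewrite mulr_ge0 ?sqr_ge0// addr_ge0// mulr_ge0 ?sqr_ge0.
by rewrite mulr_ge0// expR_ge0.
Unshelve. all: by end_near.
Qed.

End NullAsymptotics.

(** * The statistic under the alternative *)

(** Pointwise quadratic bound for the factor of one observation, according to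
    whether its p-value is small and whether its size is large. *)
Lemma excess_factor_le (R : realType) (t la : R) (s l : bool) :
  0 <= t <= 1 -> 0 <= la <= 2^-1 -> (s ==> l) ->
  expR (- (la * (s%:R - t * l%:R))) <=
  (~~ s)%:R + (1 - la + 2 * la ^+ 2) * s%:R + (la * t + 2 * la ^+ 2 * t) * l%:R.
Proof.
move=> /andP[t0 t1] /andP[la0 la1] sl.
have la20 : 0 <= la ^+ 2 by exact: sqr_ge0.
apply: (le_trans (expR_le_quadratic _)).
  by case: s l sl => -[] //= _; rewrite ?mulr1 ?mulr0 ?subr0 ?sub0r ?mulr1; nra.
have lt0 : 0 <= la ^+ 2 * t by rewrite mulr_ge0.
have lt2 : la ^+ 2 * (t * t) <= la ^+ 2 * t by rewrite ler_wpM2l// ler_piMl.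
rewrite sqrrN exprMn [(_ - _) ^+ 2]expr2; move: (la ^+ 2) lt0 lt2 la20 => a lt0 lt2 a0.
by case: s l sl => -[] //= _; rewrite ?mulr1 ?mulr0 ?subr0 ?sub0r ?addr0 ?add0r; lra.
Qed.

Section AlternativeCounts.
Local Open Scope ereal_scope.
Context {R : realType}.
Variables (F0 F1 : probability R R) (Q : probability nat R) (e : R).
Hypotheses (e0 : (0 <= e)%R) (e1 : (0 <= 1 - e)%R).
Variables (n : nat) (d : measure_display) (Omega : measurableType d).
Variables (P : probability Omega R) (K : 'I_n -> {mfun Omega >-> nat})
  (Y V : 'I_n -> {mfun Omega >-> R}).
Hypothesis HS : mixture_sample F0 F1 Q e P K Y V.

Local Notation obs := (obs K Y V).
Local Notation sizes w := (fun i => K i w).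
Local Notation pvals w := (fun i => pval F0 (obs i w)).

Lemma obs_law_large k : obs_law Q F0 F1 e0 e1 (large_size k) = Q [set j | (k <= j)%N].
Proof.
rewrite obs_lawE !size_law_large -ge0_muleDl ?lee_fin//.
by rewrite -EFinD subrK mul1e.
Qed.

Section Threshold.
Variables (k : nat) (t : R).
Hypothesis t01 : (0 < t < 1)%R.

Let t0 : (0 < t)%R. Proof. by case/andP: t01. Qed.

Let D := small_pval F0 k t.
Let C : set (nat * (R * R)) := large_size k.

Let mD : measurable D. Proof. exact: measurable_small_pval_set. Qed.
Let mC : measurable C. Proof. exact: measurable_large_size. Qed.

Let s1 : R := fine (size_law Q F1 D).
Let q : R := fine (Q [set j | (k <= j)%N]).

Let qE : q%:E = Q [set j | (k <= j)%N].
Proof. by rewrite fineK// fin_num_measure. Qed.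

Let s1E : s1%:E = size_law Q F1 D.
Proof.
rewrite fineK// ge0_fin_numE//; apply: (@le_lt_trans _ _ (size_law Q F1 C)).
  by apply: le_measure; rewrite ?inE// => z [].
by rewrite size_law_large -qE ltry.
Qed.

Let obsC : obs_law Q F0 F1 e0 e1 C = q%:E.
Proof. by rewrite obs_law_large qE. Qed.

Let delta : R := ((1 - e) * (q * t) + e * s1)%R.

Let obsD : obs_law Q F0 F1 e0 e1 D = delta%:E.
Proof. by rewrite obs_lawE null_pval_law// -qE -s1E -!EFinM -EFinD. Qed.

Definition excess (w : Omega) : R :=
  ((count_below (sizes w) (pvals w) k t)%:R - (n_above (sizes w) k)%:R * t)%R.

Let xi (z : nat * (R * R)) : R := (\1_D z - t * \1_C z)%R.

Let excessE w : excess w = (\sum_(i < n) xi (obs i w))%R.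
Proof.
rewrite /excess /xi big_split/= sumrN -mulr_sumr mulrC; congr (_ - _ * _)%R.
  rewrite /count_below -sum1_card natr_sum big_mkcond/=; apply: eq_bigr => i _.
  rewrite inE indicE; have -> : (obs i w \in D) = ((k <= K i w)%N && (pval F0 (obs i w) <= t)%R).
    by apply/idP/idP; rewrite inE => /andP.
  by case: (_ && _).
rewrite /n_above -sum1_card natr_sum big_mkcond/=; apply: eq_bigr => i _.
rewrite inE indicE; have -> : (obs i w \in C) = (k <= K i w)%N.
  by apply/idP/idP; rewrite inE.
by case: (_ <= _)%N.
Qed.

Let measurable_xi : measurable_fun setT xi.
Proof.
apply: measurable_funB; first exact: measurable_indic.
by apply: measurable_funM => //; exact: measurable_indic.
Qed.

(** Chernoff bound for the count of small p-values minus [t] times the count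
    of large sizes. This difference is a sum of independent terms even though
    the number of large sizes is random; its null mean is [0]. *)
Lemma count_lower_tail (la z : R) : (0 <= la <= 2^-1)%R ->
  covered P [set w | excess w <= z]%R
   (expR (la * z + n%:R *
     (- la * (e * (s1 - q * t)) + 2 * la ^+ 2 * (e * (s1 - q * t) + 2 * (q * t))))).
Proof.
move=> la01; have /andP[la0 la1] := la01.
pose h z := expR (- (la * xi z)).
have mh : measurable_fun setT h.
  apply: (measurableT_comp (@measurable_expR R)).
  by apply: measurableT_comp => //; exact: measurable_funM.
have h0 z' : (0 <= h z')%R by exact: expR_ge0.
pose B : R := ((1 - delta) + (1 - la + 2 * la ^+ 2) * delta + (la * t + 2 * la ^+ 2 * t) * q)%R.
have lq : (0 <= 1 - la + 2 * la ^+ 2)%R by have := sqr_ge0 la; lra.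
have lt : (0 <= la * t + 2 * la ^+ 2 * t)%R.
  by rewrite addr_ge0// ?mulr_ge0 ?sqr_ge0// ltW.
have Ih : \int[obs_law Q F0 F1 e0 e1]_z (h z)%:E <= B%:E.
  apply: (@le_trans _ _ (\int[obs_law Q F0 F1 e0 e1]_z ((\1_(~` D) z)%:E +
     (1 - la + 2 * la ^+ 2)%:E * (\1_D z)%:E + (la * t + 2 * la ^+ 2 * t)%:E * (\1_C z)%:E))).
    apply: ge0_le_integral => //.
    - by move=> z' _; rewrite lee_fin.
    - exact/measurable_EFinP.
    - apply: emeasurable_funD; last first.
        by apply: measurable_funeM; apply/measurable_EFinP; exact: measurable_indic.
      apply: emeasurable_funD; first by apply/measurable_EFinP; apply: measurable_indic; exact: measurableC.
      by apply: measurable_funeM; apply/measurable_EFinP; exact: measurable_indic.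
    move=> z' _; rewrite -!EFinM -!EFinD lee_fin /h /xi !indicE in_setC.
    apply: excess_factor_le => //; first by case/andP: t01 => /ltW -> /ltW ->.
    by apply/implyP; rewrite !inE => -[].
  have mE (A : set (nat * (R * R))) : measurable A ->
      measurable_fun setT (fun z => (\1_A z)%:E : \bar R).
    by move=> mA; apply/measurable_EFinP; exact: measurable_indic.
  have mCD : measurable (~` D) by exact: measurableC.
  rewrite ge0_integralD//; last 4 first.
  - by move=> z' _; rewrite adde_ge0// ?mule_ge0 ?lee_fin.
  - by apply: emeasurable_funD; [exact: mE|apply: measurable_funeM; exact: mE].
  - by move=> z' _; rewrite mule_ge0// lee_fin.
  - by apply: measurable_funeM; exact: mE.
  rewrite ge0_integralD//; last 3 first.
  - exact: mE.
  - by move=> z' _; rewrite mule_ge0// lee_fin.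
  - by apply: measurable_funeM; exact: mE.
  rewrite !ge0_integralZl//; try exact: mE.
  have IE A : measurable A -> \int[obs_law Q F0 F1 e0 e1]_z (\1_A z)%:E = obs_law Q F0 F1 e0 e1 A.
    by move=> mA; exact: integral_indicT.
  rewrite !IE//.
  have -> : obs_law Q F0 F1 e0 e1 (~` D) = (1 - delta)%:E.
    by apply: etrans (probability_setC (obs_law Q F0 F1 e0 e1) mD) _; rewrite obsD EFinB.
  by rewrite obsC obsD -!EFinM -!EFinD.
have Ih0 : 0 <= \int[obs_law Q F0 F1 e0 e1]_z (h z)%:E.
  by apply: integral_ge0 => z' _; rewrite lee_fin.
have Ifin : \int[obs_law Q F0 F1 e0 e1]_z (h z)%:E \is a fin_num.
  by rewrite ge0_fin_numE// (le_lt_trans Ih) ?ltry.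
pose m := fine (\int[obs_law Q F0 F1 e0 e1]_z (h z)%:E).
have mE : \int[obs_law Q F0 F1 e0 e1]_z (h z)%:E = m%:E by rewrite fineK.
have m0 : (0 <= m)%R by rewrite fine_ge0.
have mB : (m <= B)%R by rewrite -lee_fin -mE.
pose Z w : R := (\prod_(i < n) h (obs i w))%R.
have IZ : \int[P]_w (Z w)%:E = (m ^+ n)%:E.
  rewrite (mixture_sample_expectation HS (e0 := e0) (e1 := e1) (c := fun=> m)
    (h := fun=> h)) //.
  by rewrite prodr_const card_ord.
have mZ : measurable_fun setT Z.
  apply: measurable_fun_bigprod => i; apply: measurableT_comp => //.
  exact: measurable_obs.
have Z0 w : (0 <= Z w)%R by apply: prodr_ge0.
have IZ' : \int[P]_w (Z w)%:E <= (m ^+ n)%:E by rewrite IZ.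
have [mEv PEv] := markov_bound mZ Z0 (expR_gt0 (- (la * z))) IZ'.
exists [set w | (expR (- (la * z)) <= Z w)%R]; split => //.
  move=> w /=; rewrite excessE => hw.
  rewrite /Z /h -expR_sum ler_expR sumrN lerN2 -mulr_sumr ler_wpM2l//.
apply: (le_trans PEv); rewrite lee_fin expRN invrK mulrC expRD ler_wpM2l ?expR_ge0//.
rewrite expRM_natl lerXn2r ?nnegrE ?expR_ge0//.
apply: (le_trans mB); apply: le_trans (expR_ge1Dx _).
rewrite /B /delta le_eqVlt; apply/orP; left; apply/eqP; ring.
Qed.

(** The number of large sizes enters through the denominator of the statistic,
    hence an upper bound. *)
Lemma count_large_markov (x : R) : (0 < x)%R ->
  covered P [set w | x <= (n_above (sizes w) k)%:R]%R (n%:R * q / x).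
Proof.
move=> x0.
pose Z w : R := (\sum_(i < n) \1_C (obs i w))%R.
have ZE w : Z w = (n_above (sizes w) k)%:R.
  rewrite /n_above -sum1_card natr_sum big_mkcond/=; apply: eq_bigr => i _.
  rewrite inE indicE; have -> : (obs i w \in C) = (k <= K i w)%N.
    by apply/idP/idP; rewrite inE.
  by case: (_ <= _)%N.
have mi i : measurable_fun setT (fun w => \1_C (obs i w) : R).
  apply: (measurableT_comp (measurable_indic _)) => //; exact: measurable_obs.
have mZ : measurable_fun setT Z by exact: measurable_sum.
have Z0 w : (0 <= Z w)%R by apply: sumr_ge0.
have IZ : \int[P]_w (Z w)%:E <= (n%:R * q)%:E.
  rewrite /Z; under eq_integral do rewrite -sumEFin.
  rewrite ge0_integral_sum//; last by move=> i; exact/measurable_EFinP.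
  rewrite (eq_bigr (fun=> q%:E)).
    by rewrite sumEFin lee_fin sumr_const card_ord mulr_natl.
  move=> i _; rewrite -obsC -(mixture_sample_marginal e0 e1 HS i mC).
  have mA : measurable [set w | C (obs i w)].
    by rewrite -[X in measurable X]setTI; exact: measurable_obs.
  rewrite -(integral_indicT P mA); apply: eq_integral => w _.
  rewrite !indicE; have -> // : (w \in [set w | C (obs i w)]) = (obs i w \in C).
  by apply/idP/idP; rewrite !inE.
have [mE PE] := markov_bound mZ Z0 x0 IZ.
by exists [set w | (x <= Z w)%R]; split => // w /=; rewrite ZE.
Qed.

End Threshold.

Section Null.
Variables (th ps : R).
Hypothesis F01 : tilted F0 F1 th ps.

(** A p-value vanishes with probability zero also under the alternative, by
    absolute continuity. *)
Lemma pval_pos i : P [set w | (pval F0 (obs i w) <= 0)%R] = 0.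
Proof.
have mA : measurable [set z | (pval F0 z <= 0)%R].
  have -> : [set z | (pval F0 z <= 0)%R] = setT `&` pval F0 @^-1` `]-oo, 0%R].
    by rewrite setTI; apply/seteqP; split => z /=; rewrite in_itv.
  exact: measurable_pval.
rewrite (mixture_sample_marginal e0 e1 HS i mA) obs_lawE null_pval_le0 mule0 add0e.
rewrite -(integral_indicT (size_law Q F1) mA).
rewrite (integral_size_law_tilted F01); last 2 first.
- by apply/measurable_EFinP; exact: measurable_indic.
- by move=> z; rewrite lee_fin.
have -> : \int[size_law Q F0]_z ((lr th ps z)%:E * (\1_[set z | (pval F0 z <= 0)%R] z)%:E) =
    \int[size_law Q F0]_(z in [set z | (pval F0 z <= 0)%R]) (lr th ps z)%:E.
  rewrite [RHS]integral_mkcond; apply: eq_integral => z _.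
  rewrite /patch indicE; case: (z \in _); by rewrite ?mule1 ?mule0.
rewrite null_set_integral ?mule0//.
- by apply/measurable_EFinP; apply: measurable_funTS; exact: measurable_lr.
- exact: null_pval_le0.
Qed.

End Null.
End AlternativeCounts.

Section AlternativeStatistic.
Local Open Scope ereal_scope.
Context {R : realType}.
Variables (F0 F1 : probability R R) (th ps : R).
Hypothesis F01 : tilted F0 F1 th ps.
Variables (Q : probability nat R) (e : R).
Hypotheses (e0 : (0 <= e)%R) (e1 : (0 <= 1 - e)%R).
Variables (n : nat) (d : measure_display) (Omega : measurableType d).
Variables (P : probability Omega R) (K : 'I_n -> {mfun Omega >-> nat})
  (Y V : 'I_n -> {mfun Omega >-> R}).
Hypothesis HS : mixture_sample F0 F1 Q e P K Y V.

Local Notation obs := (obs K Y V).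
Local Notation sizes w := (fun i => K i w).
Local Notation pvals w := (fun i => pval F0 (obs i w)).

Lemma measurable_HC_thres_obs :
  measurable_fun setT (fun w => HC_thres (sizes w) (pvals w)).
Proof.
apply: measurable_HC_thres => // i.
by apply: measurableT_comp; [exact: measurable_pval|exact: measurable_obs].
Qed.

(** The excess at a single pair [(k, t)] is large and the denominator is not,
    up to the two probabilities on the right; p-values equal to zero, for
    which the terms degenerate, form a null event. *)
Lemma alternative_HC_thres_bound (k : nat) (t la x z c : R) :
  let q := fine (Q [set j | (k <= j)%N]) in
  let mu := (e * (fine (size_law Q F1 (small_pval F0 k t)) - q * t))%R in
  (1 <= k)%N -> (0 < t <= 4^-1)%R -> (0 <= la <= 2^-1)%R -> (0 < x)%R -> (2 <= z)%R ->
  (c <= z / (12 * Num.sqrt (x * t)))%R ->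
  P [set w | (HC_thres (sizes w) (pvals w) < c)%R] <=
  (expR (la * z + n%:R * (- la * mu + 2 * la ^+ 2 * (mu + 2 * (q * t)))) + n%:R * q / x)%:E.
Proof.
move=> q mu k1 /andP[t0 t4] la01 x0 z2 cz.
have t01 : (0 < t < 1)%R by rewrite t0/=; apply: (le_lt_trans t4); lra.
apply: covered_le.
  rewrite [X in measurable X](_ : _ =
      setT `&` (fun w => HC_thres (sizes w) (pvals w)) @^-1` `]-oo, c[).
    exact: measurable_HC_thres_obs.
  by rewrite setTI; apply/seteqP; split => w /=; rewrite in_itv.
have mneg (i : 'I_n) : measurable [set w | (pval F0 (obs i w) <= 0)%R].
  have -> : [set w | (pval F0 (obs i w) <= 0)%R] =
      setT `&` (fun w => pval F0 (obs i w)) @^-1` `]-oo, 0%R].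
    by rewrite setTI; apply/seteqP; split => w /=; rewrite in_itv.
  have : measurable_fun setT (fun w => pval F0 (obs i w)); last by apply.
  by apply: measurableT_comp; [exact: measurable_pval|exact: measurable_obs].
have cov0 := covered_bigcup (P := P) (m := n)
  (A := fun i => [set w | exists j : 'I_n, j = i :> nat /\ (pval F0 (obs j w) <= 0)%R]) (b := fun=> 0%R).
have cov1 := count_lower_tail e0 e1 HS k t01 z la01.
have cov2 := count_large_markov e0 e1 HS k x0.
apply: (covered_sub _ _ (coveredU (cov0 _) (coveredU cov1 cov2))).
- move=> w /= hw.
  have [[j pj]|nop] := pselect (exists j : 'I_n, (pval F0 (obs j w) <= 0)%R).
    by left; exists j => //; exists j.
  right; have [|ez] := leP (excess F0 K Y V k t w) z; first by left.
  right; rewrite leNgt; apply/negP => nx.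
  have pp i : (0 < pvals w i)%R by rewrite ltNge; apply/negP => h; apply: nop; exists i.
  have zc : (z + (n_above (sizes w) k)%:R * t <= (count_below (sizes w) (pvals w) k t)%:R)%R.
    by rewrite -lerBrDr ltW.
  have N2 : (2 <= n_above (sizes w) k)%N.
    apply: leq_trans (count_below_le (sizes w) (pvals w) k t).
    rewrite -(ler_nat R); apply: (le_trans z2); apply: le_trans zc.
    by rewrite lerDl mulr_ge0// ltW.
  have hHC := HC_of_count pp t0 t4 z2 zc.
  have : (c <= HC_thres (sizes w) (pvals w))%R.
    apply: (le_trans cz); apply: le_trans (HC_le_HC_thres (pvals w) k1 N2).
    apply: le_trans hHC.
    have nk0 : (0 < (n_above (sizes w) k)%:R :> R)%R by rewrite ltr0n; exact: leq_trans N2.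
    apply: ler_wpM2l; first by lra.
    rewrite lef_pV2 ?posrE ?mulr_gt0 ?sqrtr_gt0 ?mulr_gt0//.
    by rewrite ler_pM2l// ler_wsqrtr// ler_pM2r// ltW.
  by rewrite leNgt hw.
- by rewrite sumr_const_nat subn0 mul0rn add0r.
- move=> j jn; apply: (covered_sub _ (lexx _) (covered_measurable (mneg (Ordinal jn)) _)).
    by move=> w [i [ij pi]] /=; rewrite (_ : Ordinal jn = i)//; apply/val_inj.
  by rewrite (pval_pos e0 e1 HS F01).
Qed.

End AlternativeStatistic.

(** The mean excess [E] dominates both a large number [X] and [X] times the
    standard deviation [sqrt T] of the null count. The optimal Chernoff
    parameter at half of the mean is of order [E / (E + 2 * T)]. *)
Lemma excess_exponent (R : realType) (E T X : R) :
  0 < X -> 0 <= T -> X <= E -> X ^+ 2 * T <= E ^+ 2 -> 1 <= X ->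
  exists la, [/\ 0 <= la <= 2^-1 &
    la * (E / 2) + (- la * E + 2 * la ^+ 2 * (E + 2 * T)) <= - (X / 96)].
Proof.
move=> X0 T0 XE XT X1; have E0 : 0 < E by exact: lt_le_trans XE.
have D0 : 0 < E + 2 * T by rewrite ltr_pwDl// mulr_ge0.
exists (E / (8 * (E + 2 * T))).
split.
  have D80 : 0 < 8 * (E + 2 * T) by rewrite mulr_gt0.
  by rewrite divr_ge0 ?(ltW E0) ?(ltW D80)//= ler_pdivrMr//; lra.
have -> : E / (8 * (E + 2 * T)) * (E / 2) + (- (E / (8 * (E + 2 * T))) * E +
    2 * (E / (8 * (E + 2 * T))) ^+ 2 * (E + 2 * T)) = - (E ^+ 2 / (32 * (E + 2 * T))).
  by field; rewrite gt_eqF.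
rewrite lerN2 ler_pdivlMr ?mulr_gt0//.
have h1 : X * E <= E ^+ 2 by rewrite expr2 ler_pM2r.
have h2 : X * T <= E ^+ 2.
  by apply: le_trans XT; rewrite ler_wpM2r// expr2 -[leLHS]mulr1 ler_pM2l.
by move: (E ^+ 2) h1 h2 => F h1 h2; lra.
Qed.

Lemma excess_cutoff (R : realType) (E T X c : R) :
  0 < X -> 0 < T -> 0 < E -> X ^+ 2 * T <= E ^+ 2 -> 0 <= c -> 576 * c ^+ 2 <= X ->
  c <= E / 2 / (12 * Num.sqrt (X * T)).
Proof.
move=> X0 T0 E0 XT c0 cX.
have s0 : 0 < Num.sqrt (X * T) by rewrite sqrtr_gt0 mulr_gt0.
rewrite ler_pdivlMr ?mulr_gt0// ler_pdivlMr//.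
rewrite -ler_sqr ?nnegrE ?mulr_ge0 ?(ltW s0) ?(ltW E0)//.
rewrite !exprMn sqr_sqrtr; last by rewrite mulr_ge0// ltW.
apply: le_trans XT; rewrite [X ^+ 2]expr2 -[X * X * T]mulrA.
have -> : c ^+ 2 * (12 ^+ 2 * (X * T)) * 2 ^+ 2 = (576 * c ^+ 2) * (X * T) by ring.
by rewrite ler_pM2r// mulr_gt0.
Qed.

(** Here [G = theta * nu - psi theta], [y = I(nu)], and [sg], [ta] are the
    exponents of the probabilities of a small p-value under the alternative
    and the null law, with losses of order [dl]; [ep1] is the exponent of the
    mean excess. The three conclusions say that the signal dominates the null
    probability, that the mean excess is large, and that it dominates the
    standard deviation. *)
Lemma detection_exponents (R : realType) (a y G Ja be be' dl sg ta ep1 : R) :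
  0 < a -> a * y + Ja <= 1 -> be' <= a * G + 2^-1 * (1 - (a * y + Ja)) ->
  (10 * a + 8) * dl <= be' - be -> 0 <= dl -> (6 * a + 5) * dl <= a * G ->
  sg = a * (G - y) - Ja - (4 * a + 2) * dl ->
  ta = - Ja - a * y + (2 + 2 * a) * dl -> ep1 = 1 - be + sg - dl ->
  [/\ ta <= sg - dl, (be' - be) / 2 <= ep1 & (be' - be) + 1 + ta <= 2 * ep1].
Proof.
move=> a0 g1 fb hdl dl0 aG -> -> ->.
have adl : 0 <= a * dl by rewrite mulr_ge0// ltW.
by split; nra.
Qed.

Lemma signal_exponent (R : realType) (L k a y G Ja Jk dl : R) :
  L * Jk <= L * (Ja + dl) ->
  (a * L + 1) * (G - y - 4 * dl) <= k * (G - y - 4 * dl) ->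
  y + 4 * dl - G <= L * dl ->
  L * (a * (G - y) - Ja - (4 * a + 2) * dl) <=
  - (dl * k) - L * Jk + k * (G - y - 3 * dl).
Proof. by move=> *; lra. Qed.

Lemma two_expRN_le (R : realType) (u : R) : 7 <= u -> 2 * expR (- u) <= 4^-1.
Proof.
move=> u7; rewrite expRN ler_pdivrMr ?expR_gt0//.
by have := expR_ge1Dx u; lra.
Qed.

Section AlternativeAsymptotics.
Context {R : realType}.
Variables (F0 F1 : probability R R) (th a0 : R) (J : R -> R).
Local Notation Th := (natural_space F0).
Local Notation ps := (psi F0).
Hypotheses (a0_gt0 : 0 < a0) (J_vanishes : rate_vanishes a0 J)
  (J_derivative : rate_derivative a0 J).
Hypothesis Tth : Th th.
Hypothesis F01 : tilted F0 F1 th (ps th).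
Variables (nu a y be be' : R).
Hypotheses (a0a : a0 <= a) (rateE : rate_I F0 nu = y%:E) (G_gt0 : 0 < th * nu - ps th).

Let G := th * nu - ps th.

Let rate_ge t : Th t -> t * nu - ps t <= y.
Proof. by move=> Tt; rewrite -lee_fin -rateE; apply: ereal_sup_ubound; exists t. Qed.

(** The rate at [nu] need not be attained, and the window has to be narrow on
    the scale of both tilts. *)
Lemma near_optimal_tilt (dl : R) : 0 < dl -> exists t eta,
  [/\ Th t, y - dl < t * nu - ps t, 0 < eta <= dl, `|t| * eta <= dl & `|th| * eta <= dl].
Proof.
move=> dl0.
have : ((y - dl)%:E < rate_I F0 nu)%E by rewrite rateE lte_fin ltrBlDr ltrDl.
move=> /ereal_sup_gt[_ [t Tt <-]]; rewrite lte_fin => ht.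
pose m := 1 + `|t| + `|th|.
have m1 : 1 <= m by rewrite /m -addrA lerDl addr_ge0.
have m0 : 0 < m by exact: lt_le_trans m1.
have le u : 0 <= u -> u <= m -> u * (dl / m) <= dl.
  by move=> u0 um; rewrite mulrA ler_pdivrMr// mulrC ler_pM2l.
exists t, (dl / m); split => //.
- by rewrite divr_gt0//= -[leLHS]mul1r le.
- by apply: le => //; rewrite /m addrAC lerDr addr_ge0.
- by apply: le => //; rewrite /m lerDr addr_ge0.
Qed.

(** The window around [k * nu] costs [exp (- k * y)] under the null law and
    [exp (- k * (y - G))] under the alternative, and all its p-values are about
    [exp (- k * y)]. *)
Lemma window_signal (dl : R) : 0 < dl -> exists N, forall k, (N <= k)%N ->
  forall Q : probability nat R,
  (Q [set k] * (expR (k%:R * (G - y - 3 * dl)))%:E <=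
   size_law Q F1 (small_pval F0 k (2 * expR (- (k%:R * (y - 2 * dl))))))%E.
Proof.
move=> dl0; have [t [eta [Tt ht /andP[eta0 etadl] te the]]] := near_optimal_tilt dl0.
have [|N HN] := cramer_lower_bound (F := F0) (nu := nu) (r := y + dl) eta0.
  move=> s; have [Ts|nTs] := pselect (Th s).
    rewrite natural_space_shift// lte_fin ltr_expR.
    by have := rate_ge Ts; lra.
  have -> : (\int[F0]_x (expR (s * x - s * nu))%:E = +oo)%E; last exact: ltry.
  apply/eqP; rewrite -leye_eq leNgt; apply/negP => h; apply: nTs.
  move: h; rewrite integral_expR_shift /natural_space/= mgf_integral.
  case: (\int[F0]_x _)%E => [r _| |//]; first exact: ltry.
  by rewrite gt0_muley// lte_fin expR_gt0.
exists N => k Nk Q.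
set W := window (k%:R * nu) (k%:R * eta).
have mW : measurable W by exact: measurable_window.
have F0W := HN k Nk; rewrite -/W in F0W.
have F1W : ((expR (k%:R * (G - y - 3 * dl)))%:E <= conv_pow F1 k W)%E.
  rewrite (tilted_conv_pow k F01 mW).
  apply: (@le_trans _ _ (\int[conv_pow F0 k]_(x in W) (cst (expR (k%:R * (G - dl)))%:E x))%E).
    rewrite integral_cst//; apply: (@le_trans _ _ ((expR (k%:R * (G - dl)))%:E *
        (expR (- (k%:R * (y + dl + eta))))%:E)%E); last by rewrite lee_wpmul2l// lee_fin expR_ge0.
    rewrite -EFinM -expRD lee_fin ler_expR.
    have -> : k%:R * (G - dl) + - (k%:R * (y + dl + eta)) = k%:R * (G - y - (2 * dl + eta)) by ring.
    by rewrite ler_wpM2l// lerD2l lerN2; move: etadl; lra.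
  apply: ge0_le_integral => //.
  - by move=> x _; rewrite lee_fin expR_ge0.
  - by apply/measurable_EFinP; apply: measurable_funTS; exact: measurable_expR_affine.
  move=> x /windowP Wx; rewrite lee_fin ler_expR.
  have : - (th * (x - k%:R * nu)) <= k%:R * dl.
    apply: (le_trans (ler_norm _)); rewrite normrN normrM.
    apply: (@le_trans _ _ (`|th| * (k%:R * eta))); first by rewrite ler_wpM2l.
    by rewrite mulrCA ler_wpM2l.
  by rewrite /G !mulrBr; lra.
pose B := [set v : R | 0 <= v <= 1].
have mB : measurable B by exact: measurable_unit.
apply: (@le_trans _ _ (size_law Q F1 [set z | [/\ z.1 = k, W z.2.1 & B z.2.2]])).
  by rewrite size_law_rect// unif01_range mule1 lee_wpmul2l.
apply: le_measure; rewrite ?inE.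
- by apply: size_rect_measurable; right; exists k, W, B.
- exact: measurable_small_pval_set.
move=> [j [x v]] /= [-> Wx Bv]; split => //=.
apply: (le_trans (pval_window Tt Bv Wx)); rewrite ler_pM2l// ler_expR lerN2 ler_wpM2l//.
by move: ht te; lra.
Qed.

Variables (Q : nat -> probability nat R) (alpha : nat -> nat -> R).
Hypothesis Q_rate : sizes_follow_rate a0 J Q alpha.
Hypotheses (be_gt0 : 0 < be) (bebe' : be < be').
Hypothesis curve_le1 : a * y + J a <= 1.
Hypothesis curve_ge : be' <= a * G + 2^-1 * (1 - (a * y + J a)).

Let a_gt0 : 0 < a. Proof. exact: lt_le_trans a0a. Qed.
Let Gy : G <= y. Proof. exact: rate_ge Tth. Qed.
Let y_gt0 : 0 < y. Proof. exact: lt_le_trans Gy. Qed.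

Definition size_cutoff (n : nat) : nat := (Num.truncn (a * lnn n)).+1.

Lemma size_cutoff_bounds n : 0 <= lnn n :> R ->
  a * lnn n <= (size_cutoff n)%:R <= a * lnn n + 1.
Proof.
move=> L0; rewrite ltW ?truncnS_gt//= /size_cutoff -natr1 lerD2r truncn_le//.
by rewrite mulr_ge0// ltW.
Qed.

(** Only the sizes equal to the cut-off [k], about [a * log n], are used for
    the signal, while all larger sizes enter the null count; by
    [size_prob_bounds] and [size_tail] both have the exponent [- J a]. *)
Lemma signal_rates (dl : R) : 0 < dl -> 2 * dl <= y -> \forall n \near \oo,
  let k := size_cutoff n in
  let t := 2 * expR (- (k%:R * (y - 2 * dl))) in
  let q := fine (Q n [set j | (k <= j)%N]) in
  [/\ 0 < q,
   expR (lnn n * (a * (G - y) - J a - (4 * a + 2) * dl)) <=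
     fine (size_law (Q n) F1 (small_pval F0 k t)) &
   q * t <= expR (lnn n * (- J a - a * y + (2 + 2 * a) * dl))].
Proof.
move=> dl0 dly.
have [N HN] := window_signal dl0.
have bnds := size_prob_bounds Q_rate dl0.
have tail := size_tail a0_gt0 J_vanishes J_derivative Q_rate a0a dl0.
have [r r0 Hr] : exists2 r, 0 < r & forall b, `|a - b| < r -> J b <= J a + dl.
  have /cvgrPdist_le /(_ _ dl0) [r /= r0 Hr] := rate_continuous_at J_derivative a0a.
  exists r => // b ab; have := Hr b ab; rewrite ler_distlC => /andP[_].
  by [].
near=> n; set k := size_cutoff n; set t := 2 * expR (- (k%:R * (y - 2 * dl))).
set q := fine (Q n [set j | (k <= j)%N]); set L := lnn n : R.
have L1 : 1 <= L by rewrite /L; near: n; exact: near_lnn_ge.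
have L0 : 0 < L by exact: lt_le_trans L1.
have Ln0 : L != 0 by rewrite gt_eqF.
have LN : N%:R / a <= L by rewrite /L; near: n; exact: near_lnn_ge.
have Lr : 2 / r <= L by rewrite /L; near: n; exact: near_lnn_ge.
have Lc : (y + 4 * dl) / dl <= L by rewrite /L; near: n; exact: near_lnn_ge.
have L2 : 1 / dl <= L by rewrite /L; near: n; exact: near_lnn_ge.
have Hb : forall k : nat, (0 < k)%N -> a0 * L <= k%:R ->
    expR (- (dl * k%:R) - L * J (k%:R / L)) <= fine (Q n [set k])
      <= expR (dl * k%:R - L * J (k%:R / L)) by rewrite /L; near: n.
have Ht : (Q n [set k | (a * L <= k%:R)%R] <= (expR (- (J a - dl) * L))%:E)%E.
  by rewrite /L; near: n.
have /andP[k1 k2] : a * L <= k%:R <= a * L + 1 by exact: size_cutoff_bounds (ltW L0).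
have k0 : (0 < k)%N by [].
have Nk : (N <= k)%N.
  rewrite -(ler_nat R); apply: le_trans k1; move: LN.
  by rewrite ler_pdivrMr// mulrC.
have a0k : a0 * L <= k%:R by apply: le_trans k1; rewrite ler_pM2r.
have Jk : J (k%:R / L) <= J a + dl.
  apply: Hr.
  have h1 : a <= k%:R / L by rewrite ler_pdivlMr.
  have h2 : k%:R / L <= a + L^-1 by rewrite ler_pdivrMr// mulrDl mulVf.
  have h3 : L^-1 < r.
    rewrite invf_plt ?posrE//; apply: lt_le_trans Lr.
    by rewrite -[ltLHS]mul1r ltr_pM2r ?invr_gt0// ltr1n.
  by rewrite ler0_norm; lra.
have /andP[Qk _] := Hb k k0 a0k.
have Qfin A : (fine (Q n A))%:E = Q n A by rewrite fineK// fin_num_measure.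
have Qkq : fine (Q n [set k]) <= q.
  by rewrite -lee_fin !Qfin; apply: le_measure; rewrite ?inE// => j -> /=.
have qle : q <= expR (- (J a - dl) * L).
  rewrite -lee_fin Qfin; apply: le_trans Ht; apply: le_measure; rewrite ?inE// => j /= kj.
  by apply: (le_trans k1); rewrite ler_nat.
split.
- by apply: lt_le_trans Qkq; apply: lt_le_trans Qk; exact: expR_gt0.
- have := HN k Nk (Q n); rewrite -/t.
  have fin : size_law (Q n) F1 (small_pval F0 k t) \is a fin_num.
    rewrite ge0_fin_numE//; apply: (@le_lt_trans _ _ (size_law (Q n) F1 (large_size k))).
      apply: le_measure; rewrite ?inE; [exact: measurable_small_pval_set|exact: measurable_large_size|].
      by move=> z [].
    by rewrite size_law_large -Qfin ltry.
  rewrite -[X in (X * _)%E]Qfin -EFinM -[leRHS]fineK// lee_fin; apply: le_trans.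
  apply: (@le_trans _ _ (expR (- (dl * k%:R) - L * J (k%:R / L)) * expR (k%:R * (G - y - 3 * dl)))).
    rewrite -expRD ler_expR.
    have LJ : L * J (k%:R / L) <= L * (J a + dl) by rewrite ler_pM2l.
    have kk : (a * L + 1) * (G - y - 4 * dl) <= k%:R * (G - y - 4 * dl).
      rewrite ler_wnM2r// subr_le0 (@le_trans _ _ 0) ?subr_le0//.
      by rewrite mulr_ge0// ltW.
    have Lc' : y + 4 * dl - G <= L * dl.
      by apply: (@le_trans _ _ (y + 4 * dl)); [rewrite lerBlDr lerDl ltW|rewrite -ler_pdivrMr].
    exact: signal_exponent LJ kk Lc'.
  by rewrite ler_wpM2r ?expR_ge0.
rewrite /t mulrCA.
have e2 : 2 <= expR (L * dl).
  apply: le_trans (expR_ge1Dx _); rewrite -[X in X <= _]/(1 + 1) lerD2l.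
  by rewrite -ler_pdivrMr.
apply: (@le_trans _ _ (expR (L * dl) * (expR (- (J a - dl) * L) *
    expR (- (a * L * (y - 2 * dl)))))).
  apply: ler_pM => //; first by rewrite mulr_ge0 ?expR_ge0// fine_ge0.
  apply: ler_pM => //; rewrite ?expR_ge0 ?fine_ge0// ler_expR lerN2.
  by rewrite ler_wpM2r//; lra.
by rewrite -!expRD ler_expR; lra.
Unshelve. all: by end_near.
Qed.

Variables (d : nat -> measure_display) (Omega : forall n, measurableType (d n))
  (P : forall n, probability (Omega n) R)
  (K : forall n, 'I_n -> {mfun Omega n >-> nat})
  (Y V : forall n, 'I_n -> {mfun Omega n >-> R}).
Hypothesis HS : forall n,
  mixture_sample F0 F1 (Q n) (n%:R `^ (- be)) (P n) (@K n) (@Y n) (@V n).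

(** A detectable point leaves a margin [be' - be] in the exponents. Half of it
    becomes a power [X] of [n] by which the mean excess dominates the standard
    deviation, and the losses [dl] are small enough for the rest. *)
Lemma alternative_HC_thres_large (ep : R) : 0 < ep -> \forall n \near \oo,
  (P n [set w | (HC_thres (fun i => @K n i w)
      (fun i => pval F0 (obs (@K n) (@Y n) (@V n) i w)) < 2 * lnn n ^+ 2)%R] <= ep%:E)%E.
Proof.
move=> ep0.
pose ga := be' - be; have ga0 : 0 < ga by rewrite subr_gt0.
have a10 : 0 < 10 * a + 8 by rewrite ltr_wpDl// mulr_ge0// ltW.
have a6 : 0 < 6 * a + 5 by rewrite ltr_wpDl// mulr_ge0// ltW.
have aG0 : 0 < a * G by rewrite mulr_gt0.
pose dl := Num.min (y / 4) (Num.min (ga / (10 * a + 8)) (a * G / (6 * a + 5))).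
have dl0 : 0 < dl by rewrite !lt_min !divr_gt0.
have dly : dl <= y / 4 by rewrite ge_min lexx.
have dlga : (10 * a + 8) * dl <= ga.
  by rewrite mulrC -ler_pdivlMr// !ge_min lexx orbT.
have dlG : (6 * a + 5) * dl <= a * G.
  by rewrite mulrC -ler_pdivlMr// !ge_min lexx !orbT.
have ydl : y / 2 <= y - 2 * dl by move: dly; lra.
have dly2 : 2 * dl <= y by move: dly y_gt0; lra.
have [H1 H2 H3] := detection_exponents a_gt0 curve_le1 curve_ge dlga (ltW dl0) dlG
  erefl erefl erefl.
set sg := a * (G - y) - J a - (4 * a + 2) * dl in H1 H2 H3.
set ta := - J a - a * y + (2 + 2 * a) * dl in H1 H3.
set ep1 := 1 - be + sg - dl in H2 H3.
pose ka := ga / 2; have ka0 : 0 < ka by rewrite divr_gt0.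
have rates := signal_rates dl0 dly2.
near=> n; set L := lnn n : R.
set k := size_cutoff n; set t := 2 * expR (- (k%:R * (y - 2 * dl))).
pose q := fine (Q n [set j | (k <= j)%N]).
pose s1 := fine (size_law (Q n) F1 (small_pval F0 k t)).
have [q0 s1_ge qt_le] : [/\ 0 < q, expR (L * sg) <= s1 & q * t <= expR (L * ta)].
  by rewrite /s1 /q /t /k /L; near: n.
have n0 : (0 < n)%N by near: n; exact: nbhs_infty_gt.
have L1 : 1 <= L by rewrite /L; near: n; exact: near_lnn_ge.
have L0 : 0 < L by exact: lt_le_trans L1.
have Ldl : 1 / dl <= L by rewrite /L; near: n; exact: near_lnn_ge.
have Lay : 14 / (a * y) <= L by rewrite /L; near: n; exact: near_lnn_ge.
pose X := expR (ka * L).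
have X576 : 2304 * L ^+ 4 <= X by rewrite /X /L; near: n; exact: near_expR_ge.
have Xep : 192 / ep <= X.
  by rewrite -[leLHS]mulr1 -[X in _ * X](expr0 L) /X /L; near: n; exact: near_expR_ge.
have X4 : 4 <= X.
  by rewrite -[leLHS]mulr1 -[X in _ * X](expr0 L) /X /L; near: n; exact: near_expR_ge.
have X0 : 0 < X by exact: expR_gt0.
have t0 : 0 < t by rewrite mulr_gt0// expR_gt0.
have nE : n%:R = expR L :> R by rewrite expR_lnn.
have eE : n%:R `^ (- be) = expR (- be * L) by rewrite powR_lnn.
have e0 : 0 <= expR (- be * L) by exact: expR_ge0.
have e1 : 0 <= 1 - expR (- be * L).
  by rewrite subr_ge0 -[leRHS]expR0 ler_expR mulNr oppr_le0 mulr_ge0// ltW.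
have HSn := HS n; rewrite eE in HSn.
pose mean := expR (- be * L) * (s1 - q * t).
pose E := n%:R * mean.
pose T := n%:R * (q * t).
have nR0 : 0 < n%:R :> R by rewrite ltr0n.
have T0 : 0 < T by apply: mulr_gt0 => //; exact: mulr_gt0.
have e2 : 2 <= expR (L * dl).
  apply: le_trans (expR_ge1Dx _); rewrite -[X in X <= _]/(1 + 1) lerD2l.
  by rewrite -ler_pdivrMr.
have E_ge : expR (L * ep1) <= E.
  rewrite /E /mean nE mulrA -expRD.
  have -> : L * ep1 = L + - be * L + L * (sg - dl) by rewrite /ep1; ring.
  rewrite [leLHS]expRD ler_wpM2l ?expR_ge0//.
  have sgE : expR (L * sg) = expR (L * dl) * expR (L * (sg - dl)).
    by rewrite -expRD; congr expR; ring.
  have taE : expR (L * ta) <= expR (L * (sg - dl)) by rewrite ler_expR ler_pM2l.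
  have h : 2 * expR (L * (sg - dl)) <= expR (L * sg).
    by rewrite sgE ler_wpM2r ?expR_ge0.
  rewrite lerBrDr; apply: le_trans s1_ge; apply: le_trans h.
  by rewrite mulr_natl mulr2n lerD2l; exact: le_trans taE.
have E0 : 0 < E by apply: lt_le_trans E_ge; exact: expR_gt0.
have XE : X <= E.
  by apply: le_trans E_ge; rewrite ler_expR mulrC ler_pM2l.
have XT : X ^+ 2 * T <= E ^+ 2.
  apply: (@le_trans _ _ (expR (L * ep1) ^+ 2)); last first.
    by rewrite lerXn2r ?nnegrE ?expR_ge0// ltW.
  apply: (@le_trans _ _ (X ^+ 2 * (expR L * expR (L * ta)))).
    by rewrite ler_wpM2l ?sqr_ge0// /T nE ler_wpM2l ?expR_ge0.
  rewrite /X -!expRM_natl -!expRD ler_expR.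
  have -> : 2 * (ka * L) + (L + L * ta) = L * (ga + 1 + ta) by rewrite /ka; field.
  by rewrite mulrCA ler_pM2l.
have t4 : 0 < t <= 4^-1.
  rewrite t0/= /t.
  have /andP[k1 _] := size_cutoff_bounds (n := n) (ltW L0).
  have h7 : 7 <= k%:R * (y - 2 * dl).
    apply: (@le_trans _ _ ((a * L) * (y / 2))).
      move: Lay; rewrite ler_pdivrMr ?mulr_gt0//.
      have -> : a * L * (y / 2) = L * (a * y) / 2 by field.
      by rewrite ler_pdivlMr// -natrM.
    apply: ler_pM => //.
    - by rewrite mulr_ge0 ?ltW.
    - by rewrite divr_ge0 ?ltW.
  exact: two_expRN_le.
have [la [la01 hla]] := excess_exponent X0 (ltW T0) XE XT (le_trans (ler1n _ 4 : 1 <= 4) X4).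
(* The statistic is of order [E / sqrt (X * T)], at least [sqrt X], when the
   number of large sizes is at most [X] times its mean; Markov inequality
   makes the complement negligible. *)
have cut : 2 * L ^+ 2 <= E / 2 / (12 * Num.sqrt (n%:R * q * X * t)).
  have -> : n%:R * q * X * t = X * T by rewrite /T; ring.
  apply: excess_cutoff => //; first by rewrite mulr_ge0 ?sqr_ge0.
  apply: le_trans X576; rewrite exprMn -exprM mulrA le_eqVlt; apply/orP; left.
  by rewrite -natrX -natrM.
have z2 : 2 <= E / 2 by rewrite ler_pdivlMr// -natrM; exact: le_trans XE.
have x0 : 0 < n%:R * q * X by apply: mulr_gt0 => //; exact: mulr_gt0.
apply: (le_trans (alternative_HC_thres_bound F01 e0 e1 HSn (isT : (1 <= k)%N) t4 la01 x0 z2 cut)).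
rewrite lee_fin -/q -/s1 -/mean.
have -> : n%:R * q / (n%:R * q * X) = X^-1.
  by rewrite invfM mulrA divff ?mul1r// gt_eqF// mulr_gt0.
have -> : n%:R * (- la * mean + 2 * la ^+ 2 * (mean + 2 * (q * t))) =
    - la * E + 2 * la ^+ 2 * (E + 2 * T) by rewrite /E /T; ring.
have hexp : expR (la * (E / 2) + (- la * E + 2 * la ^+ 2 * (E + 2 * T))) <= 96 / X.
  apply: (@le_trans _ _ (expR (- (X / 96)))); first by rewrite ler_expR.
  rewrite expRN -[96 / X]invf_div lef_pV2 ?posrE ?expR_gt0 ?divr_gt0//.
  by apply: le_trans (expR_ge1Dx _); rewrite lerDr.
apply: (le_trans (lerD hexp (lexx _))).
rewrite -[X in _ + X]mul1r -mulrDl ler_pdivrMr//.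
by move: Xep; rewrite ler_pdivrMr// mulrC; apply: le_trans; rewrite -[X in _ + X]/(1%:R) -natrD ler_nat.
Unshelve. all: by end_near.
Qed.

End AlternativeAsymptotics.

(** * The phase transition *)

Section PowerfulBelowCurve.
Context {R : realType} {d : nat -> measure_display}
  {Omega : forall n, measurableType (d n)}.
Variables (P0 P1 : forall n, probability (Omega n) R)
  (T : forall n, Omega n -> R) (c : nat -> R).
Hypothesis mT : forall n, measurable_fun setT (@T n).
Hypothesis c_gt0 : \forall n \near \oo, 0 < c n.
Hypothesis null_small : forall e, 0 < e -> \forall n \near \oo,
  (P0 n [set w | (c n <= @T n w)%R] <= e%:E)%E.
Hypothesis alternative_large : forall e, 0 < e -> \forall n \near \oo,
  (P1 n [set w | (@T n w < 2 * c n)%R] <= e%:E)%E.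

(** The reversed rejection region is used only when the statistic is
    stochastically smaller under the alternative; separation excludes this,
    and the factor two leaves room for an atom at the cut-off. *)
Lemma powerful_of_separation : asymptotically_powerful P0 P1 T.
Proof.
apply: cvge_of_bounds => e e0.
pose r := Num.min (e / 2) 4^-1.
have r0 : 0 < r by rewrite lt_min divr_gt0//= invr_gt0.
have re : r <= e / 2 by rewrite ge_min lexx.
have r4 : r <= 4^-1 by rewrite ge_min lexx orbT.
have h0 := null_small r0; have h1 := alternative_large r0.
near=> n.
have c0 : 0 < c n by near: n.
have H0 : (P0 n [set w | (c n <= @T n w)%R] <= r%:E)%E by near: n.
have H1 : (P1 n [set w | (@T n w < 2 * c n)%R] <= r%:E)%E by near: n.
have mlt (x : R) : measurable [set w | @T n w < x].
  have -> : [set w | @T n w < x] = setT `&` @T n @^-1` `]-oo, x[.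
    by rewrite setTI; apply/seteqP; split => w /=; rewrite in_itv.
  exact: mT.
have mgt (x : R) : measurable [set w | x < @T n w].
  have -> : [set w | x < @T n w] = setT `&` @T n @^-1` `]x, +oo[.
    by rewrite setTI; apply/seteqP; split => w /=; rewrite in_itv/= andbT.
  exact: mT.
have mge (x : R) : measurable [set w | x <= @T n w].
  have -> : [set w | x <= @T n w] = setT `&` @T n @^-1` `[x, +oo[.
    by rewrite setTI; apply/seteqP; split => w /=; rewrite in_itv/= andbT.
  exact: mT.
rewrite sub0r add0r; apply/andP; split.
  apply: (@le_trans _ _ 0%E); first by rewrite lee_fin oppr_le0 ltW.
  by apply: risk_ge => x; rewrite adde_ge0.
have nstoch : ~ stoch_smaller (P0 n) (P1 n) (@T n).
  move=> /(_ (c n)); apply/negP; rewrite -ltNge.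
  apply: (@le_lt_trans _ _ r%:E).
    by apply: le_trans H0; apply: le_measure; rewrite ?inE// => w /= /ltW.
  apply: (@lt_le_trans _ _ (1 - r)%:E); first by rewrite lte_fin; lra.
  have := probability_setC (P1 n) (mgt (c n)).
  have fn : P1 n [set w | c n < @T n w] \is a fin_num by exact: fin_num_measure.
  have hC : (P1 n (~` [set w | (c n < @T n w)%R]) <= r%:E)%E.
    apply: le_trans H1; apply: le_measure; rewrite ?inE//; first exact: measurableC.
    move=> w /= /negP; rewrite -leNgt => h; apply: (le_lt_trans h).
    by rewrite mulr_natl mulr2n ltrDl.
  move=> E; move: hC; rewrite E -(fineK fn) -EFinB !lee_fin; lra.
rewrite /risk; case: ifPn => [/asboolP //|_].
apply: (@le_trans _ _ (P0 n [set w | (c n <= @T n w)%R] + P1 n [set w | (@T n w < c n)%R])%E).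
  by apply: ereal_inf_lbound; exists (c n).
apply: (@le_trans _ _ (r%:E + r%:E)%E); last by rewrite -EFinD lee_fin; lra.
apply: leeD => //; apply: le_trans H1; apply: le_measure; rewrite ?inE// => w /=.
by move=> h; apply: (lt_le_trans h); rewrite mulr_natl mulr2n lerDl ltW.
Unshelve. all: by end_near.
Qed.

End PowerfulBelowCurve.

Theorem theorem2 (R : realType)
  (F : R -> probability R R)
  (F_exp : exponential_family F)
  (F0_nondegenerate : forall c : R, F 0 [set c] <> 1%E)
  (a0 : R) (J : R -> R) (a0_gt0 : 0 < a0)
  (J_vanishes : rate_vanishes a0 J) (J_derivative : rate_derivative a0 J)
  (Q : nat -> probability nat R) (Q_pos : forall n, Q n [set 0%N] = 0%E)
  (alpha : nat -> nat -> R) (Q_rate : sizes_follow_rate a0 J Q alpha)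
  (beta : R) (beta_gt0 : 0 < beta) (beta_lt1 : beta < 1)
  (theta : R) (theta_in : natural_space (F 0) theta) (theta_neq0 : theta != 0)
  (theta_mean : psi_derivable (F 0) theta)
  (theta_rate : (a0%:E * rate_I (F 0%R) (mu (F 0%R) theta) <= 1)%E)
  (d : nat -> measure_display) (Omega : forall n, measurableType (d n))
  (P0 P1 : forall n, probability (Omega n) R)
  (K : forall n, 'I_n -> {mfun Omega n >-> nat})
  (Y V : forall n, 'I_n -> {mfun Omega n >-> R})
  (H0 : forall n, mixture_sample (F 0) (F theta) (Q n) 0 (P0 n) (K n) (Y n) (V n))
  (H1 : forall n, mixture_sample (F 0) (F theta) (Q n) (n%:R `^ (- beta))
                    (P1 n) (K n) (Y n) (V n)) :
  ((b_curve (F 0%R) J theta < beta%:E)%E ->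
     forall T : forall n,
         {mfun n.-tuple (nat * R)%type >-> R},
       asymptotically_powerless P0 P1
         (fun n w => T n [tuple (K n i w, Y n i w) | i < n])) /\
  ((beta%:E < b_curve (F 0%R) J theta)%E ->
     asymptotically_powerful P0 P1
       (fun n w => HC_thres (fun i => K n i w)
          (fun i => pvalue (F 0) (K n i w) (Y n i w) (V n i w)))).
Proof.
have F01 : tilted (F 0) (F theta) theta (psi (F 0) theta).
  by move=> A mA; exact: F_exp.
split=> [above T|below].
  exact: (powerless_above_curve F0_nondegenerate a0_gt0 J_vanishes J_derivative
    theta_in theta_neq0 theta_mean theta_rate F01 Q_rate beta_gt0 above H0 H1).
have [nu [a [y [be' [a0a bebe' rateE G_gt0 [_ g1 fb]]]]]] :=
  point_of_lt_b_curve F0_nondegenerate a0_gt0 J_vanishes J_derivative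
    theta_in theta_neq0 theta_mean theta_rate below.
apply: (powerful_of_separation (c := fun n => lnn n ^+ 2)).
- by move=> n; exact: (measurable_HC_thres_obs (F 0) (@K n) (@Y n) (@V n)).
- near=> n; rewrite exprn_gt0//; apply: (@lt_le_trans _ _ 1) => //.
  by near: n; exact: near_lnn_ge.
- by move=> e e0; exact: (null_HC_thres_small a0_gt0 J_vanishes J_derivative Q_rate Q_pos H0).
- move=> e e0; exact: (alternative_HC_thres_large a0_gt0 J_vanishes J_derivative
    theta_in F01 a0a rateE G_gt0 Q_rate beta_gt0 bebe' g1 fb H1).
Unshelve. all: by end_near.
Qed.
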